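(* Let $0<a<T$, let $p$ be a positive integer, and let $\alpha\in\mathbb{R}$ with $\alpha\neq 0,1,2,\dots$. Let $u(t)=\big(\log\frac{t}{a}\big)^{\sigma}$ with $\sigma>0$. Assume that the generating function $\omega_p(\zeta;\alpha)=\sum_{k=0}^{\infty}\omega_k^{(\alpha)}\zeta^k$ satisfies $$\text{(i)}\quad \omega_n^{(\alpha)}=O(n^{-\alpha-1})\ \ (n\to\infty),\qquad \text{(ii)}\quad \overline{\tau}^{-\alpha}\,\omega_p(e^{-\overline{\tau}};\alpha)-1=O(\overline{\tau}^{\,p})\ \ (\overline{\tau}\to 0).$$ For $N\in\mathbb{Z}^+$ put $\overline{\tau}=\frac1N\log\frac{T}{a}$ and $t_n=a\,(T/a)^{n/N}=a e^{n\overline{\tau}}$, $0\le n\le N$, and define the discrete convolution $$\mathbb{D}_{\overline{\tau},n}^{\alpha}u=\overline{\tau}^{-\alpha}\sum_{k=0}^{n}\omega_{n-k}^{(\alpha)}\,u(t_k).$$ Then, for $1\le n\le N$, $$\mathbb{D}_{\overline{\tau},n}^{\alpha}u-({}_HD_a^{\alpha}u)(t_n)=O\Big(\big(\log(t_n/a)\big)^{-\alpha-1}\,\overline{\tau}^{\,\sigma+1}\Big)+O\Big(\big(\log(t_n/a)\big)^{-\alpha+\sigma-p}\,\overline{\tau}^{\,p}\Big),$$ where the implied constants are independent of $\overline{\tau}$ and $n$.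
   Context: For $\alpha>0$ with $m-1<\alpha<m$, $m\in\mathbb{Z}^+$, the Hadamard fractional derivative of order $\alpha$ is $$({}_HD_a^{\alpha}f)(t)=\frac{\delta_t^m}{\Gamma(m-\alpha)}\int_a^t\Big(\log\frac ts\Big)^{m-\alpha-1}f(s)\frac{\mathrm{d}s}{s},\qquad \delta_t=t\frac{\mathrm{d}}{\mathrm{d}t}.$$ For $\alpha<0$, ${}_HD_a^{\alpha}$ denotes the Hadamard fractional integral of order $-\alpha$: $$({}_HD_a^{\alpha}f)(t)=({}_HI_a^{-\alpha}f)(t)=\frac{1}{\Gamma(-\alpha)}\int_a^t\Big(\log\frac ts\Big)^{-\alpha-1}f(s)\frac{\mathrm{d}s}{s}.$$ In the paper $\omega_p(\zeta;\alpha)$ is the generating function of a convolution quadrature of order $p$ for the Riemann-Liouville operator of order $\alpha$ (fractional integral of order $-\alpha$ if $\alpha<0$), this being expressed by conditions (i) and (ii).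
   Formalization: For real τ̄→0 in (ii) the claim fails (α=-1, p=σ=1, ω_n=1+cos(log²(n+1))); so ω_p is assumed to continue analytically near ζ=1 off the cut [1,∞), and (ii) is assumed for complex τ̄→0 in the plane cut along (-∞,0], principal branch; the weights are real. *)

(* Defs.v *)
From Stdlib Require Import Reals ZArith Lra Lia.
From Coquelicot Require Import Coquelicot.
Open Scope R_scope.

(* Real power of a nonnegative base with [0 ^ y = 0]; Stdlib has
   [Rpower 0 y = 1] because [ln 0 = 0], which would be wrong for
   [(log (t / a)) ^ sigma] at [t = a]. *)
Definition powr (x y : R) : R :=
  if Rlt_dec 0 x then Rpower x y else 0.

Definition Gamma (x : R) : R :=
  RInt_gen (fun s => powr s (x - 1) * exp (- s))
    (at_right 0) (Rbar_locally p_infty).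

(* int_a^t (log (t/s))^(beta-1) f(s) ds/s, improper at both end points. *)
Definition hadamard_kernel_int (a beta : R) (f : R -> R) (t : R) : R :=
  RInt_gen (fun s => powr (ln (t / s)) (beta - 1) * f s / s)
    (at_right a) (at_left t).

Definition hadamard_integral (a beta : R) (f : R -> R) (t : R) : R :=
  / Gamma beta * hadamard_kernel_int a beta f t.

Definition delta (f : R -> R) (t : R) : R := t * Derive f t.

(* For a non-integer [alpha > 0], [up alpha] is the integer m with
   m - 1 < alpha < m. *)
Definition hadamard_derivative (a alpha : R) (f : R -> R) (t : R) : R :=
  let m := Z.to_nat (up alpha) in
  / Gamma (INR m - alpha)
    * Nat.iter m delta (hadamard_kernel_int a (INR m - alpha) f) t.

Definition hadamard (a alpha : R) (f : R -> R) (t : R) : R :=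
  if Rlt_dec alpha 0 then hadamard_integral a (- alpha) f t
  else hadamard_derivative a alpha f t.

Definition bigO {T : Type} (F : (T -> Prop) -> Prop) (f g : T -> R) : Prop :=
  exists K : R, F (fun x => Rabs (f x) <= K * Rabs (g x)).

Definition Cexp (z : C) : C := (exp (Re z) * cos (Im z), exp (Re z) * sin (Im z)).

(* The complex plane without (-oo, 0]. *)
Definition cut_plane (z : C) : Prop := ~ (Re z <= 0 /\ Im z = 0).

(* Principal argument, in (-PI, PI), for [z] in [cut_plane]:
   tan (theta / 2) = sin theta / (1 + cos theta). *)
Definition Carg (z : C) : R := 2 * atan (Im z / (Cmod z + Re z)).

(* Principal branch of z ^ s. *)
Definition Cpowr (z : C) (s : R) : C :=
  (Rpower (Cmod z) s * cos (s * Carg z), Rpower (Cmod z) s * sin (s * Carg z)).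

(* [W] is the analytic function with Taylor coefficients [omega] at 0: the sum
   of the series in the unit disc, continued analytically around the branch
   point 1, off the cut [1, +oo). *)
Definition generating_function (omega : nat -> R) (W : C -> C) : Prop :=
  (forall z : C, Cmod z < 1 ->
     is_pseries (V := C_NormedModule) (fun k => RtoC (omega k)) z (W z)) /\
  within (fun z : C => cut_plane (1 - z)%C) (locally (RtoC 1))
    (fun z => ex_derive (K := C_AbsRing) (V := C_NormedModule) W z).

Definition stable (alpha : R) (omega : nat -> R) : Prop :=
  bigO eventually omega (fun n => Rpower (INR n) (- alpha - 1)).

(* tau ^ (-alpha) * W (e ^ (-tau)) - 1 = O (tau ^ p), where tau tends to 0 as a
   complex variable.  For tau tending to 0 along the positive reals only, this
   together with [stable] does not bound the quadrature error: for alpha = -1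
   and p = 1 take the weights omega_n = 1 + cos ((log (n + 1)) ^ 2). *)
Definition consistent (alpha : R) (p : nat) (W : C -> C) : Prop :=
  bigO (within cut_plane (locally (RtoC 0)))
    (fun tau : C => Cmod (Cpowr tau (- alpha) * W (Cexp (- tau)) - 1)%C)
    (fun tau : C => Cmod tau ^ p).

Definition step (a T : R) (N : nat) : R := / INR N * ln (T / a).

Definition node (a T : R) (N n : nat) : R := a * Rpower (T / a) (INR n / INR N).

Definition discrete_convolution (a T alpha : R) (omega : nat -> R)
    (u : R -> R) (N n : nat) : R :=
  Rpower (step a T N) (- alpha)
    * sum_f_R0 (fun k => omega (n - k)%nat * u (node a T N k)) n.

(* Main.v *)
(* Put x = log (t / a), so that t_k corresponds to x = k tau.  By homogeneity the
   claim is the asymptotic formula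
     sum_{m < n} omega_m (n - m)^sigma
       = Gamma(sigma+1) / Gamma(sigma-alpha+1) n^(sigma-alpha)
         + O(n^(-alpha-1)) + O(n^(sigma-alpha-p)).
   Let w be an entire function with w = 1 + O(z^M) at 0 and zeros of order M at
   +-i d.  The integrals K(k) of z^(-sigma-1) w(z) e^(k z) over the short segment
   [c - i d, c + i d] are, by deforming the segment into a Hankel contour, equal to
   k^sigma * 2 pi i / Gamma(sigma+1) up to O(k^(-M')) for k >= 1, and O(|k|^(-M'))
   for k <= 0.  Since W(e^(-z)) = sum omega_m e^(-m z), the sum is therefore, up to
   O(n^(-alpha-1)) by stability, the integral of W(e^(-z)) z^(-sigma-1) w(z) e^(n z)
   over the same segment.  This only sees W near 1, where W(e^(-z)) = z^alpha (1 + O(z^p));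
   a second deformation gives the main term and the error O(n^(sigma-alpha-p)).
   Hankel's constant is identified through the coefficients of (1 - z)^(-s-1),
   and the Hadamard operator on powers through Gauss' product for the beta
   function. *)
Require Import Defs.
From Stdlib Require Import Reals ZArith Arith Lra Lia.
From Coquelicot Require Import Coquelicot.
Open Scope R_scope.

(** * Complex differentiability *)

(** The window is there because [W] is controlled only near 1. A plain segment of half height [d]
    would leave end-point terms of relative size [1 / k], whereas zeros of order [M] at the ends
    leave [k^(-M)] for any prescribed [M]. This freedom is essential: the errors of all moments are
    summed against weights that may grow, and Peetre's inequality bounds that sum by the size of a
    single weight at [n], provided the errors decay fast enough. The abscissa [c = d / (2 n)] keeps
    [e^(n z)] bounded on the segment, keeps the series convergent, and serves all moments [n - m] at
    once. Every contour has sides parallel to the axes, so Goursat's theorem for rectangles is the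
    only form of Cauchy's theorem involved. The reciprocal [1 / Gamma (s + 1)] is carried as the
    contour constant [inv_gamma], defined for every real [s] and zero at the negative integers, so a
    pole of Gamma at [sigma - alpha + 1] needs no separate case. On the real side, powers are
    substituted so that beta and gamma integrals have continuous integrands. *)

Definition Cderiv (f : C -> C) (z l : C) : Prop :=
  is_derive (K := C_AbsRing) (V := AbsRing_NormedModule C_AbsRing) f z l.

(** [C] carries two normed structures: the one with the uniform structure of a product, which occurs
    in [generating_function], and the one of a ring over itself, which the product and chain rules
    refer to. [Cderiv] uses the second; this is the bridge from the first. *)
Lemma Cderiv_of_is_derive f z l :
  is_derive (K := C_AbsRing) (V := C_NormedModule) f z l -> Cderiv f z l.
Proof. intros [[a b c] H]. split; [split; assumption | exact H]. Qed.

Lemma Cderiv_eps f z l : Cderiv f z l <->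
  forall eps, 0 < eps -> exists d, 0 < d /\
    forall y, Cmod (y - z) < d -> Cmod (f y - f z - l * (y - z)) <= eps * Cmod (y - z).
Proof.
split.
- intros [_ H] eps he.
  assert (L : is_filter_lim (locally (T := AbsRing_UniformSpace C_AbsRing) z) z)
    by (intros P HP; exact HP).
  destruct (H z L (mkposreal eps he)) as [d Hd]; exists d; split; [apply cond_pos|].
  intros y hy; specialize (Hd y hy).
  unfold norm, minus, plus, opp in Hd; cbn in Hd; unfold abs in Hd; simpl in Hd.
  replace (l * (y - z))%C with ((y - z) * l)%C by ring; exact Hd.
- intros H; split; [apply is_linear_scal_l|].
  intros x L [eps he].
  pose proof (is_filter_lim_locally_unique (V := AbsRing_NormedModule C_AbsRing) z x L) as e; rewrite <- e.
  destruct (H eps he) as [d [hd Hd]]; exists (mkposreal d hd); intros y hy.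
  specialize (Hd y hy); simpl.
  unfold norm, minus, plus, opp; simpl; unfold abs; simpl.
  replace (scal _ _) with (l * (y - z))%C; [exact Hd|].
  unfold scal; simpl; unfold mult; simpl; ring.
Qed.

Lemma Cderiv_const c z : Cderiv (fun _ => c) z 0%C.
Proof. apply (is_derive_const (K := C_AbsRing) (V := AbsRing_NormedModule C_AbsRing)). Qed.

Lemma Cderiv_id z : Cderiv (fun z => z) z 1%C.
Proof. apply (is_derive_id (K := C_AbsRing)). Qed.

Lemma Cderiv_plus f g z a b :
  Cderiv f z a -> Cderiv g z b -> Cderiv (fun z => f z + g z)%C z (a + b)%C.
Proof. intros H1 H2; apply (is_derive_plus (K := C_AbsRing) (V := AbsRing_NormedModule C_AbsRing) f g z a b H1 H2). Qed.

Lemma Cderiv_mult f g z a b : Cderiv f z a -> Cderiv g z b ->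
  Cderiv (fun z => f z * g z)%C z (a * g z + f z * b)%C.
Proof.
intros H1 H2; apply (is_derive_mult (K := C_AbsRing) f g z a b H1 H2 Cmult_comm).
Qed.

Lemma Cderiv_comp f g z a b : Cderiv f (g z) a -> Cderiv g z b ->
  Cderiv (fun z => f (g z)) z (b * a)%C.
Proof.
intros H1 H2.
exact (is_derive_comp (K := C_AbsRing) (V := AbsRing_NormedModule C_AbsRing)
         f g z a b H1 H2).
Qed.

Lemma Cderiv_scal c f z a : Cderiv f z a -> Cderiv (fun z => c * f z)%C z (c * a)%C.
Proof.
intros H; replace (c * a)%C with (0 * f z + c * a)%C by ring.
exact (Cderiv_mult _ _ _ _ _ (Cderiv_const c z) H).
Qed.

Lemma Cderiv_opp f z a : Cderiv f z a -> Cderiv (fun z => - f z)%C z (- a)%C.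
Proof. intros H; apply (is_derive_opp (K := C_AbsRing) (V := AbsRing_NormedModule C_AbsRing) f z a H). Qed.

Lemma Cderiv_minus f g z a b :
  Cderiv f z a -> Cderiv g z b -> Cderiv (fun z => f z - g z)%C z (a - b)%C.
Proof. intros H1 H2; exact (Cderiv_plus _ _ _ _ _ H1 (Cderiv_opp _ _ _ H2)). Qed.

Definition Cdiff (f : C -> C) (z : C) : Prop := exists l, Cderiv f z l.

Lemma Cdiff_const c z : Cdiff (fun _ => c) z.
Proof. eexists; apply Cderiv_const. Qed.
Lemma Cdiff_id z : Cdiff (fun z => z) z.
Proof. eexists; apply Cderiv_id. Qed.
Lemma Cdiff_plus f g z : Cdiff f z -> Cdiff g z -> Cdiff (fun z => f z + g z)%C z.
Proof. intros [a H] [b K]; eexists; apply Cderiv_plus; eassumption. Qed.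
Lemma Cdiff_minus f g z : Cdiff f z -> Cdiff g z -> Cdiff (fun z => f z - g z)%C z.
Proof. intros [a H] [b K]; eexists; apply Cderiv_minus; eassumption. Qed.
Lemma Cdiff_opp f z : Cdiff f z -> Cdiff (fun z => - f z)%C z.
Proof. intros [a H]; eexists; apply Cderiv_opp; eassumption. Qed.
Lemma Cdiff_mult f g z : Cdiff f z -> Cdiff g z -> Cdiff (fun z => f z * g z)%C z.
Proof. intros [a H] [b K]; eexists; apply Cderiv_mult; eassumption. Qed.
Lemma Cdiff_comp f g z : Cdiff f (g z) -> Cdiff g z -> Cdiff (fun z => f (g z)) z.
Proof. intros [a H] [b K]; eexists; apply Cderiv_comp; eassumption. Qed.
Lemma Cdiff_pow f n z : Cdiff f z -> Cdiff (fun z => f z ^ n)%C z.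
Proof.
intros H; induction n as [|n IH]; simpl; [apply (Cdiff_const 1%C)|].
exact (Cdiff_mult f (fun z => f z ^ n)%C z H IH).
Qed.

Lemma Cmod_le_abs (z : C) : Cmod z <= Rabs (Re z) + Rabs (Im z).
Proof.
destruct z as [x y]; unfold Cmod; simpl.
assert (0 <= Rabs x) by apply Rabs_pos; assert (0 <= Rabs y) by apply Rabs_pos.
rewrite <- (sqrt_Rsqr (Rabs x + Rabs y)) by lra.
apply sqrt_le_1_alt; unfold Rsqr.
assert (x * (x * 1) = Rabs x * Rabs x) by (rewrite <- Rabs_mult; rewrite Rabs_pos_eq; nra).
assert (y * (y * 1) = Rabs y * Rabs y) by (rewrite <- Rabs_mult; rewrite Rabs_pos_eq; nra).
nra.
Qed.

Lemma abs_Re_le (z : C) : Rabs (Re z) <= Cmod z.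
Proof. apply re_le_Cmod. Qed.

Lemma abs_Im_le (z : C) : Rabs (Im z) <= Cmod z.
Proof. eapply Rle_trans; [|apply Rmax_Cmod]; apply Rmax_r. Qed.

Lemma Cmod_triangle_inv (x y : C) : Cmod x - Cmod y <= Cmod (x + y).
Proof.
replace x with ((x + y) + - y)%C at 1 by ring.
pose proof (Cmod_triangle (x + y) (- y)) as H; rewrite Cmod_opp in H; lra.
Qed.

(** Integrability along a contour asks for continuity in the real parameter, in the product topology
    of [C]. On a Lipschitz path the increment of [f] is at most [(1 + |l|) L' |y - x|]. *)
Lemma Cdiff_continuous_path f (g : R -> C) x : Cdiff f (g x) ->
  (exists L, forall y, Cmod (g y - g x) <= L * Rabs (y - x)) ->
  continuous (U := C_UniformSpace) (fun t => f (g t)) x.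
Proof.
intros [l Hl] [L HL].
rewrite Cderiv_eps in Hl; destruct (Hl 1 Rlt_0_1) as [d [hd Hd]].
apply filterlim_locally; intros [eps he].
set (L' := Rabs L + 1); assert (hL : 0 < L') by (unfold L'; pose proof (Rabs_pos L); lra).
set (B := (1 + Cmod l) * L').
assert (hB : 0 < B) by (unfold B; pose proof (Cmod_ge_0 l); apply Rmult_lt_0_compat; lra).
assert (hr : 0 < Rmin (d / L') (eps / B)).
{ apply Rmin_pos; apply Rdiv_lt_0_compat; assumption. }
exists (mkposreal _ hr); intros y hy.
change (Rabs (y - x) < Rmin (d / L') (eps / B)) in hy.
assert (h1 : Rabs (y - x) < d / L') by (eapply Rlt_le_trans; [exact hy | apply Rmin_l]).
assert (h2 : Rabs (y - x) < eps / B) by (eapply Rlt_le_trans; [exact hy | apply Rmin_r]).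
apply (Rmult_lt_compat_l L') in h1; [|exact hL].
apply (Rmult_lt_compat_l B) in h2; [|exact hB].
replace (L' * (d / L')) with d in h1 by (field; lra).
replace (B * (eps / B)) with eps in h2 by (field; lra).
assert (hg : Cmod (g y - g x) <= L' * Rabs (y - x)).
{ eapply Rle_trans; [apply HL|]; apply Rmult_le_compat_r; [apply Rabs_pos|].
  unfold L'; pose proof (Rle_abs L); lra. }
assert (hf : Cmod (f (g y) - f (g x)) <= B * Rabs (y - x)).
{ replace (f (g y) - f (g x))%C
    with ((f (g y) - f (g x) - l * (g y - g x)) + l * (g y - g x))%C by ring.
  eapply Rle_trans; [apply Cmod_triangle|]; rewrite Cmod_mult.
  assert (Cmod (g y - g x) < d) by lra.
  specialize (Hd _ H); unfold B.
  pose proof (Cmod_ge_0 l); pose proof (Cmod_ge_0 (g y - g x)); nra. }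
apply (C_NormedModule_mixin_compat1 _ _ eps).
change (Cmod (f (g y) - f (g x)) < eps); lra.
Qed.

Lemma Cdiff_continuous_h f x y : Cdiff f (x, y) ->
  continuous (U := C_UniformSpace) (fun t => f (t, y)) x.
Proof.
intros H; apply (Cdiff_continuous_path f (fun t => (t, y)) x H).
exists 1; intros t; eapply Rle_trans; [apply Cmod_le_abs|]; simpl.
replace (y + - y) with 0 by ring; rewrite Rabs_R0; unfold Rminus; lra.
Qed.

Lemma Cdiff_continuous_v f x y : Cdiff f (x, y) ->
  continuous (U := C_UniformSpace) (fun t => f (x, t)) y.
Proof.
intros H; apply (Cdiff_continuous_path f (fun t => (x, t)) y H).
exists 1; intros t; eapply Rle_trans; [apply Cmod_le_abs|]; simpl.
replace (x + - x) with 0 by ring; rewrite Rabs_R0; unfold Rminus; lra.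
Qed.

(** * The complex exponential *)

Lemma Cexp_plus z w : Cexp (z + w) = (Cexp z * Cexp w)%C.
Proof.
unfold Cexp; rewrite re_plus, im_plus, exp_plus, cos_plus, sin_plus.
apply injective_projections; simpl; ring.
Qed.

Lemma Cexp_0 : Cexp 0 = 1%C.
Proof. unfold Cexp; simpl; rewrite exp_0, cos_0, sin_0; apply injective_projections; simpl; lra. Qed.

Lemma Cmod_Cexp z : Cmod (Cexp z) = exp (Re z).
Proof.
unfold Cmod, Cexp; simpl.
replace (_ + _) with (Rsqr (exp (Re z)) * (Rsqr (sin (Im z)) + Rsqr (cos (Im z)))) by (unfold Rsqr; ring).
rewrite sin2_cos2, Rmult_1_r, sqrt_Rsqr; [reflexivity | left; apply exp_pos].
Qed.

(** The upper bound is [1 - x <= exp (- x)] inverted: [exp x <= 1 / (1 - x)], and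
    [1 / (1 - x) <= 1 + x + 2 x^2] for [|x| <= 1/2]. *)
Lemma exp_quad x : Rabs x <= 1 / 2 -> Rabs (exp x - 1 - x) <= 2 * x ^ 2.
Proof.
intros h; apply Rabs_le_between in h.
assert (h1 : 1 + x <= exp x) by apply exp_ineq1_le.
assert (h2 : exp x <= 1 + x + 2 * x ^ 2).
{ assert (h3 : 1 + - x <= exp (- x)) by apply exp_ineq1_le.
  assert (h4 : exp x * exp (- x) = 1) by (rewrite <- exp_plus, Rplus_opp_r; apply exp_0).
  assert (0 < exp x) by apply exp_pos.
  assert (exp x * (1 - x) <= 1) by nra.
  nra. }
rewrite Rabs_pos_eq; nra.
Qed.

(** [cos y - 1 = - 2 sin^2 (y / 2)], and the sine is bounded by its argument through the mean value
    theorem. *)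
Lemma cos_quad y : Rabs (cos y - 1) <= y ^ 2 / 2.
Proof.
replace y with (2 * (y / 2)) at 1 by field.
rewrite cos_2a_sin.
assert (h : Rabs (sin (y / 2)) <= Rabs (y / 2)).
{ destruct (MVT_cor4 sin cos 0 (mkposreal (Rabs (y / 2) + 1)
    ltac:(pose proof (Rabs_pos (y/2)); lra))) with (b := y / 2) as [c [hc _]].
  - intros c _; apply is_derive_Reals, derivable_pt_lim_sin.
  - simpl; rewrite Rminus_0_r; lra.
  - rewrite sin_0, !Rminus_0_r in hc; rewrite hc, Rabs_mult.
    assert (Rabs (cos c) <= 1) by (apply Rabs_le; apply COS_bound).
    pose proof (Rabs_pos (y / 2)); nra. }
apply Rsqr_le_abs_1 in h; unfold Rsqr in h.
rewrite Rabs_left1; nra.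
Qed.

Lemma sin_quad y : Rabs y <= 1 -> Rabs (sin y - y) <= y ^ 2.
Proof.
intros hy.
destruct (MVT_cor4 (fun t => sin t - t) (fun t => cos t - 1) 0
  (mkposreal (Rabs y + 1) ltac:(pose proof (Rabs_pos y); lra))) with (b := y) as [c [hc hc2]].
- intros c _; apply is_derive_Reals, derivable_pt_lim_minus; [apply derivable_pt_lim_sin | apply derivable_pt_lim_id].
- simpl; rewrite Rminus_0_r; lra.
- rewrite sin_0, !Rminus_0_r in hc; rewrite hc, Rabs_mult.
  rewrite !Rminus_0_r in hc2.
  pose proof (cos_quad c) as h; apply Rsqr_le_abs_1 in hc2; unfold Rsqr in hc2.
  replace (y ^ 2) with (Rabs y * Rabs y) by (rewrite <- Rabs_mult, Rabs_pos_eq; nra).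
  assert (y * y = Rabs y * Rabs y) by (rewrite <- Rabs_mult, Rabs_pos_eq; nra).
  pose proof (Rabs_pos y); apply Rmult_le_compat_r; [lra|]; nra.
Qed.

(** Both components are split into quadratic pieces. The explicit constant matters later:
    [10 r^2 <= r / 2] as soon as [r <= 1/20], which is the origin of the numbers 1/20 and 1/40
    below. *)
Lemma Cexp_quad (h : C) : Cmod h <= 1 / 2 -> Cmod (Cexp h - 1 - h) <= 10 * Cmod h ^ 2.
Proof.
intros hh.
pose proof (abs_Re_le h) as hx; pose proof (abs_Im_le h) as hy.
eapply Rle_trans; [apply Cmod_le_abs|].
destruct h as [x y]; unfold Cexp; simpl in *.
set (r := Cmod (x, y)) in *.
assert (h1 : Rabs (exp x - 1 - x) <= 2 * x ^ 2) by (apply exp_quad; lra).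
assert (h2 := cos_quad y).
assert (h3 : Rabs (sin y - y) <= y ^ 2) by (apply sin_quad; lra).
assert (hxx : x ^ 2 <= r ^ 2) by (rewrite <- (pow2_abs x); pose proof (Rabs_pos x); nra).
assert (hyy : y ^ 2 <= r ^ 2) by (rewrite <- (pow2_abs y); pose proof (Rabs_pos y); nra).
assert (he : exp x <= 2).
{ apply Rabs_le_between in h1; assert (0 <= r) by apply Cmod_ge_0.
  assert (r ^ 2 <= 1 / 4) by nra; assert (x <= 1/2) by (apply Rabs_le_between in hx; lra); lra. }
assert (he0 := exp_pos x).
replace (exp x * cos y + - (1) + - x) with ((exp x - 1 - x) + exp x * (cos y - 1)) by ring.
replace (exp x * sin y + - 0 + - y) with ((exp x - 1) * y + exp x * (sin y - y)) by ring.
assert (A1 : Rabs ((exp x - 1 - x) + exp x * (cos y - 1)) <= 2 * x ^ 2 + 2 * (y ^ 2 / 2)).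
{ eapply Rle_trans; [apply Rabs_triang|]; rewrite Rabs_mult, (Rabs_pos_eq (exp x)) by lra.
  pose proof (Rabs_pos (cos y - 1)); nra. }
assert (A3 : Rabs (exp x - 1) <= 2 * r).
{ replace (exp x - 1) with ((exp x - 1 - x) + x) by ring.
  assert (0 <= r) by apply Cmod_ge_0; assert (r ^ 2 <= r / 2) by nra.
  eapply Rle_trans; [apply Rabs_triang|]; lra. }
assert (A2 : Rabs ((exp x - 1) * y + exp x * (sin y - y)) <= 2 * r * r + 2 * y ^ 2).
{ eapply Rle_trans; [apply Rabs_triang|]; rewrite !Rabs_mult, (Rabs_pos_eq (exp x)) by lra.
  apply Rplus_le_compat; apply Rmult_le_compat; try apply Rabs_pos; lra. }
simpl in A1, A2, hxx, hyy; nra.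
Qed.

Lemma Cderiv_Cexp z : Cderiv Cexp z (Cexp z).
Proof.
apply Cderiv_eps; intros eps he.
assert (hp : 0 < exp (Re z)) by apply exp_pos.
exists (Rmin (1 / 2) (eps / (10 * exp (Re z)))); split.
{ apply Rmin_pos; [lra | apply Rdiv_lt_0_compat; lra]. }
intros y hy.
set (h := (y - z)%C) in *.
replace y with (z + h)%C by (unfold h; ring).
rewrite Cexp_plus.
replace (Cexp z * Cexp h - Cexp z - Cexp z * h)%C with (Cexp z * (Cexp h - 1 - h))%C by ring.
rewrite Cmod_mult, Cmod_Cexp.
assert (h1 : Cmod h <= 1 / 2) by (left; eapply Rlt_le_trans; [exact hy | apply Rmin_l]).
assert (h2 : Cmod h < eps / (10 * exp (Re z))) by (eapply Rlt_le_trans; [exact hy | apply Rmin_r]).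
apply (Rmult_lt_compat_l (10 * exp (Re z))) in h2; [|lra].
replace (10 * exp (Re z) * (eps / (10 * exp (Re z)))) with eps in h2 by (field; lra).
pose proof (Cexp_quad h h1); pose proof (Cmod_ge_0 h); nra.
Qed.

Lemma Cdiff_Cexp f z : Cdiff f z -> Cdiff (fun z => Cexp (f z)) z.
Proof. intros H; apply (Cdiff_comp Cexp f); [eexists; apply Cderiv_Cexp | exact H]. Qed.

(** * The principal logarithm and powers *)

Lemma Cmod_sqr z : Cmod z * Cmod z = Re z * Re z + Im z * Im z.
Proof. pose proof (Cmod2_alt z); simpl in H; lra. Qed.

Lemma cut_plane_pos z : cut_plane z -> 0 < Cmod z /\ 0 < Cmod z + Re z.
Proof.
intros H; pose proof (Cmod_sqr z) as h; pose proof (Cmod_ge_0 z) as h0.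
unfold cut_plane in H.
destruct (Rle_dec (Re z) 0) as [hx|hx].
- assert (hy : Im z <> 0) by tauto.
  assert (0 < Im z * Im z) by (apply Rsqr_pos_lt in hy; exact hy).
  split; nra.
- split; nra.
Qed.

Lemma cut_plane_neq0 z : cut_plane z -> z <> 0%C.
Proof. intros H; apply Cmod_gt_0, cut_plane_pos, H. Qed.

Lemma cos_double_atan u : cos (2 * atan u) = (1 - u * u) / (1 + u * u).
Proof.
assert (h : 0 < 1 + u * u) by nra.
rewrite cos_2a_cos, cos_atan.
assert (hs : sqrt (1 + u²) * sqrt (1 + u²) = 1 + u * u)
  by (rewrite sqrt_sqrt; unfold Rsqr; lra).
assert (0 < sqrt (1 + u²)) by (apply sqrt_lt_R0; unfold Rsqr; lra).
replace (2 * (1 / sqrt (1 + u²)) * (1 / sqrt (1 + u²)))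
  with (2 / (sqrt (1 + u²) * sqrt (1 + u²))) by (field; lra).
rewrite hs; field; lra.
Qed.

Lemma sin_double_atan u : sin (2 * atan u) = 2 * u / (1 + u * u).
Proof.
assert (h : 0 < 1 + u * u) by nra.
rewrite sin_2a, cos_atan, sin_atan.
assert (hs : sqrt (1 + u²) * sqrt (1 + u²) = 1 + u * u)
  by (rewrite sqrt_sqrt; unfold Rsqr; lra).
assert (0 < sqrt (1 + u²)) by (apply sqrt_lt_R0; unfold Rsqr; lra).
replace (2 * (u / sqrt (1 + u²)) * (1 / sqrt (1 + u²)))
  with (2 * u / (sqrt (1 + u²) * sqrt (1 + u²))) by (field; lra).
rewrite hs; field; lra.
Qed.

(** [Carg] is twice a half angle, so the double-angle formulas apply with [u = y / (r + x)]; from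
    [y^2 = (r - x) (r + x)] one gets [1 + u^2 = 2 r / (r + x)] and [1 - u^2 = 2 x / (r + x)]. *)
Lemma Carg_polar z : cut_plane z ->
  Cmod z * cos (Carg z) = Re z /\ Cmod z * sin (Carg z) = Im z.
Proof.
intros H; destruct (cut_plane_pos z H) as [h1 h2].
pose proof (Cmod_sqr z) as h.
unfold Carg; rewrite cos_double_atan, sin_double_atan.
set (r := Cmod z) in *; set (x := Re z) in *; set (y := Im z) in *.
assert (hy : y * y = (r - x) * (r + x)) by lra.
assert (e : 1 + y / (r + x) * (y / (r + x)) = 2 * r / (r + x)).
{ replace (y / (r + x) * (y / (r + x))) with (y * y / ((r + x) * (r + x))) by (field; lra).
  rewrite hy; field; lra. }
assert (e' : 1 - y / (r + x) * (y / (r + x)) = 2 * x / (r + x)) by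
  (replace (1 - y / (r + x) * (y / (r + x)))
     with (2 - (1 + y / (r + x) * (y / (r + x)))) by ring; rewrite e; field; lra).
rewrite e, e'; split; field; lra.
Qed.

Definition Clog (z : C) : C := (ln (Cmod z), Carg z).

Lemma Cexp_Clog z : cut_plane z -> Cexp (Clog z) = z.
Proof.
intros H; destruct (Carg_polar z H) as [h1 h2].
unfold Cexp, Clog; simpl; rewrite exp_ln by apply (cut_plane_pos z H).
rewrite h1, h2; symmetry; apply surjective_pairing.
Qed.

Lemma Cpowr_Cexp z s : Cpowr z s = Cexp (s * Clog z).
Proof.
unfold Cpowr, Cexp, Clog, Rpower; simpl.
apply injective_projections; simpl; f_equal; f_equal; ring.
Qed.

Lemma continuous_Cmod z : continuous (T := C_UniformSpace) Cmod z.
Proof.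
apply filterlim_locally; intros eps.
assert (he : 0 < eps / 2) by (pose proof (cond_pos eps); lra).
exists (mkposreal _ he); intros y hy.
apply C_NormedModule_mixin_compat2 in hy; simpl in hy.
assert (hs : sqrt 2 <= 2).
{ rewrite <- (sqrt_Rsqr 2) at 2 by lra; apply sqrt_le_1_alt; unfold Rsqr; lra. }
change (Cmod (y - z) < sqrt 2 * (eps / 2)) in hy.
change (Rabs (Cmod y - Cmod z) < eps).
pose proof (Cmod_triangle_inv y (- z)) as a; pose proof (Cmod_triangle_inv z (- y)) as b.
rewrite Cmod_opp in a, b.
replace (z + - y)%C with (- (y - z))%C in b by ring; rewrite Cmod_opp in b.
change (y + - z)%C with (y - z)%C in a.
apply Rabs_def1; nra.
Qed.

(** Continuity comes before the derivative, because inverting [Cexp] requires [Clog y - Clog z] to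
    be small a priori. *)
Lemma Clog_continuous z : cut_plane z -> forall eps, 0 < eps ->
  exists d, 0 < d /\ forall y, Cmod (y - z) < d -> Cmod (Clog y - Clog z) < eps.
Proof.
intros H eps he; destruct (cut_plane_pos z H) as [h1 h2].
assert (C1 : continuous (T := C_UniformSpace) (fun z => ln (Cmod z)) z).
{ apply (continuous_comp (U := C_UniformSpace) Cmod ln z (continuous_Cmod z)).
  apply (ex_derive_continuous (V := R_NormedModule)); auto_derive; exact h1. }
assert (C2 : continuous (T := C_UniformSpace) Carg z).
{ unfold Carg; apply (continuous_scal_r (U := C_UniformSpace) (K := R_AbsRing) (V := R_NormedModule) 2).
  apply (continuous_comp (U := C_UniformSpace) (fun z => Im z / (Cmod z + Re z)) atan z).
  - apply (continuous_mult (U := C_UniformSpace) (K := R_AbsRing)).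
    + destruct z as [x y]; apply (continuous_snd (U := R_UniformSpace) (V := R_UniformSpace)).
    + apply (continuous_comp (U := C_UniformSpace) (fun z => Cmod z + Re z) Rinv z);
        [|apply continuous_Rinv; lra].
      apply (continuous_plus (U := C_UniformSpace) (K := R_AbsRing) (V := R_NormedModule)).
      * apply continuous_Cmod.
      * destruct z as [x y]; apply (continuous_fst (U := R_UniformSpace) (V := R_UniformSpace)).
  - apply (ex_derive_continuous (V := R_NormedModule)); eexists; apply is_derive_Reals, derivable_pt_lim_atan. }
assert (he2 : 0 < eps / 2) by lra.
apply filterlim_locally with (eps := mkposreal _ he2) in C1.
apply filterlim_locally with (eps := mkposreal _ he2) in C2.
destruct (filter_and _ _ C1 C2) as [d Hd].
exists d; split; [apply cond_pos|]; intros y hy.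
destruct (Hd y) as [A1 A2]; [apply C_NormedModule_mixin_compat1; exact hy|].
change (Rabs (ln (Cmod y) - ln (Cmod z)) < eps / 2) in A1.
change (Rabs (Carg y - Carg z) < eps / 2) in A2.
eapply Rle_lt_trans; [apply Cmod_le_abs|]; simpl.
unfold Rminus in *; lra.
Qed.

(** Inverse function argument: with [w = Clog y - Clog z] one has [y = z e^w], hence
    [w - (y - z) / z = - r] where [r = e^w - 1 - w] is quadratic in [w]. *)
Lemma Cderiv_Clog z : cut_plane z -> Cderiv Clog z (/ z)%C.
Proof.
intros H; pose proof (cut_plane_neq0 z H) as hz.
destruct (cut_plane_pos z H) as [hm hm2].
apply Cderiv_eps; intros eps he.
destruct (Clog_continuous z H (Rmin (1 / 20) (eps * Cmod z / 20))) as [d1 [hd1 Hd1]].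
{ apply Rmin_pos; [lra|]; apply Rdiv_lt_0_compat; [nra | lra]. }
(* A point [y] of the cut satisfies [|y| = - Re y], which forces [|z| + Re z <= 2 |y - z|]; the
   second radius excludes that. *)
exists (Rmin d1 (Rmin (Cmod z) (Cmod z + Re z) / 3)); split.
{ apply Rmin_pos; [lra|]; apply Rdiv_lt_0_compat; [apply Rmin_pos; lra | lra]. }
intros y hy.
assert (hy1 : Cmod (y - z) < d1) by (eapply Rlt_le_trans; [exact hy | apply Rmin_l]).
assert (hy2 : Cmod (y - z) < Rmin (Cmod z) (Cmod z + Re z) / 3)
  by (eapply Rlt_le_trans; [exact hy | apply Rmin_r]).
pose proof (Rmin_r (Cmod z) (Cmod z + Re z)).
pose proof (Rmin_l (Cmod z) (Cmod z + Re z)).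
assert (hcut : cut_plane y).
{ intros [c1 c2].
  assert (e1 : Cmod y <= - Re y).
  { eapply Rle_trans; [apply Cmod_le_abs|]; rewrite c2, Rabs_R0, Rabs_left1; lra. }
  pose proof (abs_Re_le (y - z)) as e2; apply Rabs_le_between in e2.
  pose proof (Cmod_triangle_inv z (y - z)) as e3.
  replace (z + (y - z))%C with y in e3 by ring.
  replace (Re (y - z)) with (Re y - Re z) in e2 by (unfold Re; simpl; ring). lra. }
specialize (Hd1 y hy1).
set (w := (Clog y - Clog z)%C) in *.
assert (hw1 : Cmod w < 1 / 20) by (eapply Rlt_le_trans; [exact Hd1 | apply Rmin_l]).
assert (hw2 : Cmod w < eps * Cmod z / 20) by (eapply Rlt_le_trans; [exact Hd1 | apply Rmin_r]).
assert (hyw : y = (z * Cexp w)%C).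
{ rewrite <- (Cexp_Clog y hcut), <- (Cexp_Clog z H) at 1.
  rewrite <- Cexp_plus; f_equal; unfold w; ring. }
assert (hr := Cexp_quad w ltac:(lra)).
set (r := (Cexp w - 1 - w)%C) in *.
assert (hyz : (y - z = z * (w + r))%C) by (unfold r; rewrite hyw; ring).
assert (E : (w - / z * (y - z) = - r)%C) by (rewrite hyz; field; exact hz).
rewrite E, Cmod_opp.
(* Since [|w| < 1/20], the remainder is at most [|w| / 2], so [w] itself is controlled by
   [y - z]. *)
assert (h3 : Cmod w * Cmod z <= 2 * Cmod (y - z)).
{ rewrite hyz, Cmod_mult.
  pose proof (Cmod_triangle_inv w r); pose proof (Cmod_ge_0 w).
  assert (Cmod r <= Cmod w / 2) by (simpl in hr; nra).
  assert (Cmod w / 2 <= Cmod (w + r)) by lra; nra. }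
pose proof (Cmod_ge_0 w); pose proof (Cmod_ge_0 (y - z)).
apply (Rmult_le_reg_r (Cmod z)); [exact hm|]; simpl in hr; nra.
Qed.

Lemma Cmod_Cpowr z s : Cmod (Cpowr z s) = Rpower (Cmod z) s.
Proof. rewrite Cpowr_Cexp, Cmod_Cexp; unfold Rpower; f_equal; simpl; ring. Qed.

Lemma Cpowr_plus z s t : Cpowr z (s + t) = (Cpowr z s * Cpowr z t)%C.
Proof. rewrite !Cpowr_Cexp, <- Cexp_plus; f_equal; rewrite RtoC_plus; ring. Qed.

Lemma Cpowr_0 z : Cpowr z 0 = 1%C.
Proof. rewrite Cpowr_Cexp, Cmult_0_l; apply Cexp_0. Qed.

Lemma Cpowr_1 z : cut_plane z -> Cpowr z 1 = z.
Proof. intros H; rewrite Cpowr_Cexp, Cmult_1_l; apply Cexp_Clog, H. Qed.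

Lemma Cderiv_Cpowr z s : cut_plane z ->
  Cderiv (fun z => Cpowr z s) z (s * Cpowr z (s - 1))%C.
Proof.
intros H.
replace (s * Cpowr z (s - 1))%C with ((s * / z) * Cexp (s * Clog z))%C.
- assert (D : Cderiv (fun z => Cexp (s * Clog z)) z ((s * / z) * Cexp (s * Clog z))%C).
  { apply (Cderiv_comp Cexp (fun z => s * Clog z)%C); [apply Cderiv_Cexp|].
    apply Cderiv_scal, Cderiv_Clog, H. }
  apply (is_derive_ext (K := C_AbsRing) (V := AbsRing_NormedModule C_AbsRing)
           (fun z => Cexp (s * Clog z)%C)); [|exact D].
  intros t; symmetry; apply Cpowr_Cexp.
- rewrite <- Cpowr_Cexp; replace s with ((s - 1) + 1) at 2 by ring.
  rewrite Cpowr_plus, (Cpowr_1 z H); field; apply cut_plane_neq0, H.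
Qed.

Lemma Cdiff_Cpowr f s z : cut_plane (f z) -> Cdiff f z -> Cdiff (fun z => Cpowr (f z) s) z.
Proof.
intros H1 H2; apply (Cdiff_comp (fun z => Cpowr z s) f); [|exact H2].
eexists; apply Cderiv_Cpowr, H1.
Qed.

Lemma Carg_scal r z : 0 < r -> Carg (r * z) = Carg z.
Proof.
intros hr; unfold Carg.
rewrite Cmod_mult, Cmod_R, Rabs_pos_eq, im_scal_l, re_scal_l by lra.
f_equal; f_equal; rewrite <- Rmult_plus_distr_l.
unfold Rdiv; rewrite Rinv_mult.
replace (r * Im z * (/ r * / (Cmod z + Re z))) with (r * / r * (Im z * / (Cmod z + Re z))) by ring.
rewrite Rinv_r by lra; ring.
Qed.

Lemma Cpowr_scal r z s : 0 < r -> 0 < Cmod z ->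
  Cpowr (r * z) s = (Rpower r s * Cpowr z s)%C.
Proof.
intros hr hz; unfold Cpowr; rewrite Carg_scal, Cmod_mult, Cmod_R, Rabs_pos_eq by lra.
rewrite <- Rpower_mult_distr by lra.
apply injective_projections; simpl; ring.
Qed.

(** * Path integrals and Goursat's theorem for rectangles *)

Definition CInt (f : R -> C) (a b : R) : C := RInt (V := C_R_CompleteNormedModule) f a b.
Definition ex_CInt (f : R -> C) (a b : R) : Prop := ex_RInt (V := C_R_NormedModule) f a b.

Lemma norm_C_R (z : C) : norm (V := C_R_NormedModule) z = Cmod z.
Proof.
unfold norm; simpl; unfold prod_norm, Cmod, norm; simpl; unfold abs; simpl.
rewrite !Rmult_1_r; f_equal.
rewrite <- !Rabs_mult, !Rabs_pos_eq by nra; reflexivity.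
Qed.

Lemma CInt_correct f a b : ex_CInt f a b ->
  is_RInt (V := C_R_NormedModule) f a b (CInt f a b).
Proof. apply (RInt_correct (V := C_R_CompleteNormedModule)). Qed.

Lemma CInt_unique f a b l : is_RInt (V := C_R_NormedModule) f a b l -> CInt f a b = l.
Proof. apply (is_RInt_unique (V := C_R_CompleteNormedModule)). Qed.

Lemma ex_CInt_continuous f a b : a <= b ->
  (forall x, a <= x <= b -> continuous (U := C_UniformSpace) f x) -> ex_CInt f a b.
Proof.
intros h H; apply (ex_RInt_continuous (V := C_R_CompleteNormedModule)).
rewrite Rmin_left, Rmax_right by exact h; exact H.
Qed.

Lemma CInt_ext f g a b : a <= b -> (forall x, a < x < b -> f x = g x) -> CInt f a b = CInt g a b.
Proof.
intros h H; apply (RInt_ext (V := C_R_CompleteNormedModule)).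
rewrite Rmin_left, Rmax_right by exact h; exact H.
Qed.

Lemma CInt_const a b (c : C) : CInt (fun _ => c) a b = ((b - a)%R * c)%C.
Proof. unfold CInt; rewrite (RInt_const (V := C_R_CompleteNormedModule)); apply scal_R_Cmult. Qed.

Lemma is_CInt_plus f g a b : ex_CInt f a b -> ex_CInt g a b ->
  is_RInt (V := C_R_NormedModule) (fun x => f x + g x)%C a b (CInt f a b + CInt g a b)%C.
Proof.
intros Hf Hg.
apply (is_RInt_plus (V := C_R_NormedModule) f g a b _ _ (CInt_correct _ _ _ Hf) (CInt_correct _ _ _ Hg)).
Qed.

Lemma CInt_plus f g a b : ex_CInt f a b -> ex_CInt g a b ->
  CInt (fun x => f x + g x)%C a b = (CInt f a b + CInt g a b)%C.
Proof. intros; apply CInt_unique, is_CInt_plus; assumption. Qed.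

Lemma ex_CInt_plus f g a b : ex_CInt f a b -> ex_CInt g a b -> ex_CInt (fun x => f x + g x)%C a b.
Proof. intros; eexists; apply is_CInt_plus; assumption. Qed.

(** The integral is that of a real normed module, hence linear over the reals. Multiplication by [i]
    is treated on the two components, and [is_CInt_scal] assembles a complex factor from its real
    and imaginary parts. *)
Lemma is_CInt_Ci f a b : ex_CInt f a b ->
  is_RInt (V := C_R_NormedModule) (fun x => Ci * f x)%C a b (Ci * CInt f a b)%C.
Proof.
intros Hf; pose proof (CInt_correct _ _ _ Hf) as H.
pose proof (is_RInt_fct_extend_fst (U := R_NormedModule) (V := R_NormedModule) _ _ _ _ H) as H1.
pose proof (is_RInt_fct_extend_snd (U := R_NormedModule) (V := R_NormedModule) _ _ _ _ H) as H2.
apply (is_RInt_fct_extend_pair (U := R_NormedModule) (V := R_NormedModule)).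
- apply (is_RInt_ext (V := R_NormedModule) (fun x => opp (snd (f x)))).
  + intros x _; unfold opp; simpl; ring.
  + replace (_ - _) with (opp (snd (CInt f a b))) by (unfold opp; simpl; ring).
    exact (is_RInt_opp (V := R_NormedModule) _ _ _ _ H2).
- apply (is_RInt_ext (V := R_NormedModule) (fun x => fst (f x))).
  + intros x _; simpl; ring.
  + match goal with |- is_RInt _ _ _ ?l => replace l with (fst (CInt f a b)) by (simpl; ring) end; exact H1.
Qed.

Lemma is_CInt_scal (c : C) f a b : ex_CInt f a b ->
  is_RInt (V := C_R_NormedModule) (fun x => c * f x)%C a b (c * CInt f a b)%C.
Proof.
intros Hf; pose proof (CInt_correct _ _ _ Hf) as H; pose proof (is_CInt_Ci _ _ _ Hf) as H'.
pose proof (is_RInt_plus (V := C_R_NormedModule) _ _ _ _ _ _ (is_RInt_scal (V := C_R_NormedModule) _ _ _ (Re c) _ H) (is_RInt_scal (V := C_R_NormedModule) _ _ _ (Im c) _ H')) as K.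
assert (E : forall z : C, plus (G := C_R_NormedModule) (scal (V := C_R_NormedModule) (Re c) z)
   (scal (V := C_R_NormedModule) (Im c) (Ci * z)%C) = (c * z)%C).
{ intros z; rewrite !scal_R_Cmult; change (Re c * z + Im c * (Ci * z) = c * z)%C.
  destruct c, z; apply injective_projections; simpl; ring. }
rewrite E in K; refine (is_RInt_ext (V := C_R_NormedModule) _ _ _ _ _ (fun x _ => E (f x)) K).
Qed.

Lemma CInt_scal c f a b : ex_CInt f a b -> CInt (fun x => c * f x)%C a b = (c * CInt f a b)%C.
Proof. intros; apply CInt_unique, is_CInt_scal; assumption. Qed.

Lemma ex_CInt_scal c f a b : ex_CInt f a b -> ex_CInt (fun x => c * f x)%C a b.
Proof. intros; eexists; apply is_CInt_scal; assumption. Qed.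

Lemma is_CInt_minus f g a b : ex_CInt f a b -> ex_CInt g a b ->
  is_RInt (V := C_R_NormedModule) (fun x => f x - g x)%C a b (CInt f a b - CInt g a b)%C.
Proof.
intros Hf Hg.
apply (is_RInt_minus (V := C_R_NormedModule) f g a b _ _ (CInt_correct _ _ _ Hf) (CInt_correct _ _ _ Hg)).
Qed.

Lemma CInt_minus f g a b : ex_CInt f a b -> ex_CInt g a b ->
  CInt (fun x => f x - g x)%C a b = (CInt f a b - CInt g a b)%C.
Proof. intros; apply CInt_unique, is_CInt_minus; assumption. Qed.

Lemma ex_CInt_minus f g a b : ex_CInt f a b -> ex_CInt g a b -> ex_CInt (fun x => f x - g x)%C a b.
Proof. intros; eexists; apply is_CInt_minus; assumption. Qed.

Lemma CInt_Chasles f a b c : ex_CInt f a b -> ex_CInt f b c ->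
  CInt f a c = (CInt f a b + CInt f b c)%C.
Proof.
intros H1 H2; symmetry; apply (RInt_Chasles (V := C_R_CompleteNormedModule)); assumption.
Qed.

Lemma CInt_comp_lin f u v a b : ex_CInt f (u * a + v) (u * b + v) ->
  CInt (fun y => u * f (u * y + v)%R)%C a b = CInt f (u * a + v) (u * b + v).
Proof.
intros H; unfold CInt; rewrite <- (RInt_comp_lin (V := C_R_CompleteNormedModule) f u v a b H).
apply (RInt_ext (V := C_R_CompleteNormedModule)); intros x _; symmetry; apply scal_R_Cmult.
Qed.

Lemma Cmod_CInt_le f g a b : a <= b -> ex_CInt f a b -> ex_RInt g a b ->
  (forall x, a <= x <= b -> Cmod (f x) <= g x) -> Cmod (CInt f a b) <= RInt g a b.
Proof.
intros h Hf Hg H.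
rewrite <- norm_C_R.
refine (norm_RInt_le (V := C_R_NormedModule) f g a b _ _ h _ (CInt_correct _ _ _ Hf) (RInt_correct _ _ _ Hg)).
intros x hx; rewrite norm_C_R; apply H, hx.
Qed.

Lemma Cmod_CInt_le_const f a b M : a <= b -> ex_CInt f a b ->
  (forall x, a <= x <= b -> Cmod (f x) <= M) -> Cmod (CInt f a b) <= (b - a) * M.
Proof.
intros h Hf H.
rewrite <- norm_C_R.
refine (norm_RInt_le_const (V := C_R_NormedModule) f a b _ M h _ (CInt_correct _ _ _ Hf)).
intros x hx; rewrite norm_C_R; apply H, hx.
Qed.

(** The positively oriented boundary integral. Opposite sides share one integrand, so that affine
    parts reduce to constants before moduli are taken. *)
Definition rect_int (f : C -> C) (x0 x1 y0 y1 : R) : C :=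
  (CInt (fun x => f (x, y0) - f (x, y1))%C x0 x1
   + CInt (fun y => Ci * (f (x1, y) - f (x0, y)))%C y0 y1)%C.

Definition Cdiff_on_rect (f : C -> C) (x0 x1 y0 y1 : R) : Prop :=
  forall x y, x0 <= x <= x1 -> y0 <= y <= y1 -> Cdiff f (x, y).

Lemma ex_CInt_h f x0 x1 y : x0 <= x1 -> (forall x, x0 <= x <= x1 -> Cdiff f (x, y)) ->
  ex_CInt (fun x => f (x, y)) x0 x1.
Proof. intros h H; apply ex_CInt_continuous; [exact h|]; intros; apply Cdiff_continuous_h; auto. Qed.

Lemma ex_CInt_v f x y0 y1 : y0 <= y1 -> (forall y, y0 <= y <= y1 -> Cdiff f (x, y)) ->
  ex_CInt (fun y => f (x, y)) y0 y1.
Proof. intros h H; apply ex_CInt_continuous; [exact h|]; intros; apply Cdiff_continuous_v; auto. Qed.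

Lemma rect_int_split_h f x0 m x1 y0 y1 : x0 <= m <= x1 -> y0 <= y1 ->
  Cdiff_on_rect f x0 x1 y0 y1 ->
  rect_int f x0 x1 y0 y1 = (rect_int f x0 m y0 y1 + rect_int f m x1 y0 y1)%C.
Proof.
intros hx hy D; unfold rect_int.
rewrite (CInt_Chasles _ x0 m x1).
2,3: apply ex_CInt_minus; apply ex_CInt_h; try lra; intros; apply D; lra.
rewrite (CInt_ext (fun y => Ci * (f (x1, y) - f (x0, y)))%C
  (fun y => Ci * (f (m, y) - f (x0, y)) + Ci * (f (x1, y) - f (m, y)))%C y0 y1 hy)
  by (intros; ring).
rewrite CInt_plus; [ring| |];
  apply ex_CInt_scal, ex_CInt_minus; apply ex_CInt_v; try lra; intros; apply D; lra.
Qed.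

Lemma rect_int_split_v f x0 x1 y0 m y1 : x0 <= x1 -> y0 <= m <= y1 ->
  Cdiff_on_rect f x0 x1 y0 y1 ->
  rect_int f x0 x1 y0 y1 = (rect_int f x0 x1 y0 m + rect_int f x0 x1 m y1)%C.
Proof.
intros hx hy D; unfold rect_int.
rewrite (CInt_Chasles _ y0 m y1).
2,3: apply ex_CInt_scal, ex_CInt_minus; apply ex_CInt_v; try lra; intros; apply D; lra.
rewrite (CInt_ext (fun x => f (x, y0) - f (x, y1))%C
  (fun x => (f (x, y0) - f (x, m)) + (f (x, m) - f (x, y1)))%C x0 x1 hx) by (intros; ring).
rewrite CInt_plus; [ring| |];
  apply ex_CInt_minus; apply ex_CInt_h; try lra; intros; apply D; lra.
Qed.

(* The affine part contributes nothing, because opposite sides of the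
   rectangle cancel up to constants. *)
Lemma rect_int_affine_approx f x0 x1 y0 y1 (A B z0 : C) eta : x0 <= x1 -> y0 <= y1 ->
  Cdiff_on_rect f x0 x1 y0 y1 ->
  (forall x y, x0 <= x <= x1 -> y0 <= y <= y1 ->
     Cmod (f (x, y) - A - B * ((x, y) - z0)) <= eta) ->
  Cmod (rect_int f x0 x1 y0 y1) <= 2 * eta * ((x1 - x0) + (y1 - y0)).
Proof.
intros hx hy D H.
set (c1 := (B * (0, (y0 - y1)%R))%C); set (c2 := (Ci * (B * (x1 - x0)%R))%C).
assert (E1 : ex_CInt (fun x => f (x, y0) - f (x, y1))%C x0 x1)
  by (apply ex_CInt_minus; apply ex_CInt_h; try lra; intros; apply D; lra).
assert (E2 : ex_CInt (fun y => Ci * (f (x1, y) - f (x0, y)))%C y0 y1)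
  by (apply ex_CInt_scal, ex_CInt_minus; apply ex_CInt_v; try lra; intros; apply D; lra).
assert (Ec : forall a b c, ex_CInt (fun _ => c) a b)
  by (intros; eexists; apply (is_RInt_const (V := C_R_NormedModule))).
replace (rect_int f x0 x1 y0 y1) with
  (CInt (fun x => f (x, y0) - f (x, y1) - c1)%C x0 x1
   + CInt (fun y => Ci * (f (x1, y) - f (x0, y)) - c2)%C y0 y1)%C.
2:{ rewrite (CInt_minus _ _ _ _ E1 (Ec _ _ _)), (CInt_minus _ _ _ _ E2 (Ec _ _ _)), !CInt_const.
  assert (Z : (((x1 - x0)%R : C) * c1 + ((y1 - y0)%R : C) * c2 = 0)%C).
  { unfold c1, c2; destruct B as [b1 b2]; apply injective_projections; simpl; ring. }
  transitivity (rect_int f x0 x1 y0 y1 - (((x1 - x0)%R : C) * c1 + ((y1 - y0)%R : C) * c2))%C.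
  - unfold rect_int; ring.
  - rewrite Z; ring. }
eapply Rle_trans; [apply Cmod_triangle|].
assert (M1 : Cmod (CInt (fun x => f (x, y0) - f (x, y1) - c1)%C x0 x1) <= (x1 - x0) * (2 * eta)).
{ apply Cmod_CInt_le_const; [exact hx | apply ex_CInt_minus; [assumption | apply Ec]|].
  intros x h.
  pose proof (H x y0 h ltac:(lra)) as a; pose proof (H x y1 h ltac:(lra)) as b.
  replace (f (x, y0) - f (x, y1) - c1)%C with
    ((f (x, y0) - A - B * ((x, y0) - z0)) + - (f (x, y1) - A - B * ((x, y1) - z0)))%C.
  - eapply Rle_trans; [apply Cmod_triangle|]; rewrite Cmod_opp; lra.
  - replace c1 with (B * ((x, y0) - (x, y1)))%C; [ring|].
    unfold c1; f_equal; apply injective_projections; simpl; ring. }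
assert (M2 : Cmod (CInt (fun y => Ci * (f (x1, y) - f (x0, y)) - c2)%C y0 y1) <= (y1 - y0) * (2 * eta)).
{ apply Cmod_CInt_le_const; [exact hy | apply ex_CInt_minus; [assumption | apply Ec]|].
  intros y h.
  pose proof (H x1 y ltac:(lra) h) as a; pose proof (H x0 y ltac:(lra) h) as b.
  replace (Ci * (f (x1, y) - f (x0, y)) - c2)%C with
    (Ci * ((f (x1, y) - A - B * ((x1, y) - z0)) + - (f (x0, y) - A - B * ((x0, y) - z0))))%C.
  - rewrite Cmod_mult, Cmod_Ci, Rmult_1_l.
    eapply Rle_trans; [apply Cmod_triangle|]; rewrite Cmod_opp; lra.
  - replace c2 with (Ci * (B * ((x1, y) - (x0, y))))%C; [ring|].
    unfold c2; do 2 f_equal; apply injective_projections; simpl; ring. }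
lra.
Qed.

Definition halve (F : R -> R -> C) (p : R * R) : R * R :=
  let (a, b) := p in
  let m := (a + b) / 2 in
  if Rle_dec (Cmod (F a b) / 2) (Cmod (F a m)) then (a, m) else (m, b).

Lemma halve_spec F a b : F a b = (F a ((a + b) / 2)%R + F ((a + b) / 2)%R b)%C -> a <= b ->
  let q := halve F (a, b) in
  a <= fst q /\ snd q <= b /\ snd q - fst q = (b - a) / 2 /\
  Cmod (F a b) / 2 <= Cmod (F (fst q) (snd q)).
Proof.
intros E h; simpl; set (m := (a + b) / 2) in *.
assert (hm : m - a = (b - a) / 2 /\ b - m = (b - a) / 2) by (unfold m; split; field).
destruct (Rle_dec (Cmod (F a b) / 2) (Cmod (F a m))) as [H|H]; simpl.
- repeat split; lra.
- repeat split; try lra.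
  pose proof (Cmod_triangle (F a m) (F m b)) as T; rewrite <- E in T; lra.
Qed.

(** A vertical cut followed by a horizontal one, each keeping at least half of the modulus: a
    quarter in total, as with four quadrants, but with additivity in one direction at a time. *)
Definition bisect (f : C -> C) (q : (R * R) * (R * R)) : (R * R) * (R * R) :=
  let (p, r) := q in
  let p' := halve (fun a b => rect_int f a b (fst r) (snd r)) p in
  (p', halve (fun c d => rect_int f (fst p') (snd p') c d) r).

(** The point is the supremum of the left ends. *)
Lemma nested_intervals_point (u v : nat -> R) (L : R) :
  (forall n, u n <= u (S n)) -> (forall n, v (S n) <= v n) ->
  (forall n, v n - u n = L / 2 ^ n) -> 0 <= L ->
  exists x, forall n, u n <= x <= v n.
Proof.
intros Hu Hv Hd hL.
assert (huv : forall n, u n <= v n).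
{ intros n; pose proof (Hd n); assert (0 <= L / 2 ^ n); [|lra].
  apply Rdiv_le_0_compat; [exact hL | apply pow_lt; lra]. }
assert (mu : forall n k, u n <= u (n + k)%nat).
{ intros n k; induction k; [rewrite Nat.add_0_r; lra|].
  rewrite Nat.add_succ_r; pose proof (Hu (n + k)%nat); lra. }
assert (mv : forall n k, v (n + k)%nat <= v n).
{ intros n k; induction k; [rewrite Nat.add_0_r; lra|].
  rewrite Nat.add_succ_r; pose proof (Hv (n + k)%nat); lra. }
assert (cross : forall n m, u n <= v m).
{ intros n m; destruct (Nat.le_ge_cases n m) as [h|h].
  - replace m with (n + (m - n))%nat by lia.
    pose proof (mu n (m - n)%nat); pose proof (huv (n + (m - n))%nat); lra.
  - replace n with (m + (n - m))%nat by lia.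
    pose proof (mv m (n - m)%nat); pose proof (huv (m + (n - m))%nat); lra. }
destruct (completeness (fun x => exists n, x = u n)) as [x [Hx1 Hx2]].
- exists (v 0%nat); intros y [n ->]; apply cross.
- exists (u 0%nat), 0%nat; reflexivity.
- exists x; intros n; split.
  + apply Hx1; exists n; reflexivity.
  + apply Hx2; intros y [m ->]; apply cross.
Qed.

(** The [n]-th rectangle keeps at least [I / 4^n] of the modulus, while differentiability at the
    common point bounds its integral by [2 eps (L / 2^n)^2]. The powers of 4 cancel, and
    [I <= 2 eps L^2] for every [eps]. *)
Theorem Goursat_rect f x0 x1 y0 y1 : x0 <= x1 -> y0 <= y1 ->
  Cdiff_on_rect f x0 x1 y0 y1 -> rect_int f x0 x1 y0 y1 = 0%C.
Proof.
intros hx hy D.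
set (I := Cmod (rect_int f x0 x1 y0 y1)).
set (Q := fun n => Nat.iter n (bisect f) ((x0, x1), (y0, y1))).
assert (Inv : forall n, let '((a, b), (c, d)) := Q n in
  x0 <= a /\ a <= b /\ b <= x1 /\ y0 <= c /\ c <= d /\ d <= y1 /\
  b - a = (x1 - x0) / 2 ^ n /\ d - c = (y1 - y0) / 2 ^ n /\
  I / 4 ^ n <= Cmod (rect_int f a b c d) /\
  let '((a', b'), (c', d')) := Q (S n) in a <= a' /\ b' <= b /\ c <= c' /\ d' <= d).
{ assert (Step : forall a b c d, x0 <= a -> a <= b -> b <= x1 -> y0 <= c -> c <= d -> d <= y1 ->
    let '((a', b'), (c', d')) := bisect f ((a, b), (c, d)) in
    a <= a' /\ b' <= b /\ c <= c' /\ d' <= d /\ b' - a' = (b - a) / 2 /\ d' - c' = (d - c) / 2 /\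
    Cmod (rect_int f a b c d) / 4 <= Cmod (rect_int f a' b' c' d')).
  { intros a b c d h1 h2 h3 h4 h5 h6; unfold bisect; cbn [fst snd].
    destruct (halve_spec (fun a b => rect_int f a b c d) a b) as (p1 & p2 & p3 & p4).
    { apply rect_int_split_h; try lra; intros x y ? ?; apply D; lra. }
    { exact h2. }
    destruct (halve (fun a b => rect_int f a b c d) (a, b)) as [a' b']; cbn [fst snd] in *.
    destruct (halve_spec (fun c d => rect_int f a' b' c d) c d) as (q1 & q2 & q3 & q4).
    { apply rect_int_split_v; try lra; intros x y ? ?; apply D; lra. }
    { exact h5. }
    destruct (halve (fun c d => rect_int f a' b' c d) (c, d)) as [c' d']; cbn [fst snd] in *.
    repeat split; lra. }
  assert (Main : forall n, let '((a, b), (c, d)) := Q n in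
    x0 <= a /\ a <= b /\ b <= x1 /\ y0 <= c /\ c <= d /\ d <= y1 /\
    b - a = (x1 - x0) / 2 ^ n /\ d - c = (y1 - y0) / 2 ^ n /\
    I / 4 ^ n <= Cmod (rect_int f a b c d)).
  { induction n as [|n IH].
    - simpl; unfold I; repeat split; lra.
    - change (Q (S n)) with (bisect f (Q n)).
      destruct (Q n) as [[a b] [c d]].
      destruct IH as (h1 & h2 & h3 & h4 & h5 & h6 & h7 & h8 & h9).
      specialize (Step a b c d h1 h2 h3 h4 h5 h6).
      destruct (bisect f ((a, b), (c, d))) as [[a' b'] [c' d']].
      assert (0 < 2 ^ n) by (apply pow_lt; lra); assert (0 < 4 ^ n) by (apply pow_lt; lra).
      assert (e1 : (x1 - x0) / 2 ^ S n = (x1 - x0) / 2 ^ n / 2) by (simpl; field; lra).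
      assert (e2 : (y1 - y0) / 2 ^ S n = (y1 - y0) / 2 ^ n / 2) by (simpl; field; lra).
      assert (e3 : I / 4 ^ S n = I / 4 ^ n / 4) by (simpl; field; lra).
      rewrite e1, e2, e3; repeat split; lra. }
  intros n; pose proof (Main n) as M; change (Q (S n)) with (bisect f (Q n)).
  destruct (Q n) as [[a b] [c d]].
  destruct M as (h1 & h2 & h3 & h4 & h5 & h6 & h7 & h8 & h9).
  specialize (Step a b c d h1 h2 h3 h4 h5 h6).
  destruct (bisect f ((a, b), (c, d))) as [[a' b'] [c' d']].
  repeat split; lra. }
destruct (nested_intervals_point (fun n => fst (fst (Q n))) (fun n => snd (fst (Q n))) (x1 - x0))
  as [x Hx]; try lra.
1-3: intros n; specialize (Inv n); destruct (Q n) as [[a b] [c d]];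
  destruct (Q (S n)) as [[a' b'] [c' d']]; simpl; lra.
destruct (nested_intervals_point (fun n => fst (snd (Q n))) (fun n => snd (snd (Q n))) (y1 - y0))
  as [y Hy]; try lra.
1-3: intros n; specialize (Inv n); destruct (Q n) as [[a b] [c d]];
  destruct (Q (S n)) as [[a' b'] [c' d']]; simpl; lra.
set (L := (x1 - x0) + (y1 - y0)).
assert (hL : 0 <= L) by (unfold L; lra).
assert (Small : forall eps, 0 < eps -> I <= 2 * eps * L ^ 2).
{ intros eps he.
  assert (Dz : Cdiff f (x, y)).
  { apply D; [pose proof (Hx 0%nat) as h | pose proof (Hy 0%nat) as h]; exact h. }
  destruct Dz as [l Hl]; rewrite Cderiv_eps in Hl; destruct (Hl eps he) as [r [hr Hr]].
  (* [L / 2^n] bounds the diameter, so some rectangle lies in the disc where [f] is affine up to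
     [eps]. *)
  assert (hn : exists n, L / 2 ^ n < r).
  { destruct (pow_lt_1_zero (1 / 2) ltac:(rewrite Rabs_pos_eq; lra) (r / (L + 1))) as [n Hn].
    - apply Rdiv_lt_0_compat; lra.
    - exists n; specialize (Hn n (Nat.le_refl n)).
      assert (e : (1 / 2) ^ n = / 2 ^ n) by (unfold Rdiv; rewrite Rmult_1_l; apply pow_inv).
      assert (hp : 0 < / 2 ^ n) by (apply Rinv_0_lt_compat, pow_lt; lra).
      rewrite e, Rabs_pos_eq in Hn by lra.
      apply (Rmult_lt_compat_l (L + 1)) in Hn; [|lra].
      replace ((L + 1) * (r / (L + 1))) with r in Hn by (field; lra).
      unfold Rdiv; nra. }
  destruct hn as [n hn].
  specialize (Inv n); specialize (Hx n); specialize (Hy n).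
  destruct (Q n) as [[a b] [c d]]; destruct (Q (S n)) as [[a' b'] [c' d']].
  cbn [fst snd] in *.
  destruct Inv as (h1 & h2 & h3 & h4 & h5 & h6 & h7 & h8 & h9 & _).
  assert (p2 : 0 < 2 ^ n) by (apply pow_lt; lra).
  assert (hdiam : (b - a) + (d - c) = L / 2 ^ n) by (rewrite h7, h8; unfold L; field; lra).
  assert (K : Cmod (rect_int f a b c d) <= 2 * (eps * (L / 2 ^ n)) * ((b - a) + (d - c))).
  { apply (rect_int_affine_approx f a b c d (f (x, y)) l (x, y)); try lra.
    - intros s t ? ?; apply D; lra.
    - intros s t hs ht.
      assert (hd : Cmod ((s, t) - (x, y)) <= L / 2 ^ n).
      { eapply Rle_trans; [apply Cmod_le_abs|]; simpl; rewrite <- hdiam.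
        apply Rplus_le_compat; apply Rabs_le; lra. }
      eapply Rle_trans; [apply Hr; lra|]; apply Rmult_le_compat_l; lra. }
  rewrite hdiam in K.
  assert (p4 : 4 ^ n = 2 ^ n * 2 ^ n) by (rewrite <- Rpow_mult_distr; f_equal; ring).
  assert (J : I / 4 ^ n <= 2 * eps * L ^ 2 / 4 ^ n).
  { eapply Rle_trans; [exact h9|]; eapply Rle_trans; [exact K|].
    right; rewrite p4; field; lra. }
  apply Rmult_le_reg_r in J; [exact J|]; apply Rinv_0_lt_compat, pow_lt; lra. }
apply Cmod_eq_0; fold I.
assert (hI : 0 <= I) by apply Cmod_ge_0.
destruct (Req_dec I 0) as [e|e]; [exact e|].
assert (hI' : 0 < I) by lra.
assert (hL2 : 0 <= L ^ 2) by (apply pow_le, hL).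
(* With this [eps] the bound becomes [I <= (I / 2) L^2 / (L^2 + 1)], which is impossible for
   [I > 0]. *)
specialize (Small (I / (4 * (L ^ 2 + 1))) ltac:(apply Rdiv_lt_0_compat; lra)).
assert (E : 2 * (I / (4 * (L ^ 2 + 1))) * L ^ 2 = I * (L ^ 2 / (L ^ 2 + 1)) / 2) by (field; lra).
assert (L ^ 2 / (L ^ 2 + 1) <= 1).
{ apply (Rmult_le_reg_r (L ^ 2 + 1)); [lra|]; unfold Rdiv; rewrite Rmult_assoc, Rinv_l; lra. }
nra.
Qed.

(** * Hankel contours *)

Definition hor (f : C -> C) (x0 x1 y : R) : C := CInt (fun x => f (x, y)) x0 x1.
Definition ver (f : C -> C) (x y0 y1 : R) : C := CInt (fun y => Ci * f (x, y))%C y0 y1.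

(** A Hankel contour cut off at [- X]: rightwards below the negative axis, up across the positive
    axis at [h], and back above. *)
Definition hankel (f : C -> C) (X h : R) : C :=
  (hor f (- X) h (- h) + ver f h (- h) h - hor f (- X) h h)%C.

(** Goursat's theorem solved for the left side; every change of contour below goes through this
    identity. *)
Lemma ver_shift f x0 x1 y0 y1 : x0 <= x1 -> y0 <= y1 -> Cdiff_on_rect f x0 x1 y0 y1 ->
  ver f x0 y0 y1 = (ver f x1 y0 y1 + hor f x0 x1 y0 - hor f x0 x1 y1)%C.
Proof.
intros hx hy D; pose proof (Goursat_rect f x0 x1 y0 y1 hx hy D) as G.
unfold rect_int in G.
rewrite (CInt_ext (fun y => Ci * (f (x1, y) - f (x0, y)))%C
  (fun y => Ci * f (x1, y) - Ci * f (x0, y))%C y0 y1 hy) in G by (intros; ring).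
rewrite !CInt_minus in G.
- fold (hor f x0 x1 y0) (hor f x0 x1 y1) (ver f x1 y0 y1) (ver f x0 y0 y1) in G.
  rewrite <- (Cplus_0_r (ver f x0 y0 y1)), <- G; ring.
- apply ex_CInt_scal, ex_CInt_v; [exact hy|]; intros; apply D; lra.
- apply ex_CInt_scal, ex_CInt_v; [exact hy|]; intros; apply D; lra.
- apply ex_CInt_h; [exact hx|]; intros; apply D; lra.
- apply ex_CInt_h; [exact hx|]; intros; apply D; lra.
Qed.

Lemma ver_Chasles f x y0 y1 y2 : y0 <= y1 <= y2 ->
  (forall y, y0 <= y <= y2 -> Cdiff f (x, y)) ->
  ver f x y0 y2 = (ver f x y0 y1 + ver f x y1 y2)%C.
Proof.
intros h D; apply CInt_Chasles; apply ex_CInt_scal, ex_CInt_v; try lra; intros; apply D; lra.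
Qed.

Lemma hor_Chasles f x0 x1 x2 y : x0 <= x1 <= x2 ->
  (forall x, x0 <= x <= x2 -> Cdiff f (x, y)) ->
  hor f x0 x2 y = (hor f x0 x1 y + hor f x1 x2 y)%C.
Proof.
intros h D; apply CInt_Chasles; apply ex_CInt_h; try lra; intros; apply D; lra.
Qed.

Lemma Cmod_hor_le f x0 x1 y M : x0 <= x1 -> (forall x, x0 <= x <= x1 -> Cdiff f (x, y)) ->
  (forall x, x0 <= x <= x1 -> Cmod (f (x, y)) <= M) -> Cmod (hor f x0 x1 y) <= (x1 - x0) * M.
Proof. intros h D H; apply Cmod_CInt_le_const; [exact h | apply ex_CInt_h; assumption | exact H]. Qed.

Lemma Cmod_ver_le f x y0 y1 M : y0 <= y1 -> (forall y, y0 <= y <= y1 -> Cdiff f (x, y)) ->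
  (forall y, y0 <= y <= y1 -> Cmod (f (x, y)) <= M) -> Cmod (ver f x y0 y1) <= (y1 - y0) * M.
Proof.
intros h D H; apply Cmod_CInt_le_const; [exact h | apply ex_CInt_scal, ex_CInt_v; assumption|].
intros y hy; rewrite Cmod_mult, Cmod_Ci, Rmult_1_l; auto.
Qed.

Lemma cut_plane_Im x y : y <> 0 -> cut_plane (x, y).
Proof. intros H [_ H']; contradiction. Qed.

Lemma cut_plane_Re x y : 0 < x -> cut_plane (x, y).
Proof. intros H [H' _]; simpl in H'; lra. Qed.

Definition Cdiff_on_box (f : C -> C) (d : R) : Prop :=
  forall x y, Rabs x <= d -> Rabs y <= d -> cut_plane (x, y) -> Cdiff f (x, y).

Lemma Cmod_sum6_le (a b c e g l : C) : Cmod (a - b + c + e + g - l) <=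
  Cmod a + Cmod b + Cmod c + Cmod e + Cmod g + Cmod l.
Proof.
unfold Cminus.
repeat (eapply Rle_trans; [apply Cmod_triangle|]; rewrite ?Cmod_opp;
  match goal with |- _ + Cmod ?z <= _ + Cmod ?z => apply Rplus_le_compat_r end).
apply Rle_refl.
Qed.

(* The segment [Re = c] is deformed into a Hankel contour around the cut; what is
   left over runs along the outer boundary of the box, whence the hypotheses on [E]. *)
Lemma ver_to_hankel f d h c E : 0 < c -> c <= h -> h < d -> Cdiff_on_box f d ->
  (forall x, - d <= x <= h -> Cmod (f (x, d)) <= E /\ Cmod (f (x, - d)) <= E) ->
  (forall y, h <= Rabs y <= d -> Cmod (f (- d, y)) <= E) ->
  Cmod (ver f c (- d) d - hankel f d h) <= 8 * d * E.
Proof.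
intros hc hch hd D B1 B2.
(* One rectangle to the right of the cut, one above and one below it; none of them meets the cut. *)
assert (D1 : Cdiff_on_rect f c h (- d) d).
{ intros x y hx hy; apply D; try (apply Rabs_le; lra); apply cut_plane_Re; lra. }
assert (D2 : Cdiff_on_rect f (- d) h h d).
{ intros x y hx hy; apply D; try (apply Rabs_le; lra); apply cut_plane_Im; lra. }
assert (D3 : Cdiff_on_rect f (- d) h (- d) (- h)).
{ intros x y hx hy; apply D; try (apply Rabs_le; lra); apply cut_plane_Im; lra. }
pose proof (ver_shift f c h (- d) d hch ltac:(lra) D1) as S1.
pose proof (ver_shift f (- d) h h d ltac:(lra) ltac:(lra) D2) as S2.
pose proof (ver_shift f (- d) h (- d) (- h) ltac:(lra) ltac:(lra) D3) as S3.
assert (V1 : forall y, - d <= y <= d -> Cdiff f (h, y)) by (intros; apply D1; lra).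
rewrite (ver_Chasles f h (- d) (- h) d) in S1 by (try lra; exact V1).
rewrite (ver_Chasles f h (- h) h d) in S1 by (try lra; intros; apply V1; lra).
assert (Eq : (ver f c (- d) d - hankel f d h =
  hor f c h (- d) - hor f c h d + ver f (- d) h d + ver f (- d) (- d) (- h)
   + hor f (- d) h d - hor f (- d) h (- d))%C).
{ unfold hankel; rewrite S1, S2, S3; ring. }
rewrite Eq; eapply Rle_trans; [apply Cmod_sum6_le|].
(* The six remaining pieces have total length [4 d + 2 h - 2 c], below [8 d]. *)
assert (P1 : Cmod (hor f c h (- d)) <= (h - c) * E).
{ apply Cmod_hor_le; [lra | intros; apply D1; lra | intros; apply B1; lra]. }
assert (P2 : Cmod (hor f c h d) <= (h - c) * E).
{ apply Cmod_hor_le; [lra | intros; apply D1; lra | intros; apply B1; lra]. }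
assert (P3 : Cmod (ver f (- d) h d) <= (d - h) * E).
{ apply Cmod_ver_le; [lra | intros; apply D2; lra |].
  intros; apply B2; rewrite Rabs_pos_eq; lra. }
assert (P4 : Cmod (ver f (- d) (- d) (- h)) <= (- h - - d) * E).
{ apply Cmod_ver_le; [lra | intros; apply D3; lra |].
  intros; apply B2; rewrite Rabs_left1; lra. }
assert (P5 : Cmod (hor f (- d) h d) <= (h - - d) * E).
{ apply Cmod_hor_le; [lra | intros; apply D2; lra | intros; apply B1; lra]. }
assert (P6 : Cmod (hor f (- d) h (- d)) <= (h - - d) * E).
{ apply Cmod_hor_le; [lra | intros; apply D3; lra | intros; apply B1; lra]. }
assert (hE : 0 <= E).
{ eapply Rle_trans; [apply Cmod_ge_0 | apply (B1 h); lra]. }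
nra.
Qed.

(** * Estimates on Hankel contours *)

Lemma exp_le_compat x y : x <= y -> exp x <= exp y.
Proof.
intros [h|h]; [left; apply exp_increasing, h | right; f_equal; exact h].
Qed.

(** [x / m <= exp (x / m)], raised to the power [m]. *)
Lemma pow_le_exp x m : 0 <= x -> x ^ m <= INR m ^ m * exp x.
Proof.
intros hx; destruct m as [|m].
- simpl; pose proof (exp_ineq1_le x); lra.
- set (q := INR (S m)); assert (hq : 0 < q) by (apply lt_0_INR; lia).
  assert (e : exp x = exp (x / q) ^ S m).
  { rewrite <- Rpower_pow by apply exp_pos; fold q; unfold Rpower; rewrite ln_exp.
    f_equal; field; lra. }
  rewrite e, <- Rpow_mult_distr; apply pow_incr; split; [exact hx|].
  pose proof (exp_ineq1_le (x / q)) as h.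
  replace x with (q * (x / q)) at 1 by (field; lra).
  apply Rmult_le_compat_l; lra.
Qed.

Lemma Rpower_pos x y : 0 < Rpower x y.
Proof. apply exp_pos. Qed.

(** Dividing by [kappa] makes the base at least 1, where the exponent may be raised to an integer.
    Only [exp (t / 2)] is spent, so that a factor [exp (- t)] still decays afterwards. *)
Lemma Rpower_le_exp kappa mu : 0 < kappa -> exists K, 0 < K /\
  forall t, kappa <= t -> Rpower t mu <= K * exp (t / 2).
Proof.
intros hk.
destruct (INR_archimed 1 (Rabs mu)) as [m hm]; [lra|].
assert (hm' : mu <= INR m) by (pose proof (Rle_abs mu); lra).
exists (Rpower kappa mu * (INR (S m) ^ S m * (2 / kappa) ^ S m)); split.
{ apply Rmult_lt_0_compat; [apply Rpower_pos|].
  apply Rmult_lt_0_compat; apply pow_lt; [apply lt_0_INR; lia | apply Rdiv_lt_0_compat; lra]. }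
intros t ht.
assert (h1 : 1 <= t / kappa) by (apply (Rmult_le_reg_r kappa); [lra|]; unfold Rdiv; rewrite Rmult_assoc, Rinv_l; lra).
replace t with (kappa * (t / kappa)) at 1 by (field; lra).
rewrite <- Rpower_mult_distr by lra.
rewrite !Rmult_assoc; apply Rmult_le_compat_l; [left; apply Rpower_pos|].
assert (h2 : Rpower (t / kappa) mu <= (t / kappa) ^ S m).
{ rewrite <- Rpower_pow by lra; apply Rle_Rpower; [lra|]; rewrite S_INR; lra. }
eapply Rle_trans; [exact h2|].
replace (t / kappa) with ((2 / kappa) * (t / 2)) by (field; lra).
rewrite Rpow_mult_distr.
pose proof (pow_le_exp (t / 2) (S m) ltac:(lra)) as h3.
assert (0 <= (2 / kappa) ^ S m) by (apply pow_le, Rdiv_le_0_compat; lra).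
nra.
Qed.

(** [Rpower_le_exp] is applied to [k |z|]. Since [|z| <= |x| + kappa / k], for negative [x] the
    factor [exp (k |z| / 2)] consumes half of the decay of [exp (k x)] up to a constant; for
    [0 <= x <= kappa / k] the loss is at most [exp (3 kappa / 2)]. *)
Lemma hankel_pointwise kappa mu : 0 < kappa -> exists K, 0 < K /\
  forall k x y, 0 < k -> x <= kappa / k -> kappa / k <= Cmod (x, y) <= Rabs x + kappa / k ->
  Rpower (Cmod (x, y)) mu * exp (k * x) <= K * Rpower k (- mu) * exp (k * x / 2).
Proof.
intros hk; destruct (Rpower_le_exp kappa mu hk) as [K [hK H]].
exists (K * exp (3 * kappa / 2)); split; [apply Rmult_lt_0_compat; [lra | apply exp_pos]|].
intros k x y hk0 hx [h1 h2].
set (r := Cmod (x, y)) in *.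
assert (e0 : k * (kappa / k) = kappa) by (field; lra).
apply (Rmult_le_compat_l k) in hx, h1, h2; try lra.
rewrite Rmult_plus_distr_l, e0 in h2; rewrite e0 in hx, h1.
assert (hr : 0 < r) by nra.
specialize (H (k * r) h1).
rewrite <- Rpower_mult_distr in H by lra.
rewrite Rpower_Ropp.
assert (hp := Rpower_pos k mu).
assert (h3 : Rpower r mu <= / Rpower k mu * (K * exp (k * r / 2))).
{ apply (Rmult_le_reg_l (Rpower k mu)); [exact hp|].
  rewrite <- Rmult_assoc, Rinv_r, Rmult_1_l by lra; exact H. }
assert (h4 : exp (k * r / 2) * exp (k * x) <= exp (3 * kappa / 2) * exp (k * x / 2)).
{ rewrite <- !exp_plus; apply exp_le_compat.
  destruct (Rle_dec 0 x) as [h0|h0].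
  - rewrite Rabs_pos_eq in h2 by lra; nra.
  - rewrite Rabs_left1 in h2 by lra; nra. }
assert (h5 := exp_pos (k * x)).
apply Rle_trans with (/ Rpower k mu * (K * exp (k * r / 2)) * exp (k * x)).
- apply Rmult_le_compat_r; lra.
- replace (K * exp (3 * kappa / 2) * / Rpower k mu * exp (k * x / 2))
    with ((/ Rpower k mu * K) * (exp (3 * kappa / 2) * exp (k * x / 2))) by ring.
  replace (/ Rpower k mu * (K * exp (k * r / 2)) * exp (k * x))
    with ((/ Rpower k mu * K) * (exp (k * r / 2) * exp (k * x))) by ring.
  apply Rmult_le_compat_l; [|exact h4].
  left; apply Rmult_lt_0_compat; [apply Rinv_0_lt_compat|]; lra.
Qed.

Lemma is_RInt_exp_half k a b : 0 < k ->
  is_RInt (fun x => exp (k * x / 2)) a b (2 / k * (exp (k * b / 2) - exp (k * a / 2))).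
Proof.
intros hk.
replace (2 / k * (exp (k * b / 2) - exp (k * a / 2)))
  with (minus (2 / k * exp (k * b / 2)) (2 / k * exp (k * a / 2)))
  by (unfold minus, plus, opp; simpl; ring).
apply (is_RInt_derive (fun x => 2 / k * exp (k * x / 2))).
- intros x _; auto_derive; [trivial | unfold Rdiv; field; lra].
- intros x _; apply (ex_derive_continuous (V := R_NormedModule)); auto_derive; trivial.
Qed.

(** The value of the primitive at the left end is discarded, so the bound does not see the length of
    the piece; only [exp (k b / 2)] from the right end remains. *)
Lemma hor_Hankel_le kappa mu : 0 < kappa -> exists K, 0 < K /\
  forall f k A a b y, 0 < k -> 0 <= A -> a <= b -> b <= kappa / k -> Rabs y = kappa / k ->
  (forall x, a <= x <= b -> Cdiff f (x, y)) ->
  (forall x, a <= x <= b -> Cmod (f (x, y)) <= A * (Rpower (Cmod (x, y)) mu * exp (k * x))) ->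
  Cmod (hor f a b y) <= K * A * Rpower k (- mu - 1) * exp (k * b / 2).
Proof.
intros hk; destruct (hankel_pointwise kappa mu hk) as [K [hK H]].
exists (2 * K); split; [lra|].
intros f k A a b y hk0 hA hab hb hy D B.
assert (I := is_RInt_exp_half k a b hk0).
apply (is_RInt_scal _ _ _ (A * K * Rpower k (- mu))) in I.
change (is_RInt (fun x => A * K * Rpower k (- mu) * exp (k * x / 2)) a b
  (A * K * Rpower k (- mu) * (2 / k * (exp (k * b / 2) - exp (k * a / 2))))) in I.
eapply Rle_trans.
- apply (Cmod_CInt_le (fun x => f (x, y)) (fun x => A * K * Rpower k (- mu) * exp (k * x / 2)));
    [exact hab | apply ex_CInt_h; assumption | eexists; exact I |].
  intros x hx; eapply Rle_trans; [apply B, hx|].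
  rewrite !Rmult_assoc; apply Rmult_le_compat_l; [exact hA|].
  rewrite <- !Rmult_assoc; apply H; [exact hk0 | lra |]; split.
  + rewrite <- hy; apply (abs_Im_le (x, y)).
  + rewrite <- hy; apply (Cmod_le_abs (x, y)).
- rewrite (is_RInt_unique _ _ _ _ I).
  replace (- mu - 1) with (- mu + - (1)) by ring.
  rewrite Rpower_plus.
  assert (e : Rpower k (- (1)) = / k) by (rewrite Rpower_Ropp, Rpower_1 by lra; reflexivity).
  rewrite e.
  replace (A * K * Rpower k (- mu) * (2 / k * (exp (k * b / 2) - exp (k * a / 2))))
    with (2 * K * A * (Rpower k (- mu) * / k) * (exp (k * b / 2) - exp (k * a / 2))) by (field; lra).
  apply Rmult_le_compat_l.
  + assert (0 < Rpower k (- mu) * / k)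
      by (apply Rmult_lt_0_compat; [apply Rpower_pos | apply Rinv_0_lt_compat; lra]).
    apply Rmult_le_pos; nra.
  + pose proof (exp_pos (k * a / 2)); lra.
Qed.

(** At distance [kappa / k] from the cut everything scales: the power contributes [k^(- mu)] and the
    integration [1 / k]. The factor [A] absorbs whatever multiplies the kernel. *)
Lemma hankel_le kappa mu : 0 < kappa -> exists K, 0 < K /\
  forall f k A X, 0 < k -> 0 <= A -> 0 <= X ->
  (forall x y, - X <= x <= kappa / k -> Rabs y <= kappa / k ->
     (x = kappa / k \/ Rabs y = kappa / k) -> Cdiff f (x, y)) ->
  (forall x y, - X <= x <= kappa / k -> Rabs y <= kappa / k ->
     (x = kappa / k \/ Rabs y = kappa / k) ->
     Cmod (f (x, y)) <= A * (Rpower (Cmod (x, y)) mu * exp (k * x))) ->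
  Cmod (hankel f X (kappa / k)) <= K * A * Rpower k (- mu - 1).
Proof.
intros hk.
destruct (hor_Hankel_le kappa mu hk) as [K1 [hK1 H1]].
destruct (hankel_pointwise kappa mu hk) as [K2 [hK2 H2]].
exists (2 * K1 * exp (kappa / 2) + 2 * kappa * K2 * exp (kappa / 2)).
assert (he := exp_pos (kappa / 2)).
split; [apply Rplus_lt_0_compat; repeat apply Rmult_lt_0_compat; lra|].
intros f k A X hk0 hA hX D B; set (h := kappa / k) in *.
assert (hh : 0 < h) by (apply Rdiv_lt_0_compat; lra).
assert (ekh : k * h = kappa) by (unfold h; field; lra).
assert (ep : Rpower k (- mu - 1) = Rpower k (- mu) * / k).
{ unfold Rminus; rewrite Rpower_plus; f_equal; rewrite Rpower_Ropp, Rpower_1; trivial. }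
assert (P1 : forall y, Rabs y = h ->
  Cmod (hor f (- X) h y) <= K1 * A * Rpower k (- mu - 1) * exp (kappa / 2)).
{ intros y hy; rewrite <- ekh.
  apply (H1 f k A (- X) h y hk0 hA ltac:(lra) (Rle_refl h) hy).
  - intros; apply D; lra.
  - intros; apply B; lra. }
assert (P2 : Cmod (ver f h (- h) h) <= (h - - h) * (A * (K2 * Rpower k (- mu) * exp (kappa / 2)))).
{ apply Cmod_ver_le; [lra | |].
  - intros y hy; apply D; [lra | apply Rabs_le; lra | tauto].
  - intros y hy; eapply Rle_trans; [apply B; [lra | apply Rabs_le; lra | tauto]|].
    apply Rmult_le_compat_l; [exact hA|]; rewrite <- ekh.
    apply H2; [exact hk0 | unfold h; lra |]; fold h.
    pose proof (abs_Re_le (h, y)) as a1; pose proof (Cmod_le_abs (h, y)) as a2; simpl in a1, a2.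
    rewrite Rabs_pos_eq in a1 |- * by lra; rewrite (Rabs_pos_eq h) in a2 by lra.
    assert (Rabs y <= h) by (apply Rabs_le; lra); lra. }
unfold hankel.
assert (T : forall a b c : C, Cmod (a + b - c) <= Cmod a + Cmod b + Cmod c).
{ intros a b c; eapply Rle_trans; [apply Cmod_triangle|]; rewrite Cmod_opp.
  apply Rplus_le_compat_r, Cmod_triangle. }
eapply Rle_trans; [apply T|].
pose proof (P1 h ltac:(rewrite Rabs_pos_eq; lra)) as Q1.
pose proof (P1 (- h) ltac:(rewrite Rabs_left1; lra)) as Q2.
assert (e3 : (h - - h) * (A * (K2 * Rpower k (- mu) * exp (kappa / 2)))
  = 2 * kappa * K2 * exp (kappa / 2) * A * Rpower k (- mu - 1)).
{ rewrite ep; unfold h; field; lra. }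
rewrite e3 in P2; lra.
Qed.

Lemma hor_scale f g k a b y (c : C) : 0 < k -> a <= b ->
  (forall x, a <= x <= b -> f (x, y) = (c * g ((k * x)%R, (k * y)%R))%C) ->
  (forall x, k * a <= x <= k * b -> Cdiff g (x, k * y)) ->
  hor f a b y = (c * / k * hor g (k * a) (k * b) (k * y))%C.
Proof.
intros hk hab E D; unfold hor.
assert (X := CInt_comp_lin (fun x => g (x, k * y)) k 0 a b).
rewrite !Rplus_0_r in X.
assert (I : ex_CInt (fun x => g (x, k * y)) (k * a) (k * b)) by (apply ex_CInt_h; [nra | exact D]).
rewrite <- X by exact I.
assert (hk' : RtoC k <> 0%C) by (intros e; apply RtoC_inj in e; lra).
rewrite <- CInt_scal.
- apply CInt_ext; [exact hab|]; intros x hx; rewrite E by lra; rewrite Rplus_0_r; field; exact hk'.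
- apply ex_CInt_scal, ex_CInt_continuous; [exact hab|]; intros x hx.
  apply (Cdiff_continuous_path g (fun t => (k * t + 0, k * y)) x).
  + apply D; nra.
  + exists k; intros t; eapply Rle_trans; [apply Cmod_le_abs|]; simpl.
    replace (k * y + - (k * y)) with 0 by ring.
    replace (k * t + 0 + - (k * x + 0)) with (k * (t - x)) by ring.
    rewrite Rabs_R0, Rabs_mult, (Rabs_pos_eq k) by lra; lra.
Qed.

Lemma ver_scale f g k x a b (c : C) : 0 < k -> a <= b ->
  (forall y, a <= y <= b -> f (x, y) = (c * g ((k * x)%R, (k * y)%R))%C) ->
  (forall y, k * a <= y <= k * b -> Cdiff g (k * x, y)) ->
  ver f x a b = (c * / k * ver g (k * x) (k * a) (k * b))%C.
Proof.
intros hk hab E D; unfold ver.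
assert (X := CInt_comp_lin (fun y => Ci * g ((k * x)%R, y))%C k 0 a b).
rewrite !Rplus_0_r in X.
assert (I : ex_CInt (fun y => Ci * g ((k * x)%R, y))%C (k * a) (k * b))
  by (apply ex_CInt_scal, ex_CInt_v; [nra | exact D]).
rewrite <- X by exact I.
assert (hk' : RtoC k <> 0%C) by (intros e; apply RtoC_inj in e; lra).
rewrite <- CInt_scal.
- apply CInt_ext; [exact hab|]; intros y hy; rewrite E by lra; rewrite Rplus_0_r; field; exact hk'.
- apply ex_CInt_scal, ex_CInt_scal, ex_CInt_continuous; [exact hab|]; intros y hy.
  apply (Cdiff_continuous_path g (fun t => (k * x, k * t + 0)) y).
  + apply D; nra.
  + exists k; intros t; eapply Rle_trans; [apply Cmod_le_abs|]; simpl.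
    replace (k * x + - (k * x)) with 0 by ring.
    replace (k * t + 0 + - (k * y + 0)) with (k * (t - y)) by ring.
    rewrite Rabs_R0, Rabs_mult, (Rabs_pos_eq k) by lra; lra.
Qed.

Definition hankel_kernel (mu k : R) (z : C) : C := (Cpowr z mu * Cexp (k * z))%C.

Lemma Cdiff_hankel_kernel mu k z : cut_plane z -> Cdiff (hankel_kernel mu k) z.
Proof.
intros H; apply Cdiff_mult.
- apply (Cdiff_Cpowr (fun z => z)); [exact H | apply Cdiff_id].
- apply Cdiff_Cexp, Cdiff_mult; [apply Cdiff_const | apply Cdiff_id].
Qed.

Lemma Cmod_hankel_kernel mu k x y :
  Cmod (hankel_kernel mu k (x, y)) = Rpower (Cmod (x, y)) mu * exp (k * x).
Proof.
unfold hankel_kernel; rewrite Cmod_mult, Cmod_Cpowr, Cmod_Cexp; do 2 f_equal; simpl; ring.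
Qed.

Lemma hankel_kernel_scale mu k x y : 0 < k -> cut_plane (x, y) ->
  hankel_kernel mu k (x, y) = (Rpower k (- mu) * hankel_kernel mu 1 ((k * x)%R, (k * y)%R))%C.
Proof.
intros hk H; unfold hankel_kernel.
replace ((k * x)%R, (k * y)%R) with (k * (x, y))%C by (apply injective_projections; simpl; ring).
rewrite Cpowr_scal by (try exact hk; apply cut_plane_pos, H).
rewrite Cmult_1_l.
assert (e : (Rpower k (- mu) * Rpower k mu)%R = 1)
  by (rewrite <- Rpower_plus, Rplus_opp_l; apply Rpower_O, hk).
apply (f_equal RtoC) in e; rewrite RtoC_mult in e.
rewrite !Cmult_assoc, e; ring.
Qed.

(** Substitution of [z / k] for [z] and homogeneity of the power. For [mu = - s - 1] this produces
    the factor [k^s] of the moments. *)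
Lemma hankel_scale mu k X h : 0 < k -> 0 < h -> 0 <= X ->
  hankel (hankel_kernel mu k) X h =
  (Rpower k (- mu - 1) * hankel (hankel_kernel mu 1) (k * X)%R (k * h)%R)%C.
Proof.
intros hk hh hX; unfold hankel.
assert (hk' : RtoC k <> 0%C) by (intros e; apply RtoC_inj in e; lra).
assert (ep : RtoC (Rpower k (- mu - 1)) = (Rpower k (- mu) * / k)%C).
{ unfold Rminus; rewrite Rpower_plus, RtoC_mult; f_equal.
  rewrite Rpower_Ropp, Rpower_1, RtoC_inv by lra; trivial. }
assert (C1 : forall x y, y <> 0 -> cut_plane (x, y)) by (intros; apply cut_plane_Im; assumption).
rewrite (hor_scale _ (hankel_kernel mu 1) k (- X) h (- h) (Rpower k (- mu))),
  (hor_scale _ (hankel_kernel mu 1) k (- X) h h (Rpower k (- mu))),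
  (ver_scale _ (hankel_kernel mu 1) k h (- h) h (Rpower k (- mu))); try lra.
- rewrite ep; replace (k * - X) with (- (k * X)) by ring; replace (k * - h) with (- (k * h)) by ring; ring.
- intros; apply hankel_kernel_scale; [exact hk | apply cut_plane_Re, hh].
- intros; apply Cdiff_hankel_kernel, cut_plane_Re; nra.
- intros; apply hankel_kernel_scale; [exact hk | apply C1; lra].
- intros; apply Cdiff_hankel_kernel, C1; nra.
- intros; apply hankel_kernel_scale; [exact hk | apply C1; lra].
- intros; apply Cdiff_hankel_kernel, C1; nra.
Qed.

(** A longer contour differs by two horizontal pieces to the left of [- X], where the exponential is
    small. *)
Lemma hankel_cauchy kappa mu : 0 < kappa -> exists K, 0 < K /\
  forall X Y, 0 <= X <= Y ->
  Cmod (hankel (hankel_kernel mu 1) Y kappa - hankel (hankel_kernel mu 1) X kappa)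
    <= K * exp (- X / 2).
Proof.
intros hk; destruct (hor_Hankel_le kappa mu hk) as [K [hK H]].
exists (2 * K); split; [lra|]; intros X Y hXY.
assert (D : forall x y, y <> 0 -> Cdiff (hankel_kernel mu 1) (x, y))
  by (intros; apply Cdiff_hankel_kernel, cut_plane_Im; assumption).
assert (P : forall y, Rabs y = kappa ->
  Cmod (hor (hankel_kernel mu 1) (- Y) (- X) y) <= K * exp (- X / 2)).
{ intros y hy.
  assert (hy0 : y <> 0) by (intros e; rewrite e, Rabs_R0 in hy; lra).
  eapply Rle_trans.
  - apply (H (hankel_kernel mu 1) 1 1 (- Y) (- X) y); try lra.
    + intros; apply D, hy0.
    + intros; rewrite Cmod_hankel_kernel; lra.
  - replace (Rpower 1 (- mu - 1)) with 1
      by (unfold Rpower; rewrite ln_1, Rmult_0_r, exp_0; reflexivity).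
    rewrite !Rmult_1_r, Rmult_1_l; apply Rle_refl. }
assert (E : (hankel (hankel_kernel mu 1) Y kappa - hankel (hankel_kernel mu 1) X kappa
  = hor (hankel_kernel mu 1) (- Y) (- X) (- kappa) - hor (hankel_kernel mu 1) (- Y) (- X) kappa)%C).
{ unfold hankel.
  rewrite (hor_Chasles _ (- Y) (- X) kappa (- kappa)), (hor_Chasles _ (- Y) (- X) kappa kappa);
    try lra; try (intros; apply D; lra); ring. }
rewrite E; eapply Rle_trans; [apply Cmod_triangle|]; rewrite Cmod_opp.
pose proof (P kappa ltac:(apply Rabs_pos_eq; lra)).
pose proof (P (- kappa) ltac:(rewrite Rabs_Ropp; apply Rabs_pos_eq; lra)); lra.
Qed.

(** * Hankel's constant and the window *)

(** The limit is taken on each component with the total function [Lim_seq], so that [hankel_const]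
    can be a plain definition; the factor 2 adds up the two components. *)
Lemma C_seq_limit (u : nat -> C) (e : nat -> R) : is_lim_seq e 0 ->
  (forall i j, (i <= j)%nat -> Cmod (u j - u i) <= e i) ->
  forall i, Cmod (u i - (real (Lim_seq (fun j => Re (u j))), real (Lim_seq (fun j => Im (u j))))) <= 2 * e i.
Proof.
intros he H.
assert (P : forall v : nat -> R, (forall i j, (i <= j)%nat -> Rabs (v j - v i) <= e i) ->
  forall i, Rabs (v i - real (Lim_seq v)) <= e i).
{ intros v Hv.
  assert (X : ex_finite_lim_seq v).
  { apply ex_lim_seq_cauchy_corr; intros [eps heps].
    apply is_lim_seq_spec in he; destruct (he (mkposreal (eps / 2) ltac:(lra))) as [N HN].
    exists N; intros n m hn hm; simpl.
    pose proof (Hv N n hn) as a; pose proof (Hv N m hm) as b; pose proof (HN N (Nat.le_refl N)) as c.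
    simpl in c; rewrite Rminus_0_r in c; pose proof (Rle_abs (e N)).
    replace (v n - v m) with ((v n - v N) - (v m - v N)) by ring.
    eapply Rle_lt_trans; [apply Rabs_triang|]; rewrite Rabs_Ropp; lra. }
  apply Lim_seq_correct' in X; intros i.
  assert (L : is_lim_seq (fun j => Rabs (v i - v j)) (Rabs (v i - real (Lim_seq v)))).
  { apply (is_lim_seq_abs _ (Finite _)).
    apply is_lim_seq_minus'; [apply is_lim_seq_const | exact X]. }
  refine (is_lim_seq_le_loc _ (fun _ => e i) (Finite _) (Finite (e i)) _ L (is_lim_seq_const _)).
  exists i; intros j hj; rewrite Rabs_minus_sym; apply Hv, hj. }
intros i; eapply Rle_trans; [apply Cmod_le_abs|].
pose proof (P (fun j => Re (u j))) as P1; pose proof (P (fun j => Im (u j))) as P2.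
assert (Q1 : forall i j, (i <= j)%nat -> Rabs (Re (u j) - Re (u i)) <= e i).
{ intros a b hab; eapply Rle_trans; [|apply (H a b hab)].
  apply (abs_Re_le (u b - u a)). }
assert (Q2 : forall i j, (i <= j)%nat -> Rabs (Im (u j) - Im (u i)) <= e i).
{ intros a b hab; eapply Rle_trans; [|apply (H a b hab)].
  apply (abs_Im_le (u b - u a)). }
specialize (P1 Q1 i); specialize (P2 Q2 i); unfold Rminus, Re, Im in *; simpl; lra.
Qed.

(* [2 * PI * Ci / Gamma (s + 1)], by Hankel's formula. *)
Definition hankel_const (d s : R) : C :=
  (real (Lim_seq (fun j => Re (hankel (hankel_kernel (- s - 1) 1) (INR j * d) (d / 2)))),
   real (Lim_seq (fun j => Im (hankel (hankel_kernel (- s - 1) 1) (INR j * d) (d / 2))))).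

Lemma exp_neg_lt_1 d : 0 < d -> Rabs (exp (- d / 2)) < 1.
Proof.
intros hd; rewrite Rabs_pos_eq by (left; apply exp_pos).
rewrite <- exp_0; apply exp_increasing; lra.
Qed.

Lemma exp_nat_scale j x : exp (INR j * x) = exp x ^ j.
Proof.
rewrite <- Rpower_pow by apply exp_pos; unfold Rpower; rewrite ln_exp; reflexivity.
Qed.

Lemma is_lim_seq_exp_neg K d : 0 < d -> is_lim_seq (fun j => K * exp (- (INR j * d) / 2)) 0.
Proof.
intros hd; apply (is_lim_seq_ext (fun j => K * exp (- d / 2) ^ j)).
- intros j; rewrite <- exp_nat_scale; do 2 f_equal; field.
- replace (Finite 0) with (Rbar_mult K 0) by (simpl; f_equal; ring).
  apply is_lim_seq_scal_l, is_lim_seq_geom, exp_neg_lt_1, hd.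
Qed.

Lemma hankel_const_spec d s : 0 < d -> exists K, 0 < K /\
  forall j, Cmod (hankel (hankel_kernel (- s - 1) 1) (INR j * d) (d / 2) - hankel_const d s)
    <= K * exp (- (INR j * d) / 2).
Proof.
intros hd; destruct (hankel_cauchy (d / 2) (- s - 1) ltac:(lra)) as [K [hK H]].
exists (2 * K); split; [lra|]; intros j; rewrite Rmult_assoc.
apply (C_seq_limit (fun j => hankel (hankel_kernel (- s - 1) 1) (INR j * d) (d / 2))
  (fun j => K * exp (- (INR j * d) / 2))).
- apply is_lim_seq_exp_neg, hd.
- intros i k hik; apply H; apply le_INR in hik; pose proof (pos_INR i); nra.
Qed.

(** Chain rule across two fields: a complex derivative along a real affine path of direction [v]. *)
Lemma is_derive_path F g (t : R) (l v : C) : Cderiv F (g t) l ->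
  (forall r : R, (g r - g t = (r - t)%R * v)%C) ->
  is_derive (K := R_AbsRing) (V := C_R_NormedModule) (fun r => F (g r)) t (v * l)%C.
Proof.
intros D E; split; [apply is_linear_scal_l|].
intros x L [eps he].
pose proof (is_filter_lim_locally_unique (V := R_NormedModule) t x L) as e; rewrite <- e; clear x L e.
rewrite Cderiv_eps in D.
assert (hv : 0 < Cmod v + 1) by (pose proof (Cmod_ge_0 v); lra).
destruct (D (eps / (Cmod v + 1))) as [r [hr Hr]]; [apply Rdiv_lt_0_compat; lra|].
exists (mkposreal (r / (Cmod v + 1)) (Rdiv_lt_0_compat _ _ hr hv)); intros y hy.
change (Rabs (y - t) < r / (Cmod v + 1)) in hy.
apply (Rmult_lt_compat_r (Cmod v + 1)) in hy; [|exact hv].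
replace (r / (Cmod v + 1) * (Cmod v + 1)) with r in hy by (field; lra).
assert (eg : Cmod (g y - g t) = Rabs (y - t) * Cmod v) by (rewrite E, Cmod_mult, Cmod_R; reflexivity).
pose proof (Rabs_pos (y - t)).
specialize (Hr (g y)); rewrite eg in Hr; specialize (Hr ltac:(lra)).
rewrite norm_C_R.
match goal with |- Cmod ?z <= _ => replace z with (F (g y) - F (g t) - l * (g y - g t))%C end.
- eapply Rle_trans; [exact Hr|].
  change (norm (minus y t)) with (Rabs (y - t)).
  assert (eps / (Cmod v + 1) * Cmod v <= eps).
  { apply (Rmult_le_reg_r (Cmod v + 1)); [exact hv|].
    replace (eps / (Cmod v + 1) * Cmod v * (Cmod v + 1)) with (eps * Cmod v) by (field; lra). nra. }
  simpl; nra.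
- rewrite E.
  match goal with |- _ = minus (minus ?a ?b) (scal ?c ?z) =>
    transitivity (a - b - c * z)%C end.
  + change (minus y t) with (y - t); ring.
  + rewrite <- scal_R_Cmult; reflexivity.
Qed.

Lemma hor_primitive F f a b y : a <= b ->
  (forall x, a <= x <= b -> Cderiv F (x, y) (f (x, y)) /\ Cdiff f (x, y)) ->
  hor f a b y = (F (b, y) - F (a, y))%C.
Proof.
intros hab H; apply CInt_unique.
apply (is_RInt_derive (V := C_R_CompleteNormedModule) (fun x => F (x, y))).
- rewrite Rmin_left, Rmax_right by exact hab; intros x hx.
  replace (f (x, y)) with (1 * f (x, y))%C by ring.
  apply (is_derive_path F (fun x => (x, y))); [apply H, hx|].
  intros r; apply injective_projections; simpl; ring.
- rewrite Rmin_left, Rmax_right by exact hab; intros x hx; apply Cdiff_continuous_h, H, hx.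
Qed.

Lemma ver_primitive F f x a b : a <= b ->
  (forall y, a <= y <= b -> Cderiv F (x, y) (f (x, y)) /\ Cdiff f (x, y)) ->
  ver f x a b = (F (x, b) - F (x, a))%C.
Proof.
intros hab H; apply CInt_unique.
apply (is_RInt_derive (V := C_R_CompleteNormedModule) (fun y => F (x, y))).
- rewrite Rmin_left, Rmax_right by exact hab; intros y hy.
  apply (is_derive_path F (fun y => (x, y))); [apply H, hy|].
  intros r; apply injective_projections; simpl; ring.
- rewrite Rmin_left, Rmax_right by exact hab; intros y hy.
  apply (Cdiff_continuous_v (fun z => Ci * f z)%C).
  apply Cdiff_mult; [apply Cdiff_const | apply H, hy].
Qed.

Definition Cdiff_on_hankel (f : C -> C) (X h : R) : Prop :=
  forall x y, (- X <= x <= h /\ Rabs y = h) \/ (x = h /\ - h <= y <= h) -> Cdiff f (x, y).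

Lemma ex_CInt_hankel f X h : 0 < h -> 0 <= X -> Cdiff_on_hankel f X h ->
  ex_CInt (fun x => f (x, h)) (- X) h /\ ex_CInt (fun x => f (x, - h)) (- X) h /\
  ex_CInt (fun y => Ci * f (h, y))%C (- h) h.
Proof.
intros hh hX D; repeat split.
- apply ex_CInt_h; [lra|]; intros x hx; apply D; left; split; [exact hx | apply Rabs_pos_eq; lra].
- apply ex_CInt_h; [lra|]; intros x hx; apply D; left; split; [exact hx|].
  rewrite Rabs_Ropp; apply Rabs_pos_eq; lra.
- apply ex_CInt_scal, ex_CInt_v; [lra|]; intros y hy; apply D; right; split; [reflexivity | exact hy].
Qed.

Lemma hankel_minus f g X h : 0 < h -> 0 <= X ->
  Cdiff_on_hankel f X h -> Cdiff_on_hankel g X h ->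
  hankel (fun z => f z - g z)%C X h = (hankel f X h - hankel g X h)%C.
Proof.
intros hh hX Df Dg; unfold hankel, hor, ver.
destruct (ex_CInt_hankel f X h hh hX Df) as (F1 & F2 & F3).
destruct (ex_CInt_hankel g X h hh hX Dg) as (G1 & G2 & G3).
rewrite (CInt_ext (fun y => Ci * (f (h, y) - g (h, y)))%C
  (fun y => Ci * f (h, y) - Ci * g (h, y))%C) by (try lra; intros; ring).
rewrite (CInt_minus _ _ _ _ F1 G1), (CInt_minus _ _ _ _ F2 G2), (CInt_minus _ _ _ _ F3 G3); ring.
Qed.

Lemma hankel_scal c f X h : 0 < h -> 0 <= X -> Cdiff_on_hankel f X h ->
  hankel (fun z => c * f z)%C X h = (c * hankel f X h)%C.
Proof.
intros hh hX Df; unfold hankel, hor, ver.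
destruct (ex_CInt_hankel f X h hh hX Df) as (F1 & F2 & F3).
rewrite (CInt_ext (fun y => Ci * (c * f (h, y)))%C
  (fun y => c * (Ci * f (h, y)))%C) by (try lra; intros; ring).
rewrite (CInt_scal c _ _ _ F1), (CInt_scal c _ _ _ F2), (CInt_scal c _ _ _ F3); ring.
Qed.

Lemma Cdiff_on_hankel_kernel mu k X h : 0 < h -> Cdiff_on_hankel (hankel_kernel mu k) X h.
Proof.
intros hh x y [[_ e]|[-> _]]; apply Cdiff_hankel_kernel; [apply cut_plane_Im | apply cut_plane_Re, hh].
intros e'; rewrite e', Rabs_R0 in e; lra.
Qed.

(** Integration by parts: [z^(-s) e^z] has derivative [z^(-s) e^z - s z^(-s-1) e^z], so the two
    contour integrals differ by boundary values at real part [- X], which tend to 0. This is the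
    functional equation of the gamma function. *)
Lemma hankel_const_rec d s : 0 < d -> hankel_const d (s - 1) = (s * hankel_const d s)%C.
Proof.
intros hd.
destruct (hankel_const_spec d s hd) as [K1 [hK1 H1]].
destruct (hankel_const_spec d (s - 1) hd) as [K2 [hK2 H2]].
destruct (Rpower_le_exp (d / 2) (- s) ltac:(lra)) as [K3 [hK3 H3]].
set (F := hankel_kernel (- s) 1).
assert (DF : forall z, cut_plane z ->
  Cderiv F z (hankel_kernel (- s) 1 z - s * hankel_kernel (- s - 1) 1 z)%C).
{ intros z hz.
  replace (hankel_kernel (- s) 1 z - s * hankel_kernel (- s - 1) 1 z)%C
    with ((- s)%R * Cpowr z (- s - 1) * Cexp (1%R * z) + Cpowr z (- s) * (1 * Cexp (1%R * z)))%C.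
  - apply (Cderiv_mult (fun z => Cpowr z (- s)) (fun z => Cexp (1%R * z))); [apply Cderiv_Cpowr, hz|].
    apply (Cderiv_comp Cexp (fun z => 1%R * z)%C); [apply Cderiv_Cexp|].
    pose proof (Cderiv_scal 1 _ _ _ (Cderiv_id z)) as Q; rewrite Cmult_1_r in Q; exact Q.
  - unfold hankel_kernel; rewrite RtoC_opp; ring. }
assert (B : forall j, Cmod (hankel_const d (s - 1) - s * hankel_const d s)
  <= (K2 + Rabs s * K1 + 2 * K3 * exp (d / 4)) * exp (- (INR j * d) / 2)).
{ intros j; set (X := INR j * d); set (k := d / 2).
  assert (hk : 0 < k) by (unfold k; lra).
  assert (hX : 0 <= X) by (unfold X; pose proof (pos_INR j); nra).
  assert (DK : forall mu, Cdiff_on_hankel (hankel_kernel mu 1) X k)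
    by (intros; apply Cdiff_on_hankel_kernel, hk).
  assert (E : (hankel (hankel_kernel (- s) 1) X k - s * hankel (hankel_kernel (- s - 1) 1) X k
     = F ((- X)%R, k) - F ((- X)%R, (- k)%R))%C).
  { rewrite <- (hankel_scal s _ _ _ hk hX (DK _)).
    rewrite <- (hankel_minus _ (fun z => s * hankel_kernel (- s - 1) 1 z)%C _ _ hk hX (DK _))
      by (intros x y hxy; apply Cdiff_mult; [apply Cdiff_const | apply (DK _ x y hxy)]).
    assert (DD : Cdiff_on_hankel (fun z => hankel_kernel (- s) 1 z - s * hankel_kernel (- s - 1) 1 z)%C X k).
    { intros x y hxy; apply Cdiff_minus; [apply DK, hxy|].
      apply Cdiff_mult; [apply Cdiff_const | apply (DK _ x y hxy)]. }
    unfold hankel.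
    rewrite !(hor_primitive F), (ver_primitive F); try lra; [ring|..];
      intros t ht; (split;
      [ apply DF; first [apply cut_plane_Re; lra | apply cut_plane_Im; lra]
      | apply DD; first [right; split; lra
          | left; split; [lra|]; rewrite ?Rabs_Ropp, Rabs_pos_eq; lra] ]). }
  assert (FB : forall y, Rabs y = k -> Cmod (F ((- X)%R, y)) <= K3 * exp (d / 4) * exp (- X / 2)).
  { intros y hy; unfold F; rewrite Cmod_hankel_kernel, Rmult_1_l.
    pose proof (abs_Im_le ((- X)%R, y)) as a1; pose proof (Cmod_le_abs ((- X)%R, y)) as a2.
    simpl in a1, a2; rewrite hy in a1, a2; rewrite Rabs_Ropp, (Rabs_pos_eq X) in a2 by lra.
    specialize (H3 _ a1).
    assert (e : exp (Cmod (- X, y) / 2) * exp (- X) <= exp (d / 4) * exp (- X / 2)).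
    { rewrite <- !exp_plus; apply exp_le_compat; unfold k in *; lra. }
    pose proof (exp_pos (- X)).
    apply Rle_trans with (K3 * exp (Cmod (- X, y) / 2) * exp (- X)); [apply Rmult_le_compat_r; lra|].
    rewrite !Rmult_assoc; apply Rmult_le_compat_l; lra. }
  specialize (H1 j); specialize (H2 j); fold X k in H1, H2.
  replace (- (s - 1) - 1) with (- s) in H2 by ring.
  replace (hankel_const d (s - 1) - s * hankel_const d s)%C with
    (- (hankel (hankel_kernel (- s) 1) X k - hankel_const d (s - 1))
     + s * (hankel (hankel_kernel (- s - 1) 1) X k - hankel_const d s)
     + (F ((- X)%R, k) - F ((- X)%R, (- k)%R)))%C by (rewrite <- E; ring).
  eapply Rle_trans; [apply Cmod_triangle|].
  eapply Rle_trans; [apply Rplus_le_compat; [apply Cmod_triangle | apply Cmod_triangle]|].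
  rewrite !Cmod_opp, Cmod_mult, Cmod_R.
  pose proof (FB k ltac:(apply Rabs_pos_eq; lra)).
  pose proof (FB (- k) ltac:(rewrite Rabs_Ropp; apply Rabs_pos_eq; lra)).
  assert (Rabs s * Cmod (hankel (hankel_kernel (- s - 1) 1) X k - hankel_const d s)
    <= Rabs s * (K1 * exp (- X / 2))) by (apply Rmult_le_compat_l; [apply Rabs_pos | exact H1]).
  lra. }
(* The left side of [B] does not depend on [j], while the right side tends to 0. *)
apply (is_lim_seq_le _ _ (Finite (Cmod (hankel_const d (s - 1) - s * hankel_const d s))) (Finite 0)) in B.
- simpl in B; apply Ceq_minus, Cmod_eq_0; pose proof (Cmod_ge_0 (hankel_const d (s - 1) - s * hankel_const d s)); lra.
- apply is_lim_seq_const.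
- apply is_lim_seq_exp_neg, hd.
Qed.

(** The inner power creates zeros of order [M] at [+- i d]. Since [1 - (1 + q)^M] is divisible by
    [q = z^2 / d^2], the outer power makes the deviation from 1 vanish at 0 to order at least
    [M]. *)
Definition window (d : R) (M : nat) (z : C) : C :=
  (1 - (1 - (1 + (/ (d * d))%R * (z * z)) ^ M) ^ M)%C.

Lemma Cdiff_window d M z : Cdiff (window d M) z.
Proof.
apply Cdiff_minus; [apply Cdiff_const|].
apply (Cdiff_pow (fun z => 1 - (1 + (/ (d * d))%R * (z * z)) ^ M)%C).
apply Cdiff_minus; [apply Cdiff_const|].
apply (Cdiff_pow (fun z => 1 + (/ (d * d))%R * (z * z))%C).
apply Cdiff_plus; [apply Cdiff_const|].
apply Cdiff_mult; [apply Cdiff_const|]; apply Cdiff_mult; apply Cdiff_id.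
Qed.

Lemma pow_near_1 M B : 0 <= B -> exists K, 0 < K /\
  forall u : C, Cmod u <= B -> Cmod ((1 + u) ^ M - 1) <= K * Cmod u.
Proof.
intros hB; induction M as [|M [K [hK H]]].
- exists 1; split; [lra|]; intros u _; simpl.
  replace (1 - 1)%C with (RtoC 0) by ring; rewrite Cmod_0; pose proof (Cmod_ge_0 u); lra.
- exists ((1 + B) * K + 1); split; [nra|]; intros u hu; rewrite Cpow_S.
  replace ((1 + u) * (1 + u) ^ M - 1)%C with ((1 + u) * ((1 + u) ^ M - 1) + u)%C by ring.
  eapply Rle_trans; [apply Cmod_triangle|]; rewrite Cmod_mult.
  specialize (H u hu).
  assert (Cmod (1 + u) <= 1 + B) by (eapply Rle_trans; [apply Cmod_triangle|]; rewrite Cmod_1; lra).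
  pose proof (Cmod_ge_0 u); pose proof (Cmod_ge_0 (1 + u)); pose proof (Cmod_ge_0 ((1 + u) ^ M - 1)).
  assert (Cmod (1 + u) * Cmod ((1 + u) ^ M - 1) <= (1 + B) * (K * Cmod u))
    by (apply Rmult_le_compat; assumption).
  lra.
Qed.

Lemma window_bounds d M : 0 < d -> exists K, 0 < K /\
  forall x y, Rabs x <= d -> Rabs y <= d ->
  Cmod (window d M (x, y)) <= K /\
  Cmod (window d M (x, y) - 1) <= K * Cmod (x, y) ^ M /\
  (Rabs y = d -> Cmod (window d M (x, y)) <= K * Rabs x ^ M).
Proof.
intros hd.
destruct (pow_near_1 M 4 ltac:(lra)) as [K1 [hK1 H1]].
destruct (pow_near_1 M (3 ^ M) ltac:(apply pow_le; lra)) as [K2 [hK2 H2]].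
assert (p1 : 0 <= (K1 * (2 / d)) ^ M).
{ apply pow_le; apply Rmult_le_pos; [lra | apply Rdiv_le_0_compat; lra]. }
assert (p2 : 0 <= (2 * d) ^ M) by (apply pow_le; lra).
assert (p3 : 0 <= (3 / d) ^ M) by (apply pow_le, Rdiv_le_0_compat; lra).
assert (p4 := Rmult_le_pos _ _ p1 p2).
exists (1 + (K1 * (2 / d)) ^ M + (K1 * (2 / d)) ^ M * (2 * d) ^ M + K2 * (3 / d) ^ M).
split; [nra|]; intros x y hx hy.
set (z := (x, y)); set (r := Cmod z).
assert (hr : r <= 2 * d) by (eapply Rle_trans; [apply Cmod_le_abs|]; simpl; lra).
assert (hr0 : 0 <= r) by apply Cmod_ge_0.
set (q := ((/ (d * d))%R * (z * z))%C).
assert (hi : 0 < / (d * d)) by (apply Rinv_0_lt_compat; nra).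
assert (hq : Cmod q = r * r / (d * d)).
{ unfold q; rewrite !Cmod_mult, Cmod_R, Rabs_pos_eq by lra; fold r; field; lra. }
assert (e2 : 2 / d * d = 2) by (field; lra).
assert (hd2 : 0 < 2 / d) by (apply Rdiv_lt_0_compat; lra).
assert (hq1 : Cmod q <= 2 / d * r).
{ rewrite hq; replace (r * r / (d * d)) with (r * / (d * d) * r) by (field; lra).
  apply Rmult_le_compat_r; [exact hr0|].
  replace (2 / d) with (2 * d * / (d * d)) by (field; lra); apply Rmult_le_compat_r; lra. }
assert (hq2 : Cmod q <= 4) by nra.
pose proof (H1 q hq2) as B1.
assert (pr : r ^ M <= (2 * d) ^ M) by (apply pow_incr; lra).
assert (pr0 : 0 <= r ^ M) by (apply pow_le, hr0).
assert (W1 : Cmod (window d M z - 1) <= (K1 * (2 / d)) ^ M * r ^ M).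
{ unfold window; fold q.
  replace (1 - (1 - (1 + q) ^ M) ^ M - 1)%C with (- (1 - (1 + q) ^ M) ^ M)%C by ring.
  rewrite Cmod_opp, Cmod_pow, <- Rpow_mult_distr; apply pow_incr; split; [apply Cmod_ge_0|].
  replace (1 - (1 + q) ^ M)%C with (- ((1 + q) ^ M - 1))%C by ring; rewrite Cmod_opp.
  rewrite Rmult_assoc; eapply Rle_trans; [exact B1|]; apply Rmult_le_compat_l; lra. }
split; [|split].
- replace (window d M z) with (1 + (window d M z - 1))%C by ring.
  eapply Rle_trans; [apply Cmod_triangle|]; rewrite Cmod_1.
  assert ((K1 * (2 / d)) ^ M * r ^ M <= (K1 * (2 / d)) ^ M * (2 * d) ^ M)
    by (apply Rmult_le_compat_l; assumption).
  assert (0 <= K2 * (3 / d) ^ M) by (apply Rmult_le_pos; lra); lra.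
- eapply Rle_trans; [exact W1|]; fold r; apply Rmult_le_compat_r; [exact pr0|].
  assert (0 <= K2 * (3 / d) ^ M) by (apply Rmult_le_pos; lra); lra.
- intros e.
  assert (hy2 : y * y = d * d).
  { rewrite <- e, <- Rabs_mult, Rabs_pos_eq; [reflexivity | nra]. }
  (* On the lines [|y| = d] the quantity [1 + q] factors as [x (x + 2 i y) / d^2]; this is the
     source of the power of [|x|]. *)
  assert (V : Cmod (1 + q) <= 3 / d * Rabs x).
  { replace (1 + q)%C with ((x * / (d * d))%R * (x, (2 * y)%R))%C.
    - rewrite Cmod_mult, Cmod_R, Rabs_mult, (Rabs_pos_eq (/ (d * d))) by lra.
      assert (T : Cmod (x, 2 * y) <= 3 * d).
      { eapply Rle_trans; [apply Cmod_le_abs|]; simpl.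
        rewrite Rabs_mult, (Rabs_pos_eq 2) by lra; lra. }
      replace (3 / d) with (/ (d * d) * (3 * d)) by (field; lra).
      pose proof (Rabs_pos x); pose proof (Cmod_ge_0 (x, 2 * y)).
      replace (/ (d * d) * (3 * d) * Rabs x) with (Rabs x * / (d * d) * (3 * d)) by ring.
      apply Rmult_le_compat_l; [apply Rmult_le_pos; lra | exact T].
    - unfold q, z; apply injective_projections; simpl.
      + replace (x * x - y * y) with (x * x - d * d) by lra; field; lra.
      + ring. }
  set (v := ((1 + q) ^ M)%C).
  assert (hv : Cmod v <= (3 / d) ^ M * Rabs x ^ M).
  { unfold v; rewrite Cmod_pow, <- Rpow_mult_distr; apply pow_incr; split; [apply Cmod_ge_0 | exact V]. }
  assert (hv2 : Cmod v <= 3 ^ M).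
  { unfold v; rewrite Cmod_pow; apply pow_incr; split; [apply Cmod_ge_0|].
    eapply Rle_trans; [exact V|].
    replace 3 with (3 / d * d) at 2 by (field; lra); apply Rmult_le_compat_l; [|exact hx].
    apply Rdiv_le_0_compat; lra. }
  assert (W : Cmod (window d M z) <= K2 * Cmod v).
  { unfold window; fold q; fold v.
    replace (1 - (1 - v) ^ M)%C with (- ((1 + - v) ^ M - 1))%C by (unfold Cminus; ring).
    rewrite Cmod_opp, <- (Cmod_opp v); apply H2; rewrite Cmod_opp; exact hv2. }
  eapply Rle_trans; [exact W|].
  apply Rle_trans with (K2 * ((3 / d) ^ M * Rabs x ^ M)); [apply Rmult_le_compat_l; lra|].
  rewrite <- Rmult_assoc; apply Rmult_le_compat_r; [apply pow_le, Rabs_pos|].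
  lra.
Qed.

(** * Windowed moments *)

(** A power is monotone in its base, in a direction given by the sign of [mu]; the sum of both end
    values spares this distinction wherever the bound is used. *)
Lemma Rpower_le_ends a b r mu : 0 < a -> a <= r <= b -> Rpower r mu <= Rpower a mu + Rpower b mu.
Proof.
intros ha h; pose proof (Rpower_pos a mu); pose proof (Rpower_pos b mu).
destruct (Rle_dec 0 mu) as [hm|hm].
- assert (Rpower r mu <= Rpower b mu) by (apply Rle_Rpower_l; lra); lra.
- assert (Rpower r mu <= Rpower a mu); [|lra].
  rewrite <- (Ropp_involutive mu), !(Rpower_Ropp _ (- mu)).
  apply Rinv_le_contravar; [apply Rpower_pos | apply Rle_Rpower_l; lra].
Qed.

Lemma pow_mul_exp_neg x k M : 0 <= x -> 0 < k -> x ^ M * exp (- (k * x)) <= INR M ^ M / k ^ M.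
Proof.
intros hx hk.
pose proof (pow_le_exp (k * x) M ltac:(nra)) as h.
assert (pk : 0 < k ^ M) by (apply pow_lt; lra).
assert (he := exp_pos (k * x)).
rewrite Rpow_mult_distr in h; rewrite exp_Ropp.
apply (Rmult_le_reg_r (k ^ M * exp (k * x))); [apply Rmult_lt_0_compat; lra|].
replace (x ^ M * / exp (k * x) * (k ^ M * exp (k * x))) with (k ^ M * x ^ M) by (field; lra).
replace (INR M ^ M / k ^ M * (k ^ M * exp (k * x))) with (INR M ^ M * exp (k * x)) by (field; lra).
exact h.
Qed.

(* The window makes the passage from the segment to the Hankel contour cost only [k ^ (- M)]. *)
Lemma window_to_hankel d M : 0 < d -> exists K, 0 < K /\
  forall f k c Q, 1 <= k -> 0 < c <= d / 2 / k -> 0 <= Q -> Cdiff_on_box f d ->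
  (forall x y, Rabs x <= d -> Rabs y <= d -> cut_plane (x, y) -> d <= Cmod (x, y) ->
     Cmod (f (x, y)) <= Q * (Cmod (window d M (x, y)) * exp (k * x))) ->
  Cmod (ver f c (- d) d - hankel f d (d / 2 / k)) <= K * Q / k ^ M.
Proof.
intros hd; destruct (window_bounds d M hd) as [K [hK W]].
set (q := INR M ^ M * exp d * (1 + / d ^ M)).
assert (hM : 0 <= INR M ^ M) by (apply pow_le, pos_INR).
assert (pd : 0 < d ^ M) by (apply pow_lt, hd).
assert (ipd : 0 < / d ^ M) by (apply Rinv_0_lt_compat, pd).
assert (he : 1 <= exp d) by (pose proof (exp_ineq1_le d); lra).
assert (hq : 0 <= q) by (unfold q; repeat apply Rmult_le_pos; lra).
exists (8 * d * (K * (q + 1))); split; [repeat apply Rmult_lt_0_compat; lra|].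
intros f k c Q hk hc hQ D B; set (h := d / 2 / k) in *.
assert (hh : h <= d / 2).
{ unfold h; apply (Rmult_le_reg_r k); [lra|]; replace (d / 2 / k * k) with (d / 2) by (field; lra); nra. }
assert (hkh : k * h = d / 2) by (unfold h; field; lra).
assert (pk : 0 < k ^ M) by (apply pow_lt; lra).
assert (ik : 0 < / k ^ M) by (apply Rinv_0_lt_compat, pk).
replace (8 * d * (K * (q + 1)) * Q / k ^ M) with (8 * d * (Q * (K * ((q + 1) * / k ^ M)))) by (field; lra).
(* Horizontal edges: the zero of the window above and below [x = 0] meets the decay of [exp (k x)].
   For [0 <= x <= h] one has [2 k x <= d], whence the factor [exp d]. *)
assert (W1 : forall x, - d <= x <= h -> Rabs x ^ M * exp (k * x) <= q * / k ^ M).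
{ intros x hx.
  pose proof (pow_mul_exp_neg (Rabs x) k M (Rabs_pos x) ltac:(lra)) as a.
  assert (b : exp (k * x) <= exp (- (k * Rabs x)) * exp d).
  { rewrite <- exp_plus; apply exp_le_compat; destruct (Rle_dec 0 x).
    - rewrite Rabs_pos_eq by lra; nra.
    - rewrite Rabs_left1 by lra; lra. }
  assert (0 <= Rabs x ^ M) by (apply pow_le, Rabs_pos).
  apply Rle_trans with (Rabs x ^ M * (exp (- (k * Rabs x)) * exp d)); [apply Rmult_le_compat_l; assumption|].
  rewrite <- Rmult_assoc.
  apply Rle_trans with (INR M ^ M / k ^ M * exp d); [apply Rmult_le_compat_r; lra|].
  unfold q, Rdiv.
  replace (INR M ^ M * / k ^ M * exp d) with (INR M ^ M * exp d * 1 * / k ^ M) by ring.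
  apply Rmult_le_compat_r; [lra|]; apply Rmult_le_compat_l; [apply Rmult_le_pos; lra | lra]. }
(* Left edge: the exponential alone is small enough. *)
assert (W2 : exp (k * - d) <= q * / k ^ M).
{ pose proof (pow_mul_exp_neg d k M ltac:(lra) ltac:(lra)) as a.
  replace (k * - d) with (- (k * d)) by ring.
  apply (Rmult_le_reg_l (d ^ M)); [exact pd|]; eapply Rle_trans; [exact a|].
  unfold q, Rdiv.
  replace (d ^ M * (INR M ^ M * exp d * (1 + / d ^ M) * / k ^ M))
    with (INR M ^ M * / k ^ M * (exp d * (d ^ M + 1))) by (field; lra).
  rewrite <- (Rmult_1_r (INR M ^ M * / k ^ M)) at 1.
  apply Rmult_le_compat_l; [apply Rmult_le_pos; lra | nra]. }
apply ver_to_hankel; try lra; [exact D | |].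
- assert (P : forall x y, - d <= x <= h -> Rabs y = d ->
    Cmod (f (x, y)) <= Q * (K * ((q + 1) * / k ^ M))).
  { intros x y hx hy.
    assert (hx' : Rabs x <= d) by (apply Rabs_le; lra).
    eapply Rle_trans; [apply B; try lra|].
    - apply cut_plane_Im; intros e; rewrite e, Rabs_R0 in hy; lra.
    - rewrite <- hy at 1; apply (abs_Im_le (x, y)).
    - apply Rmult_le_compat_l; [exact hQ|].
      apply Rle_trans with (K * (Rabs x ^ M * exp (k * x))).
      + rewrite <- Rmult_assoc; apply Rmult_le_compat_r; [left; apply exp_pos|].
        apply W; lra.
      + apply Rmult_le_compat_l; [lra|]; eapply Rle_trans; [apply W1, hx|]; nra. }
  intros x hx; split; apply P; try exact hx.
  + apply Rabs_pos_eq; lra.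
  + rewrite Rabs_Ropp; apply Rabs_pos_eq; lra.
- intros y hy.
  assert (hd' : Rabs (- d) = d) by (rewrite Rabs_Ropp; apply Rabs_pos_eq; lra).
  eapply Rle_trans; [apply B; try lra|].
  + apply cut_plane_Im; intros e; rewrite e, Rabs_R0 in hy; lra.
  + rewrite <- hd' at 1; apply (abs_Re_le (- d, y)).
  + apply Rmult_le_compat_l; [exact hQ|].
    apply Rmult_le_compat; [apply Cmod_ge_0 | left; apply exp_pos | apply W; lra |].
    eapply Rle_trans; [apply W2|]; nra.
Qed.

Definition windowed (d : R) (M : nat) (mu k : R) (z : C) : C :=
  (hankel_kernel mu k z * window d M z)%C.

Lemma Cdiff_windowed d M mu k z : cut_plane z -> Cdiff (windowed d M mu k) z.
Proof. intros H; apply Cdiff_mult; [apply Cdiff_hankel_kernel, H | apply Cdiff_window]. Qed.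

(** Three errors: leaving the segment ([A1]), removing the window ([A2], where the deviation
    [O(z^M)] raises the exponent of the kernel by [M]), and cutting the contour at [- d] ([A3]).
    Scaled by [k = n] the cut sits at [- n d], a member of the very sequence that defines
    [hankel_const]. *)
Lemma windowed_moment_pos d s M : 0 < d -> exists K, 0 < K /\
  forall n c, (1 <= n)%nat -> 0 < c <= d / 2 / INR n ->
  Cmod (ver (windowed d M (- s - 1) (INR n)) c (- d) d - Rpower (INR n) s * hankel_const d s)
    <= K * (1 + Rpower (INR n) s) / INR n ^ M.
Proof.
intros hd; set (mu := - s - 1).
destruct (window_to_hankel d M hd) as [K1 [hK1 H1]].
destruct (window_bounds d M hd) as [K2 [hK2 H2]].
destruct (hankel_le (d / 2) (mu + INR M) ltac:(lra)) as [K3 [hK3 H3]].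
destruct (hankel_const_spec d s hd) as [K4 [hK4 H4]].
set (Q := Rpower d mu + Rpower (2 * d) mu).
assert (hQ : 0 < Q) by (unfold Q; pose proof (Rpower_pos d mu); pose proof (Rpower_pos (2 * d) mu); lra).
set (E := INR M ^ M * (/ (d / 2)) ^ M).
assert (hE : 0 <= E).
{ apply Rmult_le_pos; apply pow_le; [apply pos_INR|]; left; apply Rinv_0_lt_compat; lra. }
exists (K1 * Q + K3 * K2 + K4 * E + 1); split.
{ assert (0 <= K4 * E) by (apply Rmult_le_pos; lra).
  assert (0 < K3 * K2) by (apply Rmult_lt_0_compat; lra).
  assert (0 < K1 * Q) by (apply Rmult_lt_0_compat; lra); lra. }
intros n c hn hc.
assert (hk : 1 <= INR n) by (apply (le_INR 1); exact hn).
set (k := INR n) in *.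
assert (pk : 0 < k ^ M) by (apply pow_lt; lra).
assert (ik : 0 < / k ^ M) by (apply Rinv_0_lt_compat, pk).
set (h := d / 2 / k).
assert (hh : 0 < h) by (apply Rdiv_lt_0_compat; lra).
assert (hh2 : h <= d / 2).
{ unfold h; apply (Rmult_le_reg_r k); [lra|]; replace (d / 2 / k * k) with (d / 2) by (field; lra); nra. }
assert (hs : - mu - 1 = s) by (unfold mu; ring).
assert (Box : forall x y, Rabs x <= d -> Rabs y <= d -> Cmod (x, y) <= 2 * d).
{ intros x y hx hy; eapply Rle_trans; [apply Cmod_le_abs|]; simpl; lra. }
assert (A1 : Cmod (ver (windowed d M mu k) c (- d) d - hankel (windowed d M mu k) d h)
  <= K1 * Q / k ^ M).
{ apply H1; try lra.
  - intros x y hx hy hz; apply Cdiff_windowed, hz.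
  - intros x y hx hy hz hr; unfold windowed; rewrite Cmod_mult, Cmod_hankel_kernel.
    replace (Rpower (Cmod (x, y)) mu * exp (k * x) * Cmod (window d M (x, y)))
      with (Rpower (Cmod (x, y)) mu * (Cmod (window d M (x, y)) * exp (k * x))) by ring.
    apply Rmult_le_compat_r.
    + apply Rmult_le_pos; [apply Cmod_ge_0 | left; apply exp_pos].
    + apply Rpower_le_ends; [exact hd|]; split; [exact hr | apply Box; assumption]. }
assert (DW : Cdiff_on_hankel (windowed d M mu k) d h).
{ intros x y [[_ e]|[-> _]]; apply Cdiff_windowed; [apply cut_plane_Im | apply cut_plane_Re, hh].
  intros e'; rewrite e', Rabs_R0 in e; lra. }
assert (A2 : Cmod (hankel (windowed d M mu k) d h - hankel (hankel_kernel mu k) d h)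
  <= K3 * K2 * (Rpower k s / k ^ M)).
{ rewrite <- hankel_minus by (try lra; try exact DW; apply Cdiff_on_hankel_kernel, hh).
  assert (e : Rpower k s / k ^ M = Rpower k (- (mu + INR M) - 1)).
  { replace (- (mu + INR M) - 1) with (s + - INR M) by (rewrite <- hs; ring).
    rewrite Rpower_plus, Rpower_Ropp, Rpower_pow by lra; reflexivity. }
  rewrite e; apply H3; try lra.
  - intros x y hx hy hxy; apply Cdiff_minus.
    + apply Cdiff_windowed; destruct hxy as [->|e']; [apply cut_plane_Re, hh | apply cut_plane_Im].
      intros e2; rewrite e2, Rabs_R0 in e'; unfold h in hh; lra.
    + apply Cdiff_hankel_kernel; destruct hxy as [->|e']; [apply cut_plane_Re, hh | apply cut_plane_Im].
      intros e2; rewrite e2, Rabs_R0 in e'; unfold h in hh; lra.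
  - intros x y hx hy hxy.
    assert (hz : 0 < Cmod (x, y)).
    { eapply Rlt_le_trans; [exact hh|]; destruct hxy as [e1|e1].
      - rewrite <- (Rabs_pos_eq h) by lra; unfold h; rewrite <- e1; apply (abs_Re_le (x, y)).
      - unfold h; rewrite <- e1; apply (abs_Im_le (x, y)). }
    unfold windowed.
    replace (hankel_kernel mu k (x, y) * window d M (x, y) - hankel_kernel mu k (x, y))%C
      with (hankel_kernel mu k (x, y) * (window d M (x, y) - 1))%C by ring.
    rewrite Cmod_mult, Cmod_hankel_kernel, Rpower_plus, Rpower_pow by exact hz.
    assert (w : Cmod (window d M (x, y) - 1) <= K2 * Cmod (x, y) ^ M).
    { apply H2; [apply Rabs_le; fold h in hx; lra | fold h in hy; lra]. }
    pose proof (Rpower_pos (Cmod (x, y)) mu); pose proof (exp_pos (k * x)).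
    replace (K2 * (Rpower (Cmod (x, y)) mu * Cmod (x, y) ^ M * exp (k * x)))
      with (Rpower (Cmod (x, y)) mu * exp (k * x) * (K2 * Cmod (x, y) ^ M)) by ring.
    apply Rmult_le_compat_l; [apply Rmult_le_pos; lra | exact w]. }
assert (A3 : Cmod (hankel (hankel_kernel mu k) d h - Rpower k s * hankel_const d s)
  <= K4 * E * (Rpower k s / k ^ M)).
{ rewrite (hankel_scale mu k d h) by lra.
  replace (k * h) with (d / 2) by (unfold h; field; lra); rewrite hs.
  specialize (H4 n); fold k mu in H4.
  match goal with |- Cmod (?a * ?b - ?a * ?c) <= _ =>
    replace (a * b - a * c)%C with (a * (b - c))%C by ring end.
  rewrite Cmod_mult, Cmod_R, Rabs_pos_eq by (left; apply Rpower_pos).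
  replace (K4 * E * (Rpower k s / k ^ M)) with (Rpower k s * (K4 * (E * / k ^ M))) by (unfold Rdiv; ring).
  apply Rmult_le_compat_l; [left; apply Rpower_pos|].
  eapply Rle_trans; [exact H4|]; apply Rmult_le_compat_l; [lra|].
  pose proof (pow_mul_exp_neg (d / 2) k M ltac:(lra) ltac:(lra)) as a.
  replace (- (k * d) / 2) with (- (k * (d / 2))) by field.
  assert (pd : 0 < (d / 2) ^ M) by (apply pow_lt; lra).
  apply (Rmult_le_reg_l ((d / 2) ^ M)); [exact pd|]; eapply Rle_trans; [exact a|].
  right; unfold E; rewrite pow_inv; field; split; lra. }
replace (ver (windowed d M mu k) c (- d) d - Rpower k s * hankel_const d s)%C with
  ((ver (windowed d M mu k) c (- d) d - hankel (windowed d M mu k) d h)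
   + (hankel (windowed d M mu k) d h - hankel (hankel_kernel mu k) d h)
   + (hankel (hankel_kernel mu k) d h - Rpower k s * hankel_const d s))%C by ring.
eapply Rle_trans; [apply Cmod_triangle|].
eapply Rle_trans; [apply Rplus_le_compat_r, Cmod_triangle|].
assert (hp := Rpower_pos k s).
assert (0 < Rpower k s / k ^ M) by (apply Rdiv_lt_0_compat; lra).
replace ((K1 * Q + K3 * K2 + K4 * E + 1) * (1 + Rpower k s) / k ^ M) with
  ((K1 * Q + K3 * K2 + K4 * E + 1) * (/ k ^ M + Rpower k s / k ^ M)) by (field; lra).
unfold Rdiv at 1 in A1.
assert (0 <= K4 * E) by (apply Rmult_le_pos; lra); assert (0 < K3 * K2) by (apply Rmult_lt_0_compat; lra).
assert (0 < K1 * Q) by (apply Rmult_lt_0_compat; lra).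
nra.
Qed.

(** The exponential now decays to the right, so the segment is pushed to [Re z = d] and the cut is
    never met. Writing [1 + k] keeps the bound meaningful at [k = 0]. *)
Lemma windowed_moment_neg d mu M : 0 < d -> exists K, 0 < K /\
  forall k c, 0 <= k -> 0 < c <= d ->
  Cmod (ver (windowed d M mu (- k)) c (- d) d) <= K / (1 + k) ^ M.
Proof.
intros hd.
destruct (window_bounds d M hd) as [K2 [hK2 H2]].
set (Q := Rpower d mu + Rpower (2 * d) mu).
assert (hQ : 0 < Q) by (unfold Q; pose proof (Rpower_pos d mu); pose proof (Rpower_pos (2 * d) mu); lra).
assert (hM : 0 <= INR M ^ M) by (apply pow_le, pos_INR).
assert (pd : 0 < d ^ M) by (apply pow_lt, hd).
assert (ipd : 0 < / d ^ M) by (apply Rinv_0_lt_compat, pd).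
assert (hed := exp_pos d).
set (q := INR M ^ M * exp d * (1 + / d ^ M)).
assert (hq : 0 <= q) by (unfold q; repeat apply Rmult_le_pos; lra).
exists (4 * d * (Q * K2 * (q + 1))); split; [repeat apply Rmult_lt_0_compat; lra|].
intros k c hk hc.
set (f := windowed d M mu (- k)).
assert (D : Cdiff_on_rect f c d (- d) d).
{ intros x y hx hy; apply Cdiff_windowed, cut_plane_Re; lra. }
rewrite (ver_shift f c d (- d) d) by (try lra; exact D).
assert (p1 : 0 < (1 + k) ^ M) by (apply pow_lt; lra).
assert (i1 : 0 < / (1 + k) ^ M) by (apply Rinv_0_lt_compat, p1).
(* Here [exp (- k x)] is split as [exp (- (1 + k) x) exp x], with [exp x <= exp d]. *)
assert (X : forall x, 0 <= x <= d -> x ^ M * exp (- k * x) <= INR M ^ M * exp d * / (1 + k) ^ M).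
{ intros x hx; pose proof (pow_mul_exp_neg x (1 + k) M ltac:(lra) ltac:(lra)) as a.
  replace (- k * x) with (- ((1 + k) * x) + x) by ring; rewrite exp_plus, <- Rmult_assoc.
  apply Rle_trans with (INR M ^ M / (1 + k) ^ M * exp d).
  - apply Rmult_le_compat; [|left; apply exp_pos | exact a | apply exp_le_compat; lra].
    apply Rmult_le_pos; [apply pow_le; lra | left; apply exp_pos].
  - right; unfold Rdiv; ring. }
set (E := Q * K2 * (q + 1) * / (1 + k) ^ M).
assert (F : forall x y, 0 < x <= d -> Rabs y <= d -> d <= Cmod (x, y) -> 
  Cmod (f (x, y)) <= Q * (Cmod (window d M (x, y)) * exp (- k * x))).
{ intros x y hx hy hr; unfold f, windowed; rewrite Cmod_mult, Cmod_hankel_kernel.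
  replace (Rpower (Cmod (x, y)) mu * exp (- k * x) * Cmod (window d M (x, y)))
    with (Rpower (Cmod (x, y)) mu * (Cmod (window d M (x, y)) * exp (- k * x))) by ring.
  apply Rmult_le_compat_r; [apply Rmult_le_pos; [apply Cmod_ge_0 | left; apply exp_pos]|].
  apply Rpower_le_ends; [exact hd|]; split; [exact hr|].
  eapply Rle_trans; [apply Cmod_le_abs|]; simpl; rewrite (Rabs_pos_eq x); lra. }
assert (F1 : forall x y, c <= x <= d -> Rabs y = d -> Cmod (f (x, y)) <= E).
{ intros x y hx hy; eapply Rle_trans; [apply F; try lra|].
  - rewrite <- hy at 1; apply (abs_Im_le (x, y)).
  - unfold E; rewrite !Rmult_assoc; apply Rmult_le_compat_l; [lra|].
    apply Rle_trans with (K2 * (Rabs x ^ M * exp (- k * x))).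
    + rewrite <- Rmult_assoc; apply Rmult_le_compat_r; [left; apply exp_pos|].
      apply H2; try lra; rewrite Rabs_pos_eq; lra.
    + apply Rmult_le_compat_l; [lra|]; rewrite Rabs_pos_eq by lra.
      eapply Rle_trans; [apply X; lra|]; apply Rmult_le_compat_r; [lra|].
      unfold q; assert (0 <= INR M ^ M * exp d) by (apply Rmult_le_pos; lra); nra. }
assert (F2 : forall y, - d <= y <= d -> Cmod (f (d, y)) <= E).
{ intros y hy; assert (hy' : Rabs y <= d) by (apply Rabs_le; lra).
  eapply Rle_trans; [apply F; try lra|].
  - rewrite <- (Rabs_pos_eq d) at 1 by lra; apply (abs_Re_le (d, y)).
  - unfold E; rewrite !Rmult_assoc; apply Rmult_le_compat_l; [lra|].
    apply Rmult_le_compat; [apply Cmod_ge_0 | left; apply exp_pos | |].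
    + apply H2; [rewrite Rabs_pos_eq; lra | exact hy'].
    + apply (Rmult_le_reg_l (d ^ M)); [exact pd|].
      eapply Rle_trans; [apply X; lra|].
      rewrite <- Rmult_assoc; apply Rmult_le_compat_r; [lra|].
      unfold q.
      replace (d ^ M * (INR M ^ M * exp d * (1 + / d ^ M) + 1))
        with (INR M ^ M * exp d + (INR M ^ M * exp d * d ^ M + d ^ M)) by (field; lra).
      assert (0 <= INR M ^ M * exp d) by (apply Rmult_le_pos; lra); nra. }
assert (hE : 0 <= E) by (eapply Rle_trans; [apply Cmod_ge_0 | apply (F2 0); lra]).
assert (V : Cmod (ver f d (- d) d) <= (d - - d) * E).
{ apply Cmod_ver_le; [lra | intros; apply D; lra | exact F2]. }
assert (P : forall y, Rabs y = d -> Cmod (hor f c d y) <= (d - c) * E).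
{ intros y hy; apply Cmod_hor_le; [lra | | intros; apply F1; assumption].
  intros x hx; apply D; [exact hx | apply Rabs_le_between; lra]. }
pose proof (P d ltac:(apply Rabs_pos_eq; lra)).
pose proof (P (- d) ltac:(rewrite Rabs_Ropp; apply Rabs_pos_eq; lra)).
unfold Cminus.
eapply Rle_trans; [apply Cmod_triangle|]; rewrite Cmod_opp.
eapply Rle_trans; [apply Rplus_le_compat_r, Cmod_triangle|].
replace (4 * d * (Q * K2 * (q + 1)) / (1 + k) ^ M) with (4 * d * E) by (unfold E, Rdiv; ring).
nra.
Qed.

(** * Evaluation of Hankel's constant *)

(* Taylor coefficients of [(1 - z) ^ (- nu)]. *)
Fixpoint binom_coef (nu : R) (k : nat) : R :=
  match k with
  | O => 1
  | S k => binom_coef nu k * (INR k + nu) / INR (S k)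
  end.

(** The difference is the integral of the derivative over the segment from [z] to [z + v], which is
    required to stay in the right half plane. *)
Lemma Cpowr_mean_value (z v : C) mu m :
  (forall t, 0 <= t <= 1 -> 0 < Re (z + t * v) /\ Rpower (Cmod (z + t * v)) (mu - 1) <= m) ->
  Cmod (Cpowr (z + v) mu - Cpowr z mu) <= Rabs mu * m * Cmod v.
Proof.
intros H.
set (g := fun t : R => (z + t * v)%C).
assert (E : forall r t : R, (g r - g t = (r - t)%R * v)%C).
{ intros r t; unfold g; rewrite RtoC_minus; ring. }
assert (cut : forall t, 0 <= t <= 1 -> cut_plane (g t)).
{ intros t ht [a _]; destruct (H t ht) as [b _]; unfold g in a; lra. }
set (f := fun z => (v * (mu * Cpowr z (mu - 1)))%C).
assert (D : forall t, 0 <= t <= 1 -> Cdiff f (g t)).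
{ intros t ht; unfold f; apply Cdiff_mult; [apply Cdiff_const|].
  apply Cdiff_mult; [apply Cdiff_const|].
  apply (Cdiff_Cpowr (fun z => z)); [apply cut, ht | apply Cdiff_id]. }
assert (Cf : forall t, 0 <= t <= 1 -> continuous (U := C_UniformSpace) (fun t => f (g t)) t).
{ intros t ht; apply Cdiff_continuous_path; [apply D, ht|].
  exists (Cmod v); intros y; rewrite E, Cmod_mult, Cmod_R; lra. }
assert (I : CInt (fun t => f (g t)) 0 1 = (Cpowr (z + v) mu - Cpowr z mu)%C).
{ apply CInt_unique.
  replace (Cpowr (z + v) mu - Cpowr z mu)%C with (Cpowr (g 1%R) mu - Cpowr (g 0%R) mu)%C
    by (unfold g; f_equal; [f_equal; ring | f_equal; f_equal; ring]).
  apply (is_RInt_derive (V := C_R_CompleteNormedModule) (fun t => Cpowr (g t) mu));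
    rewrite Rmin_left, Rmax_right by lra; intros t ht.
  - apply (is_derive_path (fun z => Cpowr z mu) g); [apply Cderiv_Cpowr, cut, ht | intros; apply E].
  - apply Cf, ht. }
rewrite <- I.
replace (Rabs mu * m * Cmod v) with ((1 - 0) * (Cmod v * (Rabs mu * m))) by ring.
apply Cmod_CInt_le_const; [lra | apply ex_CInt_continuous; [lra | exact Cf] |].
intros t ht; unfold f; rewrite !Cmod_mult, Cmod_R, Cmod_Cpowr.
apply Rmult_le_compat_l; [apply Cmod_ge_0|]; apply Rmult_le_compat_l; [apply Rabs_pos|].
apply H, ht.
Qed.

(** * Binomial coefficients as contour integrals over a period *)

Definition one_minus_exp (z : C) : C := (1 - Cexp (- z))%C.

Lemma one_minus_exp_Re x y : Re (one_minus_exp (x, y)) = 1 - exp (- x) * cos y.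
Proof. unfold one_minus_exp, Cexp; simpl; rewrite cos_neg; ring. Qed.

Lemma one_minus_exp_Re_pos x y : 0 < x -> 0 < Re (one_minus_exp (x, y)).
Proof.
intros hx; rewrite one_minus_exp_Re.
assert (exp (- x) < 1) by (rewrite <- exp_0; apply exp_increasing; lra).
assert (0 < exp (- x)) by apply exp_pos.
pose proof (COS_bound y); nra.
Qed.

Lemma one_minus_exp_cut x y : 0 < x -> cut_plane (one_minus_exp (x, y)).
Proof. intros hx [a _]; pose proof (one_minus_exp_Re_pos x y hx); lra. Qed.

Lemma Cderiv_one_minus_exp z : Cderiv one_minus_exp z (Cexp (- z)).
Proof.
unfold one_minus_exp.
replace (Cexp (- z)) with (0 - (- (1)) * Cexp (- z))%C by ring.
apply Cderiv_minus; [apply Cderiv_const|].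
apply (Cderiv_comp Cexp (fun z => - z)%C); [apply Cderiv_Cexp | apply Cderiv_opp, Cderiv_id].
Qed.

Definition binom_kernel (nu k : R) (z : C) : C :=
  (Cpowr (one_minus_exp z) (- nu) * Cexp (k * z))%C.

Lemma Cdiff_binom_kernel nu k x y : 0 < x -> Cdiff (binom_kernel nu k) (x, y).
Proof.
intros hx; apply Cdiff_mult.
- apply (Cdiff_Cpowr one_minus_exp); [apply one_minus_exp_cut, hx | eexists; apply Cderiv_one_minus_exp].
- apply Cdiff_Cexp, Cdiff_mult; [apply Cdiff_const | apply Cdiff_id].
Qed.

Lemma sin_cos_nat_PI n : sin (INR n * PI) = 0 /\ cos (INR n * - PI) = cos (INR n * PI).
Proof.
split.
- apply sin_eq_0_1; exists (Z.of_nat n); rewrite <- INR_IZR_INZ; ring.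
- replace (INR n * - PI) with (- (INR n * PI)) by ring; apply cos_neg.
Qed.

Lemma Cexp_period n x : Cexp (INR n * (x, - PI)) = Cexp (INR n * (x, PI)).
Proof.
destruct (sin_cos_nat_PI n) as [hs hc].
unfold Cexp; simpl.
replace (INR n * - PI + 0 * x) with (INR n * - PI) by ring.
replace (INR n * PI + 0 * x) with (INR n * PI) by ring.
rewrite hc, hs; replace (INR n * - PI) with (- (INR n * PI)) by ring; rewrite sin_neg, hs.
apply injective_projections; simpl; [|ring]; do 2 f_equal; ring.
Qed.

Lemma one_minus_exp_period x : one_minus_exp (x, - PI) = one_minus_exp (x, PI).
Proof.
unfold one_minus_exp, Cexp; simpl.
rewrite Ropp_involutive, cos_neg, sin_neg, sin_PI; apply injective_projections; simpl; ring.
Qed.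

Lemma binom_kernel_period nu n x : binom_kernel nu (INR n) (x, - PI) = binom_kernel nu (INR n) (x, PI).
Proof. unfold binom_kernel; rewrite one_minus_exp_period, Cexp_period; reflexivity. Qed.

(** Moving the line to the right costs nothing, since by periodicity the horizontal sides agree.
    There [(1 - e^(-z))^(-nu)] tends to 1, and the segment has length [2 PI]. *)
Lemma binom_contour_0 nu c : 0 < c -> ver (binom_kernel nu 0) c (- PI) PI = (2 * PI * Ci)%C.
Proof.
intros hc; assert (hpi := PI_RGT_0).
destruct (Cdiff_Cpowr (fun z => z) (- nu) 1%C) as [l Hl].
{ intros [a _]; simpl in a; lra. }
{ apply Cdiff_id. }
rewrite Cderiv_eps in Hl; destruct (Hl 1 Rlt_0_1) as [r [hr Hr]].
assert (P1 : Cpowr 1 (- nu) = 1%C).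
{ rewrite Cpowr_Cexp; unfold Clog; rewrite Cmod_1, ln_1; unfold Carg; simpl.
  replace (0 / (Cmod 1 + 1)) with 0 by (rewrite Cmod_1; field).
  rewrite atan_0, Rmult_0_r.
  replace ((- nu)%R * (0%R, 0%R))%C with (RtoC 0) by (apply injective_projections; simpl; ring).
  apply Cexp_0. }
apply Ceq_minus, Cmod_eq_0.
set (V := ver (binom_kernel nu 0) c (- PI) PI).
assert (B : forall X, c <= X -> exp (- X) < r ->
  Cmod (V - 2 * PI * Ci) <= 2 * PI * ((Cmod l + 1) * exp (- X))).
{ intros X hX hXr.
  assert (S : V = ver (binom_kernel nu 0) X (- PI) PI).
  { unfold V; rewrite (ver_shift _ c X (- PI) PI); try lra.
    - replace (hor (binom_kernel nu 0) c X PI) with (hor (binom_kernel nu 0) c X (- PI)); [ring|].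
      apply CInt_ext; [exact hX|]; intros x _; apply (binom_kernel_period nu 0).
    - intros x y hx _; apply Cdiff_binom_kernel; lra. }
  assert (ex : ex_CInt (fun y => binom_kernel nu 0 (X, y)) (- PI) PI).
  { apply ex_CInt_v; [lra|]; intros; apply Cdiff_binom_kernel; lra. }
  assert (exc : ex_CInt (fun _ => 1%C) (- PI) PI)
    by (eexists; apply (is_RInt_const (V := C_R_NormedModule))).
  assert (E : (V - 2 * PI * Ci = CInt (fun y => Ci * (binom_kernel nu 0 (X, y) - 1))%C (- PI) PI)%C).
  { rewrite S; unfold ver; rewrite !CInt_scal, CInt_minus, CInt_const by
      (try exact ex; try exact exc; apply ex_CInt_minus; assumption).
    replace (PI - - PI) with (2 * PI) by ring; rewrite RtoC_mult; ring. }
  rewrite E; replace (2 * PI) with (PI - - PI) by ring.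
  apply Cmod_CInt_le_const; [lra | apply ex_CInt_scal, ex_CInt_minus; assumption |].
  intros y _; rewrite Cmod_mult, Cmod_Ci, Rmult_1_l.
  unfold binom_kernel; rewrite Cmult_0_l, Cexp_0, Cmult_1_r.
  set (u := Cexp (- (X, y))).
  assert (hu : Cmod u = exp (- X)) by (unfold u; rewrite Cmod_Cexp; reflexivity).
  assert (eu : (one_minus_exp (X, y) - 1 = - u)%C) by (unfold one_minus_exp; fold u; ring).
  specialize (Hr (one_minus_exp (X, y))); rewrite eu, Cmod_opp, hu, P1 in Hr; specialize (Hr hXr).
  replace (Cpowr (one_minus_exp (X, y)) (- nu) - 1)%C with
    ((Cpowr (one_minus_exp (X, y)) (- nu) - 1 - l * - u) + l * - u)%C by ring.
  eapply Rle_trans; [apply Cmod_triangle|]; rewrite Cmod_mult, Cmod_opp, hu; lra. }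
assert (h0 := Cmod_ge_0 (V - 2 * PI * Ci)).
destruct (Req_dec (Cmod (V - 2 * PI * Ci)) 0) as [e|e]; [exact e|exfalso].
set (w := Cmod (V - 2 * PI * Ci)) in *.
assert (hw : 0 < w) by (destruct h0 as [h0|h0]; [exact h0 | congruence]).
set (L := Cmod l + 1) in *; assert (hL : 0 < L) by (unfold L; pose proof (Cmod_ge_0 l); lra).
assert (h4 : 0 < 4 * PI * L) by nra.
assert (hA : 0 < w / (4 * PI * L)) by (apply Rdiv_lt_0_compat; assumption).
(* The abscissa [X] makes [exp (- X)] smaller than the radius of the estimate at 1 and than the size
   that contradicts [w > 0]. *)
set (t := Rmin r (w / (4 * PI * L))); assert (ht : 0 < t) by (apply Rmin_pos; assumption).
set (X := Rmax c (1 - ln t)).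
assert (hX : exp (- X) < t).
{ rewrite <- (exp_ln t) by exact ht; apply exp_increasing.
  pose proof (Rmax_r c (1 - ln t)); unfold X; lra. }
pose proof (Rmin_l r (w / (4 * PI * L))); pose proof (Rmin_r r (w / (4 * PI * L))).
specialize (B X (Rmax_l _ _) ltac:(unfold t in hX; lra)).
assert (exp (- X) * (4 * PI * L) < w).
{ apply (Rmult_lt_reg_r (/ (4 * PI * L))).
  - apply Rinv_0_lt_compat, h4.
  - rewrite Rmult_assoc, Rinv_r, Rmult_1_r by lra; unfold t, Rdiv in *; lra. }
lra.
Qed.

(* Integrating the derivative of [(1 - e^-z) ^ (1 - nu) e^(k z)] over a period
   gives the recurrence of the binomial coefficients. *)
Lemma binom_contour nu k c : 0 < c ->
  ver (binom_kernel nu (INR k)) c (- PI) PI = (2 * PI * Ci * binom_coef nu k)%C.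
Proof.
intros hc; assert (hpi := PI_RGT_0).
induction k as [|k IH].
- simpl; rewrite (binom_contour_0 nu c hc); ring.
- set (K := INR (S k)); assert (hK : 0 < K) by (apply lt_0_INR; lia).
  set (F := fun z => (Cpowr (one_minus_exp z) (1 - nu) * Cexp (K * z))%C).
  set (f := fun z => (K * binom_kernel nu K z - (INR k + nu)%R * binom_kernel nu (INR k) z)%C).
  assert (Df : forall y, Cdiff f (c, y)).
  { intros y; apply Cdiff_minus; (apply Cdiff_mult; [apply Cdiff_const | apply Cdiff_binom_kernel, hc]). }
  assert (DF : forall y, Cderiv F (c, y) (f (c, y))).
  { intros y; set (z := (c, y)).
    assert (hz : cut_plane (one_minus_exp z)) by (apply one_minus_exp_cut, hc).
    replace (f z) with
      ((Cexp (- z) * ((1 - nu)%R * Cpowr (one_minus_exp z) (1 - nu - 1))) * Cexp (K * z)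
       + Cpowr (one_minus_exp z) (1 - nu) * (K * Cexp (K * z)))%C.
    - apply (Cderiv_mult (fun z => Cpowr (one_minus_exp z) (1 - nu)) (fun z => Cexp (K * z))).
      + apply (Cderiv_comp (fun z => Cpowr z (1 - nu)) one_minus_exp);
          [apply Cderiv_Cpowr, hz | apply Cderiv_one_minus_exp].
      + apply (Cderiv_comp Cexp (fun z => K * z)%C); [apply Cderiv_Cexp|].
        pose proof (Cderiv_scal K _ _ _ (Cderiv_id z)) as Q; rewrite Cmult_1_r in Q; exact Q.
    - unfold f, binom_kernel.
      replace (Cpowr (one_minus_exp z) (1 - nu)) with
        (one_minus_exp z * Cpowr (one_minus_exp z) (- nu))%C
        by (rewrite <- (Cpowr_1 _ hz) at 1; rewrite <- Cpowr_plus; f_equal).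
      replace (1 - nu - 1) with (- nu) by ring.
      replace (Cexp (INR k * z)) with (Cexp (- z) * Cexp (K * z))%C.
      + unfold one_minus_exp; unfold K; rewrite S_INR, !RtoC_plus, RtoC_minus; ring.
      + rewrite <- Cexp_plus; f_equal; unfold K; rewrite S_INR, RtoC_plus; ring. }
  pose proof (ver_primitive F f c (- PI) PI ltac:(lra) (fun y _ => conj (DF y) (Df y))) as P.
  replace (F (c, PI)) with (F (c, - PI)) in P
    by (unfold F, K; rewrite one_minus_exp_period, Cexp_period; reflexivity).
  replace (F (c, (- PI)%R) - F (c, (- PI)%R))%C with (RtoC 0) in P by ring.
  assert (X : forall m, ex_CInt (fun y => Ci * binom_kernel nu m (c, y))%C (- PI) PI).
  { intros m; apply ex_CInt_scal, ex_CInt_v; [lra|]; intros; apply Cdiff_binom_kernel, hc. }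
  assert (E : ver f c (- PI) PI = (K * ver (binom_kernel nu K) c (- PI) PI
    - (INR k + nu)%R * ver (binom_kernel nu (INR k)) c (- PI) PI)%C).
  { unfold ver; rewrite <- !CInt_scal by apply X.
    rewrite <- CInt_minus by (apply ex_CInt_scal, X).
    apply CInt_ext; [lra|]; intros y _; unfold f; ring. }
  rewrite E, IH in P.
  assert (hK' : RtoC K <> 0%C) by (intros e; apply RtoC_inj in e; lra).
  assert (G : (K * ver (binom_kernel nu K) c (- PI) PI
    = (INR k + nu)%R * (2 * PI * Ci * binom_coef nu k))%C).
  { apply Ceq_minus; exact P. }
  replace (ver (binom_kernel nu K) c (- PI) PI)
    with (/ K * (K * ver (binom_kernel nu K) c (- PI) PI))%C by (field; exact hK').
  rewrite G; change (binom_coef nu (S k)) with (binom_coef nu k * (INR k + nu) / K).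
  unfold Rdiv; rewrite !RtoC_mult, RtoC_inv by lra; field; exact hK'.
Qed.

(** The real part of [1 - e^(-z)] is [1 - e^(-x) cos y], and [cos y <= cos d] with [cos d >= 0], so
    it stays above [1 - cos d] even as [x] tends to 0. *)
Lemma binom_kernel_far nu d : 0 < d <= 1 -> exists Q, 0 < Q /\
  forall x y, 0 < x -> d <= Rabs y <= PI -> Rpower (Cmod (one_minus_exp (x, y))) (- nu) <= Q.
Proof.
intros hd; set (m := 1 - cos d).
assert (hpi := PI_RGT_0); pose proof PI2_3_2 as hpi2.
assert (hc1 : cos d < 1) by (rewrite <- cos_0; apply cos_decreasing_1; lra).
assert (hc0 : 0 <= cos d) by (apply cos_ge_0; lra).
exists (Rpower m (- nu) + Rpower 2 (- nu)); split.
{ apply Rplus_lt_0_compat; apply Rpower_pos. }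
intros x y hx hy; apply Rpower_le_ends; [unfold m; lra|]; split.
- eapply Rle_trans; [|apply abs_Re_le]; rewrite one_minus_exp_Re.
  assert (he : 0 < exp (- x)) by apply exp_pos.
  assert (he1 : exp (- x) < 1) by (rewrite <- exp_0; apply exp_increasing; lra).
  assert (hcy : cos y <= cos d).
  { replace (cos y) with (cos (Rabs y)).
    - apply cos_decr_1; lra.
    - unfold Rabs; destruct (Rcase_abs y); [apply cos_neg | reflexivity]. }
  eapply Rle_trans; [|apply Rle_abs]; unfold m; nra.
- unfold one_minus_exp; eapply Rle_trans; [apply Cmod_triangle|].
  rewrite Cmod_1, Cmod_opp, Cmod_Cexp; simpl.
  assert (exp (- x) < 1) by (rewrite <- exp_0; apply exp_increasing; lra); lra.
Qed.

(** [1 - e^(-z) = z + v] with [|v| <= 10 r^2 <= r / 2]. The segment between the two points stays in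
    the right half plane and between the radii [r / 2] and [3 r / 2], so the mean value bound gains
    one power of [r]. *)
Lemma Cpowr_one_minus_exp nu : exists K, 0 < K /\ forall x y, 0 < x -> Cmod (x, y) <= 1 / 20 ->
  Cmod (Cpowr (one_minus_exp (x, y)) (- nu) - Cpowr (x, y) (- nu)) <= K * Rpower (Cmod (x, y)) (1 - nu).
Proof.
set (m := Rpower (1 / 2) (- nu - 1) + Rpower (3 / 2) (- nu - 1)).
assert (hm : 0 < m) by (apply Rplus_lt_0_compat; apply Rpower_pos).
exists (Rabs (- nu) * m * 10 + 1); split.
{ pose proof (Rabs_pos (- nu)); assert (0 <= Rabs (- nu) * m) by nra; lra. }
intros x y hx hr; set (z := (x, y)) in *; set (r := Cmod z) in *.
assert (hr0 : 0 < r).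
{ eapply Rlt_le_trans; [exact hx|]; rewrite <- (Rabs_pos_eq x) by lra; apply (abs_Re_le z). }
set (v := (one_minus_exp z - z)%C).
assert (hv : Cmod v <= 10 * r ^ 2).
{ replace v with (- (Cexp (- z) - 1 - - z))%C by (unfold v, one_minus_exp; ring).
  rewrite Cmod_opp; unfold r; rewrite <- (Cmod_opp z); apply Cexp_quad; rewrite Cmod_opp; fold r; lra. }
assert (hv2 : Cmod v <= r / 2) by (simpl in hv; nra).
replace (one_minus_exp z) with (z + v)%C by (unfold v; ring).
eapply Rle_trans; [apply (Cpowr_mean_value z v (- nu) (m * Rpower r (- nu - 1)))|].
- intros t ht; split.
  + replace (Re (z + t * v)) with ((1 - t) * x + t * Re (one_minus_exp z)).
    * pose proof (one_minus_exp_Re_pos x y hx) as hp; fold z in hp.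
      destruct (Req_dec t 0) as [->|e]; [lra|].
      assert (0 < t * Re (one_minus_exp z)) by (apply Rmult_lt_0_compat; lra); nra.
    * unfold v; rewrite re_plus, re_scal_l; unfold Cminus; rewrite re_plus, re_opp.
      change (Re z) with x; ring.
  + assert (htv : Cmod (t * v) <= r / 2).
    { rewrite Cmod_mult, Cmod_R, Rabs_pos_eq by lra; pose proof (Cmod_ge_0 v); nra. }
    pose proof (Cmod_triangle_inv z (t * v)) as a; pose proof (Cmod_triangle z (t * v)) as b.
    fold r in a, b.
    eapply Rle_trans; [apply (Rpower_le_ends (1 / 2 * r) (3 / 2 * r)); lra|].
    rewrite <- !Rpower_mult_distr by lra; unfold m; lra.
- assert (e : Rpower r (1 - nu) = Rpower r (- nu - 1) * r ^ 2).
  { replace (1 - nu) with ((- nu - 1) + INR 2) by (simpl; ring).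
    rewrite Rpower_plus, Rpower_pow by exact hr0; reflexivity. }
  rewrite e; assert (hp := Rpower_pos r (- nu - 1)); pose proof (Rabs_pos (- nu)).
  assert (0 <= r ^ 2) by (apply pow_le; lra).
  replace ((Rabs (- nu) * m * 10 + 1) * (Rpower r (- nu - 1) * r ^ 2)) with
    (Rabs (- nu) * (m * Rpower r (- nu - 1)) * (10 * r ^ 2) + Rpower r (- nu - 1) * r ^ 2) by ring.
  assert (0 <= Rpower r (- nu - 1) * r ^ 2) by (apply Rmult_le_pos; lra).
  assert (Rabs (- nu) * (m * Rpower r (- nu - 1)) * Cmod v
     <= Rabs (- nu) * (m * Rpower r (- nu - 1)) * (10 * r ^ 2)); [|lra].
  apply Rmult_le_compat_l; [|exact hv]; apply Rmult_le_pos; [lra|]; apply Rmult_le_pos; lra.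
Qed.

(** The mass of this kernel is at most [PI] whatever [c] is, which makes it a suitable majorant on
    the line [Re z = c]. *)
Lemma is_RInt_cauchy_kernel c a b : 0 < c ->
  is_RInt (fun y => c / (c ^ 2 + y ^ 2)) a b (atan (b / c) - atan (a / c)).
Proof.
intros hc.
apply (is_RInt_derive (fun y => atan (y / c))).
- intros y _; auto_derive; [trivial|]; unfold Rsqr; field; split; [apply Rgt_not_eq; nra | lra].
- intros y _; apply (ex_derive_continuous (V := R_NormedModule)); auto_derive; apply Rgt_not_eq; nra.
Qed.

(** The exact integral over a period is compared with the windowed moment for [M = 1]. Away from 0
    the integrand is bounded. Near 0 the kernels differ by [O(|z|^(-s))], which integrates to
    [O(c^(1 - s))], and [c] is of order [1 / n]. For [s >= 2] the factor [|z|^(2 - s)] is at most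
    [c^(2 - s)], which leaves the Cauchy kernel [c / |z|^2]. *)
Lemma binom_coef_asymp d s : 0 < d <= 1 / 40 -> 2 <= s -> exists K, 0 < K /\
  forall n, (1 <= n)%nat ->
  Cmod (2 * PI * Ci * binom_coef (s + 1) n - Rpower (INR n) s * hankel_const d s)
    <= K * Rpower (INR n) (s - 1).
Proof.
intros hd hs; assert (hpi := PI_RGT_0); pose proof PI2_3_2 as hpi2.
set (nu := s + 1).
destruct (windowed_moment_pos d s 1 ltac:(lra)) as [K1 [hK1 H1]].
destruct (window_bounds d 1 ltac:(lra)) as [K2 [hK2 H2]].
destruct (binom_kernel_far nu d ltac:(lra)) as [K3 [hK3 H3]].
destruct (Cpowr_one_minus_exp nu) as [K4 [hK4 H4]].
assert (he := exp_pos (d / 2)).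
set (Z := (K4 + K2) * exp (d / 2) * Rpower (d / 2) (1 - s) * PI).
assert (hZ : 0 < Z).
{ unfold Z; pose proof (Rpower_pos (d / 2) (1 - s)); do 2 (apply Rmult_lt_0_compat; [|lra]); apply Rmult_lt_0_compat; lra. }
assert (hW : 0 < 2 * PI * (K3 * exp (d / 2))) by (apply Rmult_lt_0_compat; [lra | apply Rmult_lt_0_compat; lra]).
exists (2 * PI * (K3 * exp (d / 2)) + Z + 2 * K1); split; [lra|].
intros n hn.
assert (hk : 1 <= INR n) by (apply (le_INR 1); exact hn).
set (c := d / 2 / INR n).
assert (hc : 0 < c) by (apply Rdiv_lt_0_compat; lra).
assert (hc2 : c <= d / 2).
{ apply (Rmult_le_reg_r (INR n)); [lra|]; unfold c.
  replace (d / 2 / INR n * INR n) with (d / 2) by (field; lra); nra. }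
assert (ekc : INR n * c = d / 2) by (unfold c; field; lra).
rewrite <- (binom_contour nu n c hc).
set (k := INR n) in *; set (f := binom_kernel nu k).
assert (Df : forall y, Cdiff f (c, y)) by (intros; apply Cdiff_binom_kernel, hc).
set (g := windowed d 1 (- s - 1) k).
assert (Dg : forall y, Cdiff g (c, y)) by (intros; apply Cdiff_windowed, cut_plane_Re, hc).
assert (Far : forall a b, a <= b -> (forall y, a <= y <= b -> d <= Rabs y <= PI) ->
  Cmod (ver f c a b) <= (b - a) * (K3 * exp (d / 2))).
{ intros a b hab H; apply Cmod_ver_le; [exact hab | intros; apply Df |].
  intros y hy; unfold f, binom_kernel; rewrite Cmod_mult, Cmod_Cpowr, Cmod_Cexp.
  replace (Re (k * (c, y))) with (d / 2) by (rewrite <- ekc; simpl; ring).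
  apply Rmult_le_compat_r; [lra|]; apply H3; [exact hc | apply H, hy]. }
assert (F1 := Far (- PI) (- d) ltac:(lra)
  ltac:(intros y hy; rewrite Rabs_left1; lra)).
assert (F2 := Far d PI ltac:(lra) ltac:(intros y hy; rewrite Rabs_pos_eq; lra)).
assert (Near : Cmod (ver f c (- d) d - ver g c (- d) d) <= Z * Rpower k (s - 1)).
{ assert (X : ex_CInt (fun y => Ci * f (c, y))%C (- d) d)
    by (apply ex_CInt_scal, ex_CInt_v; [lra | intros; apply Df]).
  assert (Y : ex_CInt (fun y => Ci * g (c, y))%C (- d) d)
    by (apply ex_CInt_scal, ex_CInt_v; [lra | intros; apply Dg]).
  unfold ver; rewrite <- CInt_minus by assumption.
  set (q := (K4 + K2) * exp (d / 2) * Rpower c (1 - s)).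
  assert (I := is_RInt_cauchy_kernel c (- d) d hc).
  apply (is_RInt_scal _ _ _ q) in I.
  change (is_RInt (fun y => q * (c / (c ^ 2 + y ^ 2))) (- d) d (q * (atan (d / c) - atan (- d / c)))) in I.
  assert (hq : 0 < q) by (unfold q; pose proof (Rpower_pos c (1 - s)); repeat apply Rmult_lt_0_compat; lra).
  eapply Rle_trans.
  - apply (Cmod_CInt_le _ (fun y => q * (c / (c ^ 2 + y ^ 2))));
      [lra | apply ex_CInt_minus; assumption | eexists; exact I |].
    intros y hy.
    replace (Ci * f (c, y) - Ci * g (c, y))%C with (Ci * (f (c, y) - g (c, y)))%C by ring.
    rewrite Cmod_mult, Cmod_Ci, Rmult_1_l.
    unfold f, g, binom_kernel, windowed, hankel_kernel.
    replace (- s - 1) with (- nu) by (unfold nu; ring).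
    set (z := (c, y)); set (r := Cmod z).
    assert (hy' : Rabs y <= d) by (apply Rabs_le; lra).
    assert (hr : c <= r) by (rewrite <- (Rabs_pos_eq c) by lra; apply (abs_Re_le z)).
    assert (hr2 : r <= 1 / 20).
    { eapply Rle_trans; [apply Cmod_le_abs|]; simpl; rewrite (Rabs_pos_eq c); lra. }
    specialize (H4 c y hc hr2); fold z r in H4.
    destruct (H2 c y ltac:(rewrite Rabs_pos_eq; lra) hy') as (_ & W & _); fold z r in W.
    rewrite pow_1 in W.
    replace (Cpowr (one_minus_exp z) (- nu) * Cexp (k * z) - Cpowr z (- nu) * Cexp (k * z) * window d 1 z)%C
      with (((Cpowr (one_minus_exp z) (- nu) - Cpowr z (- nu)) - Cpowr z (- nu) * (window d 1 z - 1)) * Cexp (k * z))%C by ring.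
    rewrite Cmod_mult, Cmod_Cexp.
    replace (Re (k * z)) with (d / 2) by (rewrite <- ekc; simpl; ring).
    assert (e1 : Rpower r (1 - nu) = Rpower r (- nu) * r).
    { replace (1 - nu) with (- nu + 1) by ring; rewrite Rpower_plus, Rpower_1 by lra; reflexivity. }
    assert (T : Cmod ((Cpowr (one_minus_exp z) (- nu) - Cpowr z (- nu)) - Cpowr z (- nu) * (window d 1 z - 1))
      <= (K4 + K2) * Rpower r (1 - nu)).
    { eapply Rle_trans; [apply Cmod_triangle|].
      rewrite Cmod_opp, Cmod_mult, Cmod_Cpowr; fold r.
      assert (Rpower r (- nu) * Cmod (window d 1 z - 1) <= Rpower r (- nu) * (K2 * r))
        by (apply Rmult_le_compat_l; [left; apply Rpower_pos | exact W]).
      rewrite e1 in *; lra. }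
    assert (U : Rpower r (1 - nu) <= Rpower c (1 - s) * (c / (c ^ 2 + y ^ 2))).
    { assert (er : r ^ 2 = c ^ 2 + y ^ 2) by (unfold r; rewrite Cmod2_alt; reflexivity).
      rewrite <- er.
      replace (1 - nu) with ((2 - s) + - INR 2) by (unfold nu; simpl; ring).
      rewrite Rpower_plus, Rpower_Ropp, Rpower_pow by lra.
      replace (Rpower c (1 - s) * (c / r ^ 2)) with (Rpower c (2 - s) * / r ^ 2).
      - apply Rmult_le_compat_r; [left; apply Rinv_0_lt_compat, pow_lt; lra|].
        replace (2 - s) with (- (s - 2)) by ring; rewrite !Rpower_Ropp.
        apply Rinv_le_contravar; [apply Rpower_pos | apply Rle_Rpower_l; lra].
      - replace (2 - s) with ((1 - s) + 1) by ring; rewrite Rpower_plus, Rpower_1 by lra.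
        unfold Rdiv; ring. }
    apply Rle_trans with ((K4 + K2) * Rpower r (1 - nu) * exp (d / 2)).
    + apply Rmult_le_compat_r; lra.
    + unfold q.
      replace ((K4 + K2) * exp (d / 2) * Rpower c (1 - s) * (c / (c ^ 2 + y ^ 2)))
        with ((K4 + K2) * (Rpower c (1 - s) * (c / (c ^ 2 + y ^ 2))) * exp (d / 2)) by ring.
      apply Rmult_le_compat_r; [lra|]; apply Rmult_le_compat_l; lra.
  - rewrite (is_RInt_unique _ _ _ _ I).
    assert (Ha : atan (d / c) - atan (- d / c) <= PI).
    { pose proof (atan_bound (d / c)); pose proof (atan_bound (- d / c)); lra. }
    assert (ec : Rpower c (1 - s) = Rpower (d / 2) (1 - s) * Rpower k (s - 1)).
    { unfold c, Rdiv at 1; rewrite <- Rpower_mult_distr by (try apply Rinv_0_lt_compat; lra).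
      f_equal; replace (1 - s) with (- (s - 1)) by ring; rewrite Rpower_Ropp.
      unfold Rpower; rewrite ln_Rinv, <- exp_Ropp by lra; f_equal; ring. }
    apply Rle_trans with (q * PI); [apply Rmult_le_compat_l; lra|].
    unfold q, Z; rewrite ec; right; ring. }
assert (M := H1 n c hn (conj hc (Rle_refl _))); fold k g in M.
rewrite pow_1 in M.
assert (hp1 : 1 <= Rpower k (s - 1)).
{ apply Rle_trans with (Rpower k 0); [rewrite Rpower_O; lra | apply Rle_Rpower; lra]. }
assert (eks : Rpower k s = Rpower k (s - 1) * k).
{ replace s with ((s - 1) + 1) at 1 by ring; rewrite Rpower_plus, Rpower_1 by lra; reflexivity. }
assert (M' : K1 * (1 + Rpower k s) / k <= 2 * K1 * Rpower k (s - 1)).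
{ rewrite eks; apply (Rmult_le_reg_r k); [lra|].
  unfold Rdiv; rewrite (Rmult_assoc _ (/ k)), Rinv_l, Rmult_1_r by lra.
  replace (2 * K1 * Rpower k (s - 1) * k) with (K1 * (2 * (Rpower k (s - 1) * k))) by ring.
  apply Rmult_le_compat_l; nra. }
rewrite (ver_Chasles f c (- PI) (- d) PI), (ver_Chasles f c (- d) d PI) by (try lra; intros; apply Df).
replace (ver f c (- PI) (- d) + (ver f c (- d) d + ver f c d PI) - Rpower k s * hankel_const d s)%C with
  (ver f c (- PI) (- d) + ver f c d PI + (ver f c (- d) d - ver g c (- d) d)
   + (ver g c (- d) d - Rpower k s * hankel_const d s))%C by ring.
eapply Rle_trans; [apply Cmod_triangle|].
eapply Rle_trans; [apply Rplus_le_compat_r, Cmod_triangle|].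
eapply Rle_trans; [apply Rplus_le_compat_r, Rplus_le_compat_r, Cmod_triangle|].
assert (hW' : 0 < K3 * exp (d / 2)) by (apply Rmult_lt_0_compat; lra).
assert (F3 : Cmod (ver f c (- PI) (- d)) + Cmod (ver f c d PI) <= 2 * PI * (K3 * exp (d / 2))) by nra.
assert (2 * PI * (K3 * exp (d / 2)) <= 2 * PI * (K3 * exp (d / 2)) * Rpower k (s - 1)).
{ rewrite <- Rmult_1_r at 1; apply Rmult_le_compat_l; lra. }
lra.
Qed.

Lemma is_lim_seq_inv_INR K : is_lim_seq (fun n => K / INR n) 0.
Proof.
replace (Finite 0) with (Rbar_mult K 0) by (simpl; f_equal; ring).
apply (is_lim_seq_scal_l (fun n => / INR n) K 0).
replace (Finite 0) with (Rbar_inv p_infty) by reflexivity.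
apply is_lim_seq_inv; [apply is_lim_seq_INR | discriminate].
Qed.

(* [1 / Gamma (s + 1)] for every real [s]; the value does not depend on [d]. *)
Definition inv_gamma (d s : R) : R := Im (hankel_const d s) / (2 * PI).

(** The normalised coefficients are real, so [hankel_const] is purely imaginary and is determined by
    the imaginary part that [inv_gamma] keeps. *)
Lemma binom_coef_limit d s : 0 < d <= 1 / 40 -> 2 <= s ->
  hankel_const d s = (2 * PI * Ci * inv_gamma d s)%C /\
  is_lim_seq (fun n => binom_coef (s + 1) n / Rpower (INR n) s) (inv_gamma d s).
Proof.
intros hd hs; assert (hpi := PI_RGT_0).
destruct (binom_coef_asymp d s hd hs) as [K [hK H]].
set (Hc := hankel_const d s).
set (b := fun n => binom_coef (s + 1) n / Rpower (INR n) s).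
assert (B : forall n, (1 <= n)%nat -> Cmod (2 * PI * Ci * b n - Hc) <= K / INR n).
{ intros n hn; specialize (H n hn); fold Hc in H.
  assert (hk : 1 <= INR n) by (apply (le_INR 1); exact hn).
  assert (hp := Rpower_pos (INR n) s).
  assert (hp' : RtoC (Rpower (INR n) s) <> 0%C) by (intros e; apply RtoC_inj in e; lra).
  replace (2 * PI * Ci * binom_coef (s + 1) n - Rpower (INR n) s * Hc)%C
    with (Rpower (INR n) s * (2 * PI * Ci * b n - Hc))%C in H
    by (unfold b; rewrite RtoC_div by lra; field; exact hp').
  rewrite Cmod_mult, Cmod_R, Rabs_pos_eq in H by lra.
  assert (e : Rpower (INR n) (s - 1) = Rpower (INR n) s * / INR n).
  { unfold Rminus; rewrite Rpower_plus, (Rpower_Ropp _ 1), Rpower_1 by lra; reflexivity. }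
  rewrite e in H; apply (Rmult_le_reg_l (Rpower (INR n) s)); [exact hp|]; unfold Rdiv; lra. }
assert (hz : is_lim_seq (fun n => K / INR n) 0) by apply is_lim_seq_inv_INR.
assert (R0 : Re Hc = 0).
{ assert (L : Rbar_le (Rabs (Re Hc)) 0).
  { refine (is_lim_seq_le_loc (fun _ => Rabs (Re Hc)) (fun n => K / INR n) _ _ _ (is_lim_seq_const _) hz).
    exists 1%nat; intros n hn; eapply Rle_trans; [|apply (B n hn)].
    eapply Rle_trans; [|apply abs_Re_le]; simpl.
    rewrite <- Rabs_Ropp; right; f_equal; unfold Re; ring. }
  change (Rabs (Re Hc) <= 0) in L; destruct (Req_dec (Re Hc) 0) as [e|e]; [exact e|].
  apply Rabs_pos_lt in e; lra. }
split.
- assert (E : Im Hc = 2 * PI * inv_gamma d s) by (unfold inv_gamma; fold Hc; field; lra).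
  transitivity (Re Hc, Im Hc); [apply surjective_pairing|]; rewrite R0, E.
  apply injective_projections; simpl; ring.
- apply (is_lim_seq_ext (fun n => / (2 * PI) * (2 * PI * b n))); [intros n; unfold b; field|].
  { split; [apply Rgt_not_eq, Rpower_pos | lra]. }
  replace (inv_gamma d s) with (/ (2 * PI) * Im Hc) by (unfold inv_gamma, Hc; field; lra).
  apply (is_lim_seq_scal_l _ (/ (2 * PI)) (Im Hc)).
  apply (is_lim_seq_le_le_loc (fun n => Im Hc - K / INR n) _ (fun n => Im Hc + K / INR n)).
  + exists 1%nat; intros n hn.
    assert (T : Rabs (2 * PI * b n - Im Hc) <= K / INR n).
    { eapply Rle_trans; [|apply (B n hn)]; eapply Rle_trans; [|apply abs_Im_le]; simpl.
      right; f_equal; unfold Im; ring. }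
    apply Rabs_le_between in T; lra.
  + replace (Finite (Im Hc)) with (Finite (Im Hc - 0)) by (f_equal; ring).
    apply is_lim_seq_minus'; [apply is_lim_seq_const | exact hz].
  + replace (Finite (Im Hc)) with (Finite (Im Hc + 0)) by (f_equal; ring).
    apply is_lim_seq_plus'; [apply is_lim_seq_const | exact hz].
Qed.

(** * The convolution sum *)

Lemma inv_gamma_rec d s : 0 < d -> inv_gamma d (s - 1) = s * inv_gamma d s.
Proof.
intros hd; unfold inv_gamma; rewrite hankel_const_rec by exact hd; rewrite im_scal_l.
field; pose proof PI_RGT_0; lra.
Qed.

(** Known for [s >= 2] from the limit of coefficients; the common recurrence carries it down by unit
    steps to every real [s]. *)
Lemma hankel_const_inv_gamma d s : 0 < d <= 1 / 40 ->
  hankel_const d s = (2 * PI * Ci * inv_gamma d s)%C.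
Proof.
intros hd; destruct (INR_archimed 1 (2 - s)) as [j hj]; [lra|].
assert (h : 2 <= s + INR j) by lra; clear hj.
revert s h; induction j as [|j IH]; intros s h.
- apply binom_coef_limit; [exact hd | simpl in h; lra].
- rewrite S_INR in h.
  replace s with ((s + 1) - 1) by ring.
  rewrite hankel_const_rec, inv_gamma_rec, IH, RtoC_mult by lra; ring.
Qed.

Lemma Cdiff_of_ex_derive W z :
  ex_derive (K := C_AbsRing) (V := C_NormedModule) W z -> Cdiff W z.
Proof. intros [l H]; exists l; apply Cderiv_of_is_derive, H. Qed.

(** For [|y| <= 1] the sine of [y] vanishes only at 0, so [1 - e^(-z)] can lie on the cut only if
    [z] does. *)
Lemma one_minus_exp_cut_small x y : Rabs y <= 1 -> cut_plane (x, y) -> cut_plane (one_minus_exp (x, y)).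
Proof.
intros hy hz [h1 h2]; apply hz; simpl.
rewrite one_minus_exp_Re in h1.
assert (h3 : exp (- x) * sin y = 0).
{ rewrite <- h2; unfold one_minus_exp, Cexp; simpl; rewrite sin_neg; ring. }
assert (he := exp_pos (- x)).
assert (hs : sin y = 0) by (apply Rmult_integral in h3; destruct h3; [lra | assumption]).
assert (hy0 : y = 0).
{ destruct (Rtotal_order y 0) as [a|[a|a]]; [|exact a|]; exfalso; apply Rabs_le_between in hy;
    pose proof PI2_3_2.
  - assert (0 < sin (- y)) by (apply sin_gt_0; lra); rewrite sin_neg in *; lra.
  - assert (0 < sin y) by (apply sin_gt_0; lra); lra. }
split; [|exact hy0].
rewrite hy0, cos_0 in h1.
destruct (Rle_dec x 0) as [a|a]; [exact a|].
assert (exp (- x) < 1) by (rewrite <- exp_0; apply exp_increasing; lra); lra.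
Qed.

(** One box for analyticity and consistency. As [|z| <= 2 d <= 1/20], one has
    [|e^(-z) - 1| <= 3/2 |z|], so [d <= e1 / 8] keeps [e^(-z)] where [W] is differentiable. *)
Lemma local_expansion omega W alpha p : generating_function omega W -> consistent alpha p W ->
  exists d K, 0 < d <= 1 / 40 /\ 0 <= K /\
  forall x y, Rabs x <= d -> Rabs y <= d -> cut_plane (x, y) ->
    Cdiff (fun z => W (Cexp (- z))) (x, y) /\
    Cmod (Cpowr (x, y) (- alpha) * W (Cexp (- (x, y))) - 1) <= K * Cmod (x, y) ^ p.
Proof.
intros [_ [[e1 h1] H1]] [K [[e2 h2] H2]]; simpl in H1, H2.
set (d := Rmin (1 / 40) (Rmin (e1 / 8) (e2 / 2))).
assert (hd0 : 0 < d) by (repeat apply Rmin_pos; lra).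
assert (hd1 : d <= 1 / 40) by apply Rmin_l.
assert (hd2 : d <= e1 / 8) by (eapply Rle_trans; [apply Rmin_r | apply Rmin_l]).
assert (hd3 : d <= e2 / 2) by (eapply Rle_trans; [apply Rmin_r | apply Rmin_r]).
exists d, (Rabs K); repeat split; try lra; [apply Rabs_pos | |].
- set (z := (x, y)).
  assert (hr : Cmod z <= 2 * d) by (eapply Rle_trans; [apply Cmod_le_abs|]; simpl; lra).
  apply (Cdiff_comp W (fun z => Cexp (- z))); [|apply Cdiff_Cexp, Cdiff_opp, Cdiff_id].
  apply Cdiff_of_ex_derive, H1.
  + apply C_NormedModule_mixin_compat1; change (Cmod (Cexp (- z) - 1) < e1).
    replace (Cexp (- z) - 1)%C with ((Cexp (- z) - 1 - - z) + - z)%C by ring.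
    eapply Rle_lt_trans; [apply Cmod_triangle|].
    pose proof (Cexp_quad (- z)) as a; rewrite Cmod_opp in *; specialize (a ltac:(lra)).
    pose proof (Cmod_ge_0 z); simpl in a; nra.
  + apply one_minus_exp_cut_small; [lra | assumption].
- set (z := (x, y)) in *.
  assert (B : Rabs (Cmod (Cpowr z (- alpha) * W (Cexp (- z)) - 1)) <= K * Rabs (Cmod z ^ p)).
  { apply H2; [|assumption].
    split; simpl; unfold ball; simpl; unfold AbsRing_ball, abs, minus, plus, opp; simpl;
      rewrite Ropp_0, Rplus_0_r; lra. }
  assert (hp : 0 <= Cmod z ^ p) by (apply pow_le, Cmod_ge_0).
  rewrite (Rabs_pos_eq (Cmod z ^ p)) in B by exact hp.
  eapply Rle_trans; [apply Rle_abs|]; eapply Rle_trans; [exact B|].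
  apply Rmult_le_compat_r; [exact hp | apply Rle_abs].
Qed.

(** * Global bounds on the weights, and sums against decaying errors *)

Lemma eventually_le_all (u v : nat -> R) : (forall n, 0 < v n) ->
  (exists K, eventually (fun n => Rabs (u n) <= K * v n)) ->
  exists C, 0 < C /\ forall n, Rabs (u n) <= C * v n.
Proof.
intros hv [K [N HN]].
assert (P : exists C, 0 < C /\ forall n, (n < N)%nat -> Rabs (u n) <= C * v n).
{ clear HN; induction N as [|N [C [hC H]]]; [exists 1; split; [lra | intros; lia]|].
  exists (C + Rabs (u N) / v N).
  assert (h : 0 <= Rabs (u N) / v N) by (apply Rdiv_le_0_compat; [apply Rabs_pos | apply hv]).
  split; [lra|]; intros n hn; specialize (hv n) as hvn.
  destruct (Nat.eq_dec n N) as [->|e].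
  - rewrite Rmult_plus_distr_r; unfold Rdiv; rewrite (Rmult_assoc _ (/ v N)), Rinv_l by lra; nra.
  - specialize (H n ltac:(lia)); nra. }
destruct P as [C [hC H]]; exists (C + Rabs K); split; [pose proof (Rabs_pos K); lra|].
intros n; specialize (hv n); pose proof (Rabs_pos K); pose proof (Rle_abs K).
destruct (Nat.lt_ge_cases n N) as [h|h].
- specialize (H n h); nra.
- specialize (HN n h); nra.
Qed.

(** The base [n + 1] makes the bound valid at [n = 0] too; for [n >= 1] the quotient [n / (n + 1)]
    lies in [[1/2, 1]] and affects only the constant. *)
Lemma stable_bound alpha omega : stable alpha omega -> exists C, 0 < C /\
  forall n, Rabs (omega n) <= C * Rpower (INR n + 1) (- alpha - 1).
Proof.
intros [K [N HN]]; set (a := - alpha - 1) in *.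
apply eventually_le_all; [intros; apply Rpower_pos|].
exists (Rabs K * (Rpower (1 / 2) a + Rpower 1 a)), (S N); intros n hn.
specialize (HN n ltac:(lia)); eapply Rle_trans; [exact HN|].
assert (hk : 1 <= INR n) by (apply (le_INR 1); lia).
rewrite (Rabs_pos_eq (Rpower (INR n) a)) by (left; apply Rpower_pos).
assert (E : Rpower (INR n) a <= (Rpower (1 / 2) a + Rpower 1 a) * Rpower (INR n + 1) a).
{ replace (INR n) with (INR n / (INR n + 1) * (INR n + 1)) at 1 by (field; lra).
  rewrite <- Rpower_mult_distr by (try apply Rdiv_lt_0_compat; lra).
  apply Rmult_le_compat_r; [left; apply Rpower_pos|].
  apply Rpower_le_ends; [lra|]; split; apply (Rmult_le_reg_r (INR n + 1)); try lra;
    unfold Rdiv; rewrite (Rmult_assoc (INR n)), Rinv_l; lra. }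
assert (hp := Rpower_pos (INR n) a); pose proof (Rle_abs K); pose proof (Rabs_pos K).
apply Rle_trans with (Rabs K * Rpower (INR n) a); [nra|].
rewrite Rmult_assoc; apply Rmult_le_compat_l; assumption.
Qed.

(** Each of [x] and [y] is at most [D] times the other. The inequality moves the growth of a weight
    from one index to another at the price of a power of their distance. *)
Lemma Peetre_inequality a (A : nat) (x y : R) : Rabs a <= INR A -> 1 <= x -> 1 <= y ->
  Rpower x a <= Rpower y a * (1 + Rabs (y - x)) ^ A.
Proof.
intros hA hx hy.
set (D := 1 + Rabs (y - x)).
assert (hD : 1 <= D) by (unfold D; pose proof (Rabs_pos (y - x)); lra).
assert (h1 : x <= D * y).
{ unfold D; pose proof (Rle_abs (- (y - x))); rewrite Rabs_Ropp in *; pose proof (Rabs_pos (y - x)); nra. }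
assert (h2 : y <= D * x) by (unfold D; pose proof (Rle_abs (y - x)); pose proof (Rabs_pos (y - x)); nra).
assert (hDA : Rpower D (Rabs a) <= D ^ A) by (rewrite <- Rpower_pow by lra; apply Rle_Rpower; lra).
assert (hya := Rpower_pos y a).
apply Rle_trans with (Rpower y a * Rpower D (Rabs a)); [|apply Rmult_le_compat_l; lra].
destruct (Rle_dec 0 a) as [h|h].
- rewrite (Rabs_pos_eq a) by lra; rewrite Rpower_mult_distr by lra; apply Rle_Rpower_l; lra.
- rewrite (Rabs_left1 a) by lra.
  assert (e : forall t, Rpower t a = / Rpower t (- a)) by (intros; rewrite <- Rpower_Ropp; f_equal; ring).
  rewrite !e.
  assert (p1 := Rpower_pos x (- a)); assert (p2 := Rpower_pos y (- a)).
  apply (Rmult_le_reg_l (Rpower x (- a) * Rpower y (- a))); [apply Rmult_lt_0_compat; assumption|].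
  replace (Rpower x (- a) * Rpower y (- a) * / Rpower x (- a)) with (Rpower y (- a)) by (field; lra).
  replace (Rpower x (- a) * Rpower y (- a) * (/ Rpower y (- a) * Rpower D (- a)))
    with (Rpower D (- a) * Rpower x (- a)) by (field; lra).
  rewrite Rpower_mult_distr by lra; apply Rle_Rpower_l; lra.
Qed.

Fixpoint Csum (f : nat -> C) (N : nat) : C :=
  match N with O => 0%C | S n => (Csum f n + f n)%C end.

Fixpoint Rsum (f : nat -> R) (N : nat) : R :=
  match N with O => 0 | S n => Rsum f n + f n end.

Lemma Cmod_Csum_le f g N : (forall m, (m < N)%nat -> Cmod (f m) <= g m) ->
  Cmod (Csum f N) <= Rsum g N.
Proof.
induction N as [|N IH]; intros H; simpl; [rewrite Cmod_0; lra|].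
eapply Rle_trans; [apply Cmod_triangle|]; apply Rplus_le_compat; [apply IH; intros; apply H; lia | apply H; lia].
Qed.

Lemma Rsum_scal c f N : Rsum (fun m => c * f m) N = c * Rsum f N.
Proof. induction N as [|N IH]; simpl; [|rewrite IH]; ring. Qed.

Lemma Csum_minus f g N : (Csum f N - Csum g N)%C = Csum (fun m => f m - g m)%C N.
Proof. induction N as [|N IH]; simpl; [|rewrite <- IH]; ring. Qed.

Lemma Csum_scal c f N : (c * Csum f N)%C = Csum (fun m => c * f m)%C N.
Proof. induction N as [|N IH]; simpl; [|rewrite <- IH]; ring. Qed.

Lemma Csum_RtoC f N : Csum (fun m => RtoC (f m)) N = RtoC (Rsum f N).
Proof. induction N as [|N IH]; simpl; [reflexivity|]; rewrite IH, RtoC_plus; reflexivity. Qed.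

Lemma Csum_ext f g N : (forall m, (m < N)%nat -> f m = g m) -> Csum f N = Csum g N.
Proof.
induction N as [|N IH]; intros H; simpl; [reflexivity|].
rewrite IH, H by (intros; try apply H; lia); reflexivity.
Qed.

(** Telescoping with [1 / (t + 1)^2 <= 1 / t - 1 / (t + 1)]. The majorant [B] collects at most 1
    from the indices below [n], 1 from [n] itself and 1 from those above. *)
Lemma sum_inv_square_dist n N :
  Rsum (fun m => / (1 + Rabs (INR n - INR m)) ^ 2) N <= 3.
Proof.
set (B := fun N => if le_dec N n then / (INR n - INR N + 1) else 3 - / (INR N - INR n)).
assert (P : Rsum (fun m => / (1 + Rabs (INR n - INR m)) ^ 2) N <= B N).
{ induction N as [|N IH].
  - unfold B; simpl; destruct (le_dec 0 n); [|lia].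
    left; apply Rinv_0_lt_compat; pose proof (pos_INR n); lra.
  - simpl Rsum; eapply Rle_trans; [apply Rplus_le_compat_r, IH|]; unfold B; rewrite S_INR.
    destruct (le_dec N n) as [h|h]; destruct (le_dec (S N) n) as [h'|h']; try lia.
    + apply le_INR in h'; rewrite S_INR in h'; rewrite Rabs_pos_eq by lra.
      set (t := INR n - INR N) in *; replace (INR n - (INR N + 1) + 1) with t by (unfold t; ring).
      assert (ht : 1 <= t) by (unfold t; lra).
      replace (1 + t) with (t + 1) by ring.
      assert (e : / t - / (t + 1) = / (t * (t + 1))) by (field; split; lra).
      assert (/ ((t + 1) * ((t + 1) * 1)) <= / (t * (t + 1))); [|lra].
      apply Rinv_le_contravar; [apply Rmult_lt_0_compat; lra | nra].
    + replace n with N by lia; rewrite Rminus_diag, Rabs_R0.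
      replace (INR N + 1 - INR N) with 1 by ring; simpl; lra.
    + assert (h2 : (n < N)%nat) by lia; apply lt_INR in h2.
      assert (h3 : INR n + 1 <= INR N) by (rewrite <- S_INR; apply le_INR; lia).
      rewrite Rabs_left1 by lra.
      set (t := INR N - INR n) in *; replace (INR N + 1 - INR n) with (t + 1) by (unfold t; ring).
      replace (- (INR n - INR N)) with t by (unfold t; ring).
      assert (ht : 1 <= t) by (unfold t; lra).
      replace (1 + t) with (t + 1) by ring.
      assert (e : / t - / (t + 1) = / (t * (t + 1))) by (field; split; lra).
      assert (/ ((t + 1) * ((t + 1) * 1)) <= / (t * (t + 1))); [|lra].
      apply Rinv_le_contravar; [apply Rmult_lt_0_compat; lra | nra]. }
eapply Rle_trans; [exact P|]; unfold B; destruct (le_dec N n) as [h|h].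
- apply le_INR in h; apply Rle_trans with (/ 1); [apply Rinv_le_contravar; lra | lra].
- assert (h2 : (n < N)%nat) by lia; apply lt_INR in h2.
  assert (0 < / (INR N - INR n)) by (apply Rinv_0_lt_compat; lra); lra.
Qed.

Lemma ex_CInt_Csum f a b N : (forall m, ex_CInt (f m) a b) -> ex_CInt (fun y => Csum (fun m => f m y) N) a b.
Proof.
intros H; induction N as [|N IH]; simpl.
- eexists; apply (is_RInt_const (V := C_R_NormedModule)).
- apply ex_CInt_plus; [exact IH | apply H].
Qed.

Lemma CInt_Csum f a b N : (forall m, ex_CInt (f m) a b) ->
  CInt (fun y => Csum (fun m => f m y) N) a b = Csum (fun m => CInt (f m) a b) N.
Proof.
intros H; induction N as [|N IH]; simpl.
- rewrite CInt_const; ring.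
- rewrite CInt_plus, IH; [reflexivity | apply ex_CInt_Csum, H | apply H].
Qed.

(** At modulus [e^(-c)] the algebraic growth of the weights costs half of the geometric decay
    rate. *)
Lemma stable_geometric C0 a omega c : 0 < c -> 0 < C0 ->
  (forall n, Rabs (omega n) <= C0 * Rpower (INR n + 1) a) ->
  exists K, 0 < K /\ forall n, Rabs (omega n) * exp (- c) ^ n <= K * exp (- (c / 2)) ^ n.
Proof.
intros hc hC H; destruct (Rpower_le_exp c a hc) as [K [hK HK]].
assert (hp := Rpower_pos c a).
exists (C0 * (K / Rpower c a) * exp (c / 2)); split.
{ apply Rmult_lt_0_compat; [|apply exp_pos]; apply Rmult_lt_0_compat; [exact hC | apply Rdiv_lt_0_compat; assumption]. }
intros n; set (t := INR n + 1).
assert (ht : 1 <= t) by (unfold t; pose proof (pos_INR n); lra).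
specialize (HK (c * t) ltac:(nra)); rewrite <- Rpower_mult_distr in HK by lra.
assert (h : Rpower t a <= K / Rpower c a * exp (c * t / 2)).
{ apply (Rmult_le_reg_l (Rpower c a)); [exact hp|].
  replace (Rpower c a * (K / Rpower c a * exp (c * t / 2))) with (K * exp (c * t / 2)) by (field; lra).
  exact HK. }
rewrite <- !exp_nat_scale.
assert (he := exp_pos (INR n * - c)).
apply Rle_trans with (C0 * (K / Rpower c a * exp (c * t / 2)) * exp (INR n * - c)).
- apply Rmult_le_compat_r; [lra|]; eapply Rle_trans; [apply H|]; apply Rmult_le_compat_l; [lra | exact h].
- assert (E : exp (c * t / 2) * exp (INR n * - c) = exp (c / 2) * exp (INR n * - (c / 2)))
    by (rewrite <- !exp_plus; f_equal; unfold t; field).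
  right; rewrite !Rmult_assoc, E; ring.
Qed.

Lemma Cpow_Cexp z m : (Cexp z ^ m)%C = Cexp (INR m * z).
Proof.
induction m as [|m IH]; [simpl; rewrite Cmult_0_l; symmetry; apply Cexp_0|].
rewrite Cpow_S, IH, <- Cexp_plus; f_equal; rewrite S_INR, RtoC_plus; ring.
Qed.

Lemma Cpow_pow_n (z : C) n : pow_n (K := C_AbsRing) z n = (z ^ n)%C.
Proof. induction n as [|n IH]; [reflexivity|]; simpl; rewrite IH; reflexivity. Qed.

Lemma sum_n_Csum (f : nat -> C) N : sum_n (G := C_AbelianMonoid) f N = Csum f (S N).
Proof.
induction N as [|N IH].
- rewrite sum_O; simpl; ring.
- rewrite sum_Sn, IH; reflexivity.
Qed.

Lemma power_series_tail (omega : nat -> R) (z l : C) K q : 0 < q < 1 ->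
  is_pseries (V := C_NormedModule) (fun k => RtoC (omega k)) z l ->
  (forall n, Rabs (omega n) * Cmod z ^ n <= K * q ^ n) ->
  forall N, Cmod (l - Csum (fun m => omega m * z ^ m)%C N) <= K * q ^ N / (1 - q).
Proof.
intros hq H B N.
set (u := Csum (fun m => omega m * z ^ m)%C).
assert (hK : 0 <= K).
{ specialize (B 0%nat); simpl in B; pose proof (Rabs_pos (omega 0%nat)); lra. }
assert (P : forall j, Cmod (u (N + j)%nat - u N) <= K * q ^ N * (1 - q ^ j) / (1 - q)).
{ induction j as [|j IH].
  - rewrite Nat.add_0_r; replace (u N - u N)%C with (RtoC 0) by ring; rewrite Cmod_0; simpl.
    right; field; lra.
  - rewrite Nat.add_succ_r.
    replace (u (S (N + j)) - u N)%C with ((u (N + j)%nat - u N) + omega (N + j)%nat * z ^ (N + j))%C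
      by (unfold u; simpl; ring).
    eapply Rle_trans; [apply Cmod_triangle|]; rewrite Cmod_mult, Cmod_R, Cmod_pow.
    specialize (B (N + j)%nat); rewrite (pow_add q) in B.
    replace (K * q ^ N * (1 - q ^ S j) / (1 - q)) with
      (K * q ^ N * (1 - q ^ j) / (1 - q) + K * (q ^ N * q ^ j)) by (simpl; field; lra).
    lra. }
assert (Q : forall j, Cmod (u (N + j)%nat - u N) <= K * q ^ N / (1 - q)).
{ intros j; eapply Rle_trans; [apply P|]; unfold Rdiv.
  apply Rmult_le_compat_r; [left; apply Rinv_0_lt_compat; lra|].
  assert (0 <= q ^ j) by (apply pow_le; lra); assert (0 <= K * q ^ N) by (apply Rmult_le_pos; [lra | apply pow_le; lra]).
  nra. }
apply le_epsilon; intros eps he.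
unfold is_pseries, is_series in H.
assert (he2 : 0 < eps / 2) by lra.
destruct (proj1 (filterlim_locally _ _) H (mkposreal _ he2)) as [J HJ].
specialize (HJ (N + J)%nat ltac:(lia)); specialize (Q (S J)).
rewrite (sum_n_ext _ (fun m => omega m * z ^ m)%C) in HJ.
2:{ intros m; change (pow_n (K := C_AbsRing) z m * omega m = omega m * z ^ m)%C.
    rewrite Cpow_pow_n; ring. }
change (sum_n (G := C_NormedModule) (fun m => omega m * z ^ m)%C (N + J)) with
  (sum_n (G := C_AbelianMonoid) (fun m => omega m * z ^ m)%C (N + J)) in HJ.
rewrite sum_n_Csum in HJ; fold u in HJ.
apply C_NormedModule_mixin_compat2 in HJ; simpl in HJ.
change (Cmod (u (S (N + J)) - l) < sqrt 2 * (eps / 2)) in HJ.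
(* Balls of the product structure agree with discs up to the factor [sqrt 2]; half of [eps] leaves
   room for it. *)
assert (hs : sqrt 2 <= 2).
{ rewrite <- (sqrt_Rsqr 2) at 2 by lra; apply sqrt_le_1_alt; unfold Rsqr; lra. }
rewrite Nat.add_succ_r in Q.
replace (l - u N)%C with (- (u (S (N + J)) - l) + (u (S (N + J)) - u N))%C by ring.
eapply Rle_trans; [apply Cmod_triangle|]; rewrite Cmod_opp.
assert (sqrt 2 * (eps / 2) <= eps) by nra; lra.
Qed.

(** Peetre's inequality costs [D^A], where [D] is 1 plus the distance from [m] to [n]. The errors
    decay like [D^(- A - 2)], so a summable [D^(-2)] remains and the sum has the size of one weight
    at [n], uniformly in [N]. *)
Lemma convolution_decay (omega : nat -> R) (e : nat -> C) C0 K a A n N :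
  Rabs a <= INR A -> 0 <= C0 -> 0 <= K ->
  (forall m, Rabs (omega m) <= C0 * Rpower (INR m + 1) a) ->
  (forall m, Cmod (e m) <= K / (1 + Rabs (INR n - INR m)) ^ (A + 2)) ->
  Cmod (Csum (fun m => omega m * e m)%C N) <= 3 * C0 * K * Rpower (INR n + 1) a.
Proof.
intros hA hC hK Ho He.
assert (hp := Rpower_pos (INR n + 1) a).
eapply Rle_trans.
- apply (Cmod_Csum_le _ (fun m => C0 * K * Rpower (INR n + 1) a * / (1 + Rabs (INR n - INR m)) ^ 2)).
  intros m _; rewrite Cmod_mult, Cmod_R.
  set (D := 1 + Rabs (INR n - INR m)).
  assert (hD : 1 <= D) by (unfold D; pose proof (Rabs_pos (INR n - INR m)); lra).
  specialize (He m); fold D in He.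
  assert (P : Rpower (INR m + 1) a <= Rpower (INR n + 1) a * D ^ A).
  { unfold D; replace (INR n - INR m) with (INR n + 1 - (INR m + 1)) by ring.
    apply Peetre_inequality; [exact hA | pose proof (pos_INR m); lra | pose proof (pos_INR n); lra]. }
  assert (pA : 0 < D ^ A) by (apply pow_lt; lra); assert (p2 : 0 < D ^ 2) by (apply pow_lt; lra).
  apply Rle_trans with (C0 * (Rpower (INR n + 1) a * D ^ A) * (K / D ^ (A + 2))).
  + apply Rmult_le_compat; [apply Rabs_pos | apply Cmod_ge_0 | | exact He].
    eapply Rle_trans; [apply Ho|]; apply Rmult_le_compat_l; assumption.
  + right; rewrite pow_add; field; repeat split; lra.
- rewrite Rsum_scal.
  replace (3 * C0 * K * Rpower (INR n + 1) a) with (C0 * K * Rpower (INR n + 1) a * 3) by ring.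
  apply Rmult_le_compat_l; [|apply sum_inv_square_dist].
  apply Rmult_le_pos; [apply Rmult_le_pos|]; lra.
Qed.

(** Both moment estimates in one form: the moments reproduce a truncated power, set to 0 for
    [m >= n]. The growth condition on [M] pays for the factor [k^sigma] in the error. *)
Lemma windowed_moment d sigma A M : 0 < d -> (forall k, 1 <= k -> Rpower k sigma * k ^ (A + 2) <= k ^ M) ->
  (A + 2 <= M)%nat -> exists K, 0 < K /\ forall n, (1 <= n)%nat -> forall m,
  Cmod (ver (windowed d M (- sigma - 1) (INR n - INR m)) (d / 2 / INR n) (- d) d
        - RtoC (if lt_dec m n then Rpower (INR n - INR m) sigma else 0) * hankel_const d sigma)
  <= K / (1 + Rabs (INR n - INR m)) ^ (A + 2).
Proof.
intros hd hM hAM.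
destruct (windowed_moment_pos d sigma M hd) as [K1 [hK1 H1]].
destruct (windowed_moment_neg d (- sigma - 1) M hd) as [K2 [hK2 H2]].
assert (h2 : 0 < 2 ^ (A + 2)) by (apply pow_lt; lra).
assert (hK3 : 0 < 2 * K1 * 2 ^ (A + 2)) by (apply Rmult_lt_0_compat; lra).
exists (2 * K1 * 2 ^ (A + 2) + K2); split; [lra|].
intros n hn m.
assert (hkn : 1 <= INR n) by (apply (le_INR 1); exact hn).
assert (hc : 0 < d / 2 / INR n) by (apply Rdiv_lt_0_compat; lra).
destruct (lt_dec m n) as [h|h].
- rewrite <- minus_INR by lia.
  assert (hk : 1 <= INR (n - m)) by (apply (le_INR 1); lia).
  assert (hkle : INR (n - m) <= INR n) by (apply le_INR; lia).
  rewrite Rabs_pos_eq by lra.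
  set (k := INR (n - m)) in *.
  assert (pk : 0 < k ^ (A + 2)) by (apply pow_lt; lra).
  assert (pk1 : 0 < (1 + k) ^ (A + 2)) by (apply pow_lt; lra).
  assert (pM : 0 < k ^ M) by (apply pow_lt; lra).
  eapply Rle_trans.
  (* The abscissa [d / (2 n)] is admissible for the exponent [n - m] because [n - m <= n]. *)
  + apply (H1 (n - m)%nat); [lia|]; split; [exact hc|]; fold k.
    apply Rmult_le_compat_l; [lra | apply Rinv_le_contravar; lra].
  + fold k.
    assert (T1 : k ^ (A + 2) <= k ^ M) by (apply Rle_pow; [exact hk | exact hAM]).
    assert (T2 := hM k hk).
    assert (T3 : (1 + Rpower k sigma) / k ^ M <= 2 / k ^ (A + 2)).
    { apply (Rmult_le_reg_r (k ^ M * k ^ (A + 2))); [apply Rmult_lt_0_compat; assumption|].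
      replace ((1 + Rpower k sigma) / k ^ M * (k ^ M * k ^ (A + 2)))
        with (k ^ (A + 2) + Rpower k sigma * k ^ (A + 2)) by (field; lra).
      replace (2 / k ^ (A + 2) * (k ^ M * k ^ (A + 2))) with (2 * k ^ M) by (field; lra); lra. }
    assert (T4 : / k ^ (A + 2) <= 2 ^ (A + 2) / (1 + k) ^ (A + 2)).
    { apply (Rmult_le_reg_r (k ^ (A + 2) * (1 + k) ^ (A + 2))); [apply Rmult_lt_0_compat; assumption|].
      replace (/ k ^ (A + 2) * (k ^ (A + 2) * (1 + k) ^ (A + 2))) with ((1 + k) ^ (A + 2)) by (field; lra).
      replace (2 ^ (A + 2) / (1 + k) ^ (A + 2) * (k ^ (A + 2) * (1 + k) ^ (A + 2)))
        with (2 ^ (A + 2) * k ^ (A + 2)) by (field; lra).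
      rewrite <- Rpow_mult_distr; apply pow_incr; lra. }
    assert (P : 0 < K2 / (1 + k) ^ (A + 2)) by (apply Rdiv_lt_0_compat; lra).
    apply Rle_trans with (2 * K1 * 2 ^ (A + 2) / (1 + k) ^ (A + 2)).
    * replace (K1 * (1 + Rpower k sigma) / k ^ M) with (K1 * ((1 + Rpower k sigma) / k ^ M)) by (field; lra).
      replace (2 * K1 * 2 ^ (A + 2) / (1 + k) ^ (A + 2)) with (K1 * (2 * (2 ^ (A + 2) / (1 + k) ^ (A + 2)))) by (field; lra).
      apply Rmult_le_compat_l; [lra|]; unfold Rdiv in T3; unfold Rdiv in T4; unfold Rdiv; lra.
    * unfold Rdiv in P |- *; rewrite Rmult_plus_distr_r; lra.
- assert (hmn : INR n <= INR m) by (apply le_INR; lia).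
  rewrite Rabs_left1 by lra.
  set (k := INR m - INR n); replace (INR n - INR m) with (- k) by (unfold k; ring).
  rewrite Ropp_involutive; assert (hk : 0 <= k) by (unfold k; lra).
  replace (ver (windowed d M (- sigma - 1) (- k)) (d / 2 / INR n) (- d) d - 0 * hankel_const d sigma)%C
    with (ver (windowed d M (- sigma - 1) (- k)) (d / 2 / INR n) (- d) d) by ring.
  assert (pk1 : 0 < (1 + k) ^ (A + 2)) by (apply pow_lt; lra).
  eapply Rle_trans.
  + apply H2; [exact hk|]; split; [exact hc|].
    apply (Rmult_le_reg_r (INR n)); [lra|].
    replace (d / 2 / INR n * INR n) with (d / 2) by (field; lra); nra.
  + assert (T : / (1 + k) ^ M <= / (1 + k) ^ (A + 2))
      by (apply Rinv_le_contravar; [exact pk1 | apply Rle_pow; [lra | exact hAM]]).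
    assert (0 < / (1 + k) ^ (A + 2)) by (apply Rinv_0_lt_compat, pk1).
    unfold Rdiv; rewrite Rmult_plus_distr_r.
    assert (K2 * / (1 + k) ^ M <= K2 * / (1 + k) ^ (A + 2)) by (apply Rmult_le_compat_l; lra).
    assert (0 < 2 * K1 * 2 ^ (A + 2) * / (1 + k) ^ (A + 2)) by (apply Rmult_lt_0_compat; assumption).
    lra.
Qed.

Lemma Rsum_truncate (f : nat -> R) n N : (n <= N)%nat ->
  Rsum (fun m => if lt_dec m n then f m else 0) N = Rsum f n.
Proof.
intros h; induction N as [|N IH].
- replace n with 0%nat by lia; reflexivity.
- simpl; destruct (lt_dec N n) as [h'|h'].
  + replace n with (S N) by lia; simpl; f_equal.
    clear; assert (P : forall k, (k <= N)%nat ->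
      Rsum (fun m => if lt_dec m (S N) then f m else 0) k = Rsum f k).
    { induction k as [|k IH]; intros hk; [reflexivity|]; simpl; rewrite IH by lia.
      destruct (lt_dec k (S N)); [reflexivity | lia]. }
    apply P; lia.
  + rewrite IH by lia; ring.
Qed.

(* Multiplying the generating function by the windowed kernel and integrating over
   [Re z = c] produces the convolution of the weights with the windowed moments. *)
Lemma weighted_contour omega W C0 a d M mu n c : 0 < d -> 0 < c <= d -> 0 < C0 ->
  generating_function omega W ->
  (forall m, Rabs (omega m) <= C0 * Rpower (INR m + 1) a) ->
  (forall y, - d <= y <= d -> Cdiff (fun z => W (Cexp (- z))) (c, y)) ->
  exists K q, 0 < q < 1 /\ forall N,
  Cmod (ver (fun z => W (Cexp (- z)) * windowed d M mu (INR n) z)%C c (- d) d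
        - Csum (fun m => omega m * ver (windowed d M mu (INR n - INR m)) c (- d) d)%C N) <= K * q ^ N.
Proof.
intros hd hc hC [PS _] Ho DW.
destruct (stable_geometric C0 a omega c ltac:(lra) hC Ho) as [K1 [hK1 H1]].
destruct (window_bounds d M hd) as [K2 [hK2 H2]].
set (q := exp (- (c / 2))).
assert (hq : 0 < q < 1).
{ unfold q; split; [apply exp_pos|]; rewrite <- exp_0; apply exp_increasing; lra. }
set (Q := Rpower c mu + Rpower (2 * d) mu).
assert (hQ : 0 < Q) by (unfold Q; pose proof (Rpower_pos c mu); pose proof (Rpower_pos (2 * d) mu); lra).
set (E := exp (INR n * c)); assert (hE : 0 < E) by apply exp_pos.
exists (2 * d * (K1 / (1 - q) * (Q * E * K2))), q; split; [exact hq|]; intros N.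
set (g := windowed d M mu (INR n)).
assert (Dg : forall k y, Cdiff (windowed d M mu k) (c, y)) by (intros; apply Cdiff_windowed, cut_plane_Re; lra).
assert (Bg : forall y, - d <= y <= d -> Cmod (g (c, y)) <= Q * E * K2).
{ intros y hy; unfold g, windowed; rewrite Cmod_mult, Cmod_hankel_kernel; fold E.
  assert (hy' : Rabs y <= d) by (apply Rabs_le; lra).
  apply Rmult_le_compat; [| apply Cmod_ge_0 | | apply H2; [rewrite Rabs_pos_eq; lra | exact hy']].
  - apply Rmult_le_pos; [left; apply Rpower_pos | lra].
  - apply Rmult_le_compat_r; [lra|]; apply Rpower_le_ends; [lra|]; split.
    + rewrite <- (Rabs_pos_eq c) at 1 by lra; apply (abs_Re_le (c, y)).
    + eapply Rle_trans; [apply Cmod_le_abs|]; simpl; rewrite (Rabs_pos_eq c); lra. }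
(* [e^(-m z) e^(n z) = e^((n - m) z)]: the weight of index [m] meets the moment of order [n - m]. *)
assert (Shift : forall m z, (Ci * (omega m * (Cexp (- z) ^ m * g z)))%C
   = (omega m * (Ci * windowed d M mu (INR n - INR m) z))%C).
{ intros m z; unfold g, windowed, hankel_kernel; rewrite Cpow_Cexp.
  replace (Cexp ((INR n - INR m)%R * z)) with (Cexp (INR m * - z) * Cexp (INR n * z))%C; [ring|].
  rewrite <- Cexp_plus; f_equal; rewrite RtoC_minus; ring. }
assert (X : forall m, ex_CInt (fun y => Ci * windowed d M mu (INR n - INR m) (c, y))%C (- d) d).
{ intros m; apply ex_CInt_scal, ex_CInt_v; [lra | intros; apply Dg]. }
assert (X' : ex_CInt (fun y => Ci * (W (Cexp (- (c, y))) * g (c, y)))%C (- d) d).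
{ apply ex_CInt_scal, (ex_CInt_v (fun z => W (Cexp (- z)) * g z)%C); [lra|].
  intros y hy; apply Cdiff_mult; [apply DW, hy | apply Dg]. }
assert (Eq : Csum (fun m => omega m * ver (windowed d M mu (INR n - INR m)) c (- d) d)%C N
  = CInt (fun y => Csum (fun m => omega m * (Ci * windowed d M mu (INR n - INR m) (c, y)))%C N) (- d) d).
{ rewrite CInt_Csum by (intros; apply ex_CInt_scal, X).
  apply Csum_ext; intros m _; symmetry; exact (CInt_scal (omega m) _ _ _ (X m)). }
rewrite Eq; unfold ver.
rewrite <- CInt_minus; [|exact X' | apply ex_CInt_Csum; intros; apply ex_CInt_scal, X].
replace (2 * d * (K1 / (1 - q) * (Q * E * K2)) * q ^ N)
  with ((d - - d) * (K1 * q ^ N / (1 - q) * (Q * E * K2))) by (field; lra).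
apply Cmod_CInt_le_const; [lra | apply ex_CInt_minus; [exact X' | apply ex_CInt_Csum; intros; apply ex_CInt_scal, X] |].
intros y hy; set (z := (c, y)).
rewrite (Csum_ext _ (fun m => (Ci * g z) * (omega m * Cexp (- z) ^ m))%C).
2:{ intros m _; rewrite <- Shift; ring. }
rewrite <- Csum_scal.
fold g; replace (Ci * (W (Cexp (- z)) * g z) - Ci * g z * Csum (fun m => omega m * Cexp (- z) ^ m)%C N)%C
  with (Ci * ((W (Cexp (- z)) - Csum (fun m => omega m * Cexp (- z) ^ m)%C N) * g z))%C by ring.
rewrite !Cmod_mult, Cmod_Ci, Rmult_1_l.
(* The modulus of [e^(-z)] is constant on the segment and less than 1, so one geometric tail bound
   serves all of it. *)
assert (hm : Cmod (Cexp (- z)) = exp (- c)) by (rewrite Cmod_Cexp; reflexivity).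
apply Rmult_le_compat; [apply Cmod_ge_0 | apply Cmod_ge_0 | | apply Bg, hy].
apply power_series_tail; [exact hq | | intros k; rewrite hm; apply H1].
apply PS; rewrite hm, <- exp_0; apply exp_increasing; lra.
Qed.

Lemma Rpower_INR_le x s (n : nat) : 1 <= x -> s <= INR n -> Rpower x s <= x ^ n.
Proof. intros hx hs; rewrite <- Rpower_pow by lra; apply Rle_Rpower; lra. Qed.

(** The integral [I] is evaluated twice, by series and by local expansion. Keeping [inv_gamma] as a
    factor on both sides avoids dividing by [inv_gamma d (sigma - alpha)], which may vanish. *)
Lemma weighted_power_sum omega W alpha p sigma : 0 < sigma ->
  generating_function omega W -> stable alpha omega -> consistent alpha p W ->
  exists d C, 0 < d <= 1 / 40 /\ 0 < C /\ forall n, (1 <= n)%nat ->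
  Rabs (inv_gamma d sigma * Rsum (fun m => omega m * Rpower (INR n - INR m) sigma) n
        - inv_gamma d (sigma - alpha) * Rpower (INR n) (sigma - alpha))
  <= C * (Rpower (INR n) (- alpha - 1) + Rpower (INR n) (sigma - alpha - INR p)).
Proof.
intros hsig GF St Co.
destruct (stable_bound alpha omega St) as [C0 [hC0 Ho]].
destruct (local_expansion omega W alpha p GF Co) as (d & K & hd & hK & Loc).
set (a := - alpha - 1) in *.
destruct (INR_archimed 1 (Rabs a)) as [A hA]; [lra|].
destruct (INR_archimed 1 sigma) as [S hS]; [lra|].
assert (hA' : Rabs a <= INR A) by lra; assert (hS' : sigma <= INR S) by lra.
(* [S] compensates [k^sigma] in the moment errors, [A + 2] pays for Peetre's inequality and the
   summation, and [p] pushes the windowing error of the main term below [k^(sigma - alpha - p)]. *)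
set (M := (S + (A + 2) + p)%nat).
assert (hM : forall k, 1 <= k -> Rpower k sigma * k ^ (A + 2) <= k ^ M).
{ intros k hk; unfold M; rewrite !pow_add, <- pow_add.
  assert (p1 : 1 <= k ^ p) by (apply pow_R1_Rle, hk).
  assert (p2 : 0 < k ^ (A + 2)) by (apply pow_lt; lra).
  assert (p3 : Rpower k sigma <= k ^ S) by (apply Rpower_INR_le; assumption).
  assert (p4 : 0 < Rpower k sigma) by apply Rpower_pos.
  assert (p5 : Rpower k sigma * k ^ (A + 2) <= k ^ S * k ^ (A + 2)) by (apply Rmult_le_compat_r; lra).
  assert (0 < k ^ S * k ^ (A + 2)) by nra; nra. }
destruct (windowed_moment d sigma A M ltac:(lra) hM ltac:(unfold M; lia)) as [K1 [hK1 H1]].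
destruct (windowed_moment_pos d (sigma - alpha) M ltac:(lra)) as [K2 [hK2 H2]].
destruct (window_to_hankel d M ltac:(lra)) as [K3 [hK3 H3]].
set (mu := alpha + INR p + (- sigma - 1)).
destruct (hankel_le (d / 2) mu ltac:(lra)) as [K4 [hK4 H4]].
destruct (window_bounds d M ltac:(lra)) as [K5 [hK5 H5]].
set (Q := Rpower d mu + Rpower (2 * d) mu).
assert (hQ : 0 < Q) by (unfold Q; pose proof (Rpower_pos d mu); pose proof (Rpower_pos (2 * d) mu); lra).
set (L := Rpower 1 a + Rpower 2 a).
assert (hL : 0 < L) by (unfold L; pose proof (Rpower_pos 1 a); pose proof (Rpower_pos 2 a); lra).
set (C1 := 3 * C0 * K1 * L + 2 * K2 + K3 * (K * Q) + K4 * (K * K5)).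
assert (hKQ : 0 <= K3 * (K * Q)) by (apply Rmult_le_pos; [lra | apply Rmult_le_pos; lra]).
assert (hKK : 0 <= K4 * (K * K5)) by (apply Rmult_le_pos; [lra | apply Rmult_le_pos; lra]).
assert (hCL : 0 < 3 * C0 * K1 * L) by (repeat apply Rmult_lt_0_compat; lra).
assert (hpi := PI_RGT_0); pose proof PI2_3_2 as hpi2.
exists d, C1; split; [exact hd|]; split; [unfold C1; lra|]; intros n hn.
assert (hk : 1 <= INR n) by (apply (le_INR 1); exact hn).
set (c := d / 2 / INR n).
assert (hc : 0 < c) by (apply Rdiv_lt_0_compat; lra).
assert (hc2 : c <= d / 2).
{ apply (Rmult_le_reg_r (INR n)); [lra|]; unfold c.
  replace (d / 2 / INR n * INR n) with (d / 2) by (field; lra); nra. }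
set (k := INR n) in *.
set (g := windowed d M (- sigma - 1) k).
set (I := ver (fun z => W (Cexp (- z)) * g z)%C c (- d) d).
set (Sn := Rsum (fun m => omega m * Rpower (k - INR m) sigma) n).
set (X := Rpower k a + Rpower k (sigma - alpha - INR p)).
assert (hX1 := Rpower_pos k a); assert (hX2 := Rpower_pos k (sigma - alpha - INR p)).
assert (pM : 0 < k ^ M) by (apply pow_lt; lra).
assert (Y1 : / k ^ M <= Rpower k a).
{ rewrite <- Rpower_pow, <- Rpower_Ropp by lra; apply Rle_Rpower; [exact hk|].
  unfold M; rewrite !plus_INR; pose proof (Rle_abs (- a)); rewrite Rabs_Ropp in *.
  pose proof (pos_INR S); pose proof (pos_INR p); simpl INR; lra. }
assert (Y2 : Rpower k (sigma - alpha) / k ^ M <= Rpower k (sigma - alpha - INR p)).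
{ unfold Rdiv; rewrite <- (Rpower_pow M), <- Rpower_Ropp, <- Rpower_plus by lra; apply Rle_Rpower; [exact hk|].
  unfold M; rewrite !plus_INR; pose proof (pos_INR S); pose proof (pos_INR A); simpl INR; lra. }
assert (DW : forall y, - d <= y <= d -> Cdiff (fun z => W (Cexp (- z))) (c, y)).
{ intros y hy; apply Loc; [rewrite Rabs_pos_eq; lra | apply Rabs_le; lra | apply cut_plane_Re, hc]. }
assert (P1 : Cmod (I - Sn * hankel_const d sigma) <= 3 * C0 * K1 * L * Rpower k a).
{ destruct (weighted_contour omega W C0 a d M (- sigma - 1) n c ltac:(lra) ltac:(lra) hC0 GF Ho DW)
    as (K6 & q & hq & H6).
  (* Terms with [m >= n] are compared with truncated powers equal to 0, so any number [N >= n] of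
     them may be included; letting [N] grow then removes the tail [q^N]. *)
  assert (B : forall N, (n <= N)%nat ->
    Cmod (I - Sn * hankel_const d sigma) <= K6 * q ^ N + 3 * C0 * K1 * Rpower (k + 1) a).
  { intros N hN; specialize (H6 N); fold k g in H6; fold I in H6.
    set (V := fun m => ver (windowed d M (- sigma - 1) (k - INR m)) c (- d) d) in *.
    set (y := fun m => if lt_dec m n then Rpower (k - INR m) sigma else 0).
    assert (E : (Sn * hankel_const d sigma)%C = Csum (fun m => omega m * (y m * hankel_const d sigma))%C N).
    { rewrite (Csum_ext _ (fun m => hankel_const d sigma * RtoC (if lt_dec m n then omega m * Rpower (k - INR m) sigma else 0))%C).
      - rewrite <- Csum_scal, Csum_RtoC, (Rsum_truncate _ n N hN); unfold Sn; ring.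
      - intros m _; unfold y; destruct (lt_dec m n); rewrite ?RtoC_mult; ring. }
    replace (I - Sn * hankel_const d sigma)%C with
      ((I - Csum (fun m => omega m * V m)%C N)
       + (Csum (fun m => omega m * V m)%C N - Csum (fun m => omega m * (y m * hankel_const d sigma))%C N))%C
      by (rewrite <- E; ring).
    eapply Rle_trans; [apply Cmod_triangle|]; apply Rplus_le_compat; [exact H6|].
    rewrite Csum_minus, (Csum_ext _ (fun m => omega m * (V m - y m * hankel_const d sigma))%C) by (intros; ring).
    apply (convolution_decay omega _ C0 K1 a A n N hA'); try lra; [exact Ho|].
    intros m; apply (H1 n hn m). }
  assert (B2 : Cmod (I - Sn * hankel_const d sigma) <= 3 * C0 * K1 * Rpower (k + 1) a).
  { refine (is_lim_seq_le_loc (fun _ => Cmod (I - Sn * hankel_const d sigma))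
      (fun N => K6 * q ^ N + 3 * C0 * K1 * Rpower (k + 1) a) (Finite _) (Finite _) _ (is_lim_seq_const _) _).
    - exists n; exact B.
    - replace (Finite (3 * C0 * K1 * Rpower (k + 1) a))
        with (Finite (K6 * 0 + 3 * C0 * K1 * Rpower (k + 1) a)) by (f_equal; ring).
      apply is_lim_seq_plus'; [|apply is_lim_seq_const].
      apply (is_lim_seq_scal_l _ K6 0), is_lim_seq_geom; rewrite Rabs_pos_eq; lra. }
  eapply Rle_trans; [exact B2|].
  rewrite (Rmult_assoc (3 * C0 * K1)); apply Rmult_le_compat_l.
  - left; repeat apply Rmult_lt_0_compat; lra.
  (* The quotient [(k + 1) / k] lies in [[1, 2]]; its power is bounded by [L]. *)
  - replace (k + 1) with ((1 + / k) * k) by (field; lra).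
    assert (hi : 0 < / k) by (apply Rinv_0_lt_compat; lra).
    assert (hi1 : / k <= 1) by (rewrite <- Rinv_1; apply Rinv_le_contravar; lra).
    rewrite <- Rpower_mult_distr by lra; apply Rmult_le_compat_r; [lra|].
    apply Rpower_le_ends; lra. }
set (h := d / 2 / k) in *.
(* The deviation of [W (e^(-z))] from [z^alpha], inside the windowed integrand. Consistency gives it
   the exponent [mu], larger by [p] than that of the main term. *)
set (f1 := fun z => ((W (Cexp (- z)) - Cpowr z alpha) * g z)%C).
assert (Dg : forall x y, cut_plane (x, y) -> Cdiff g (x, y)) by (intros; apply Cdiff_windowed; assumption).
assert (Dpow : forall x y, cut_plane (x, y) -> Cdiff (fun z => Cpowr z alpha) (x, y)).
{ intros x y hz; apply (Cdiff_Cpowr (fun z => z)); [exact hz | apply Cdiff_id]. }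
assert (Df1 : Cdiff_on_box f1 d).
{ intros x y hx hy hz; apply Cdiff_mult; [|apply Dg, hz]; apply Cdiff_minus; [apply Loc; assumption | apply Dpow, hz]. }
assert (Bf1 : forall x y, Rabs x <= d -> Rabs y <= d -> cut_plane (x, y) ->
  Cmod (f1 (x, y)) <= K * (Rpower (Cmod (x, y)) mu * exp (k * x)) * Cmod (window d M (x, y))).
{ intros x y hx hy hz; destruct (cut_plane_pos _ hz) as [hr _].
  destruct (Loc x y hx hy hz) as [_ B].
  set (z := (x, y)) in *; unfold f1, g, windowed.
  assert (E : (W (Cexp (- z)) - Cpowr z alpha
    = Cpowr z alpha * (Cpowr z (- alpha) * W (Cexp (- z)) - 1))%C).
  { assert (e : (Cpowr z alpha * Cpowr z (- alpha))%C = 1%C)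
      by (rewrite <- Cpowr_plus, Rplus_opp_r; apply Cpowr_0).
    transitivity ((Cpowr z alpha * Cpowr z (- alpha)) * W (Cexp (- z)) - Cpowr z alpha)%C;
      [rewrite e |]; ring. }
  pose proof (Cmod_hankel_kernel (- sigma - 1) k x y) as HK; fold z in HK.
  rewrite E, !Cmod_mult, Cmod_Cpowr, HK.
  unfold mu; rewrite !Rpower_plus, Rpower_pow by exact hr.
  set (u := Rpower (Cmod z) alpha); set (v := Rpower (Cmod z) (- sigma - 1)).
  assert (hu : 0 < u) by apply Rpower_pos; assert (hv : 0 < v) by apply Rpower_pos.
  pose proof (exp_pos (k * x)); pose proof (Cmod_ge_0 (window d M z)).
  apply Rle_trans with (u * (K * Cmod z ^ p) * (v * exp (k * x) * Cmod (window d M z))).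
  - apply Rmult_le_compat_r; [repeat apply Rmult_le_pos; lra|]; apply Rmult_le_compat_l; lra.
  - right; ring. }
(* The segment is traded once more for a Hankel contour; this time only the size of the integral is
   wanted, not its value. *)
assert (P2 : Cmod (ver f1 c (- d) d) <= K3 * (K * Q) / k ^ M + K4 * (K * K5) * Rpower k (sigma - alpha - INR p)).
{ replace (ver f1 c (- d) d) with ((ver f1 c (- d) d - hankel f1 d h) + hankel f1 d h)%C by ring.
  eapply Rle_trans; [apply Cmod_triangle|]; apply Rplus_le_compat.
  - apply (H3 f1 k c (K * Q) hk (conj hc (Rle_refl _)) ltac:(apply Rmult_le_pos; lra) Df1).
    intros x y hx hy hz hr; eapply Rle_trans; [apply Bf1; assumption|].
    replace (K * (Rpower (Cmod (x, y)) mu * exp (k * x)) * Cmod (window d M (x, y)))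
      with (K * Rpower (Cmod (x, y)) mu * (Cmod (window d M (x, y)) * exp (k * x))) by ring.
    apply Rmult_le_compat_r; [apply Rmult_le_pos; [apply Cmod_ge_0 | left; apply exp_pos]|].
    apply Rmult_le_compat_l; [exact hK|]; apply Rpower_le_ends; [lra|]; split; [exact hr|].
    eapply Rle_trans; [apply Cmod_le_abs|]; simpl; lra.
  - replace (sigma - alpha - INR p) with (- mu - 1) by (unfold mu; ring).
    assert (Bx : forall x y, - d <= x <= d / 2 / k -> Rabs y <= d / 2 / k ->
      (x = d / 2 / k \/ Rabs y = d / 2 / k) -> Rabs x <= d /\ Rabs y <= d /\ cut_plane (x, y)).
    { intros x y hx hy hxy; fold h in hx, hy, hxy; unfold c in hc, hc2.
      repeat split; [apply Rabs_le; lra | lra |].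
      destruct hxy as [->|e]; [apply cut_plane_Re, hc | apply cut_plane_Im].
      intros e'; rewrite e', Rabs_R0 in e; lra. }
    apply (H4 f1 k (K * K5) d); [lra | apply Rmult_le_pos; lra | lra | |].
    + intros x y hx hy hxy; destruct (Bx x y hx hy hxy) as (b1 & b2 & b3); apply Df1; assumption.
    + intros x y hx hy hxy; destruct (Bx x y hx hy hxy) as (b1 & b2 & b3).
      eapply Rle_trans; [apply Bf1; assumption|].
      destruct (H5 x y b1 b2) as [w _].
      assert (0 <= Rpower (Cmod (x, y)) mu * exp (k * x))
        by (apply Rmult_le_pos; left; [apply Rpower_pos | apply exp_pos]).
      replace (K * K5 * (Rpower (Cmod (x, y)) mu * exp (k * x)))
        with (K * (Rpower (Cmod (x, y)) mu * exp (k * x)) * K5) by ring.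
      apply Rmult_le_compat_l; [apply Rmult_le_pos; lra | exact w]. }
specialize (H2 n c hn (conj hc (Rle_refl _))); fold k in H2.
set (g2 := windowed d M (- (sigma - alpha) - 1) k) in *.
assert (E2 : I = (ver f1 c (- d) d + ver g2 c (- d) d)%C).
{ assert (X1 : ex_CInt (fun y => Ci * f1 (c, y))%C (- d) d).
  { apply ex_CInt_scal, ex_CInt_v; [lra|]; intros y hy; apply Df1;
      [rewrite Rabs_pos_eq; lra | apply Rabs_le; lra | apply cut_plane_Re, hc]. }
  assert (X2 : ex_CInt (fun y => Ci * g2 (c, y))%C (- d) d).
  { apply ex_CInt_scal, ex_CInt_v; [lra|]; intros y hy; apply Cdiff_windowed, cut_plane_Re, hc. }
  unfold I, ver; rewrite <- CInt_plus by assumption.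
  apply CInt_ext; [lra|]; intros y _; unfold f1, g2, g, windowed, hankel_kernel.
  replace (- (sigma - alpha) - 1) with (alpha + (- sigma - 1)) by ring; rewrite Cpowr_plus; ring. }
rewrite E2 in P1.
set (s := sigma - alpha) in *.
set (D := inv_gamma d sigma * Sn - inv_gamma d s * Rpower k s).
rewrite !hankel_const_inv_gamma in P1, H2 by exact hd.
(* The integral cancels between the two evaluations, and only their errors remain. *)
assert (E3 : (2 * PI * Ci * D)%C = 
  (- (ver f1 c (- d) d + ver g2 c (- d) d - Sn * (2 * PI * Ci * inv_gamma d sigma))
   + (ver f1 c (- d) d + (ver g2 c (- d) d - Rpower k s * (2 * PI * Ci * inv_gamma d s))))%C).
{ unfold D; rewrite RtoC_minus, !RtoC_mult; ring. }
assert (E4 : Cmod (2 * PI * Ci * D) = 2 * PI * Rabs D).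
{ rewrite !Cmod_mult, !Cmod_R, Cmod_Ci, !Rabs_pos_eq by lra; ring. }
assert (Fin : 2 * PI * Rabs D <= C1 * X).
{ rewrite <- E4, E3; eapply Rle_trans; [apply Cmod_triangle|]; rewrite Cmod_opp.
  eapply Rle_trans; [apply Rplus_le_compat_l, Cmod_triangle|].
  assert (Z1 : K2 * (1 + Rpower k s) / k ^ M <= K2 * X).
  { replace (K2 * (1 + Rpower k s) / k ^ M) with (K2 * (/ k ^ M + Rpower k s / k ^ M)) by (field; lra).
    apply Rmult_le_compat_l; unfold X; lra. }
  assert (Z2 : K3 * (K * Q) / k ^ M <= K3 * (K * Q) * Rpower k a)
    by (apply Rmult_le_compat_l; assumption).
  unfold C1; unfold X in *.
  assert (0 <= K3 * (K * Q) * Rpower k (s - INR p)) by (apply Rmult_le_pos; lra).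
  assert (0 <= K4 * (K * K5) * Rpower k a) by (apply Rmult_le_pos; lra).
  assert (0 <= 3 * C0 * K1 * L * Rpower k (s - INR p)) by (apply Rmult_le_pos; lra).
  assert (0 <= K2 * (Rpower k a + Rpower k (s - INR p))) by (apply Rmult_le_pos; lra).
  lra. }
pose proof (Rabs_pos D).
assert (Rabs D <= 2 * PI * Rabs D) by nra; lra.
Qed.

(** * Beta and Gamma integrals *)

Lemma powr_pos x e : 0 < x -> powr x e = Rpower x e.
Proof. intros h; unfold powr; destruct (Rlt_dec 0 x); [reflexivity | lra]. Qed.

Lemma powr_npos x e : x <= 0 -> powr x e = 0.
Proof. intros h; unfold powr; destruct (Rlt_dec 0 x); [lra | reflexivity]. Qed.

Lemma powr_ge_0 x e : 0 <= powr x e.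
Proof. unfold powr; destruct (Rlt_dec 0 x); [left; apply Rpower_pos | lra]. Qed.

Lemma locally_gt a x : a < x -> locally x (fun y => a < y).
Proof. intros h; apply (locally_interval _ x a p_infty h I); intros; assumption. Qed.

Lemma locally_lt a x : x < a -> locally x (fun y => y < a).
Proof. intros h; apply (locally_interval _ x m_infty a I h); intros; assumption. Qed.

Lemma is_derive_powr x e : 0 < x -> is_derive (fun x => powr x e) x (e * Rpower x (e - 1)).
Proof.
intros hx; apply (is_derive_ext_loc (fun x => exp (e * ln x))).
- apply (filter_imp (fun y => 0 < y)); [|apply locally_gt, hx].
  intros y hy; rewrite powr_pos by exact hy; reflexivity.
- auto_derive; [exact hx|].
  unfold Rminus; rewrite Rpower_plus, Rpower_Ropp, Rpower_1 by exact hx; unfold Rpower; field; lra.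
Qed.

Lemma continuous_powr e x : 0 < e -> continuous (fun x => powr x e) x.
Proof.
intros he; destruct (Rtotal_order x 0) as [h|[h|h]].
- apply (continuous_ext_loc _ (fun _ => 0)); [|apply continuous_const].
  apply (filter_imp (fun y => y < 0)); [|apply locally_lt, h].
  intros y hy; rewrite powr_npos by lra; reflexivity.
- subst x; apply filterlim_locally; intros [eps heps].
  exists (mkposreal (Rpower eps (/ e)) (Rpower_pos _ _)); intros y hy.
  change (Rabs (y - 0) < Rpower eps (/ e)) in hy; rewrite Rminus_0_r in hy.
  change (Rabs (powr y e - powr 0 e) < eps); rewrite (powr_npos 0) by lra.
  rewrite Rminus_0_r, Rabs_pos_eq by apply powr_ge_0.
  destruct (Rle_dec y 0) as [h|h]; [rewrite powr_npos; assumption|].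
  rewrite powr_pos by lra; rewrite Rabs_pos_eq in hy by lra.
  apply Rlt_le_trans with (Rpower (Rpower eps (/ e)) e).
  + apply Rlt_Rpower_l; lra.
  + rewrite Rpower_mult, Rinv_l, Rpower_1 by lra; lra.
- apply (ex_derive_continuous (V := R_NormedModule)).
  eexists; apply is_derive_powr, h.
Qed.

(** The fundamental theorem of calculus with limits of a primitive at both ends; the Gamma and
    Hadamard integrals are computed through it. *)
Lemma is_RInt_gen_primitive (Fa Fb : (R -> Prop) -> Prop) {FFa : Filter Fa} {FFb : Filter Fb}
  (F f : R -> R) la lb :
  filter_prod Fa Fb (fun ab => forall x, Rmin (fst ab) (snd ab) <= x <= Rmax (fst ab) (snd ab) ->
    is_derive F x (f x) /\ continuous f x) ->
  filterlim F Fa (locally la) -> filterlim F Fb (locally lb) ->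
  is_RInt_gen f Fa Fb (lb - la).
Proof.
intros H Ha Hb P HP.
assert (L : filterlim (fun ab => F (snd ab) - F (fst ab)) (filter_prod Fa Fb) (locally (lb - la))).
{ apply (filterlim_comp_2 (G := locally lb) (H := locally (- la))
    (fun ab => F (snd ab)) (fun ab => - F (fst ab)) Rplus).
  - apply (filterlim_comp _ _ _ snd F _ Fb); [apply filterlim_snd | exact Hb].
  - apply (filterlim_comp _ _ _ (fun ab => F (fst ab)) Ropp _ (locally la)).
    + apply (filterlim_comp _ _ _ fst F _ Fa); [apply filterlim_fst | exact Ha].
    + apply (filterlim_opp (K := R_AbsRing) (V := R_NormedModule)).
  - apply (filterlim_plus (K := R_AbsRing) (V := R_NormedModule)). }
specialize (L P HP); unfold filtermap in L; unfold filtermapi.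
generalize (filter_and _ _ H L); apply filter_imp; intros [a b] [h1 h2]; simpl in *.
exists (F b - F a); split; [|exact h2].
apply (is_RInt_derive (V := R_CompleteNormedModule) F f); intros x hx; apply h1, hx.
Qed.

(** Differentiability is asked only inside, because the powers involved can fail to be
    differentiable at an end. With [G] the integral function of [f], the difference [F - G] is
    constant by the mean value theorem. *)
Lemma RInt_primitive_open (F f : R -> R) a b : a < b ->
  (forall x, continuous f x) -> (forall x, a <= x <= b -> continuous F x) ->
  (forall x, a < x < b -> is_derive F x (f x)) -> RInt f a b = F b - F a.
Proof.
intros hab Cf CF D.
set (G := fun x => RInt f a x).
assert (DG : forall x, is_derive G x (f x)).
{ intros x; apply (is_derive_RInt f G a x); [|apply Cf].
  apply filter_forall; intros y; apply (RInt_correct (V := R_CompleteNormedModule)), (ex_RInt_continuous (V := R_CompleteNormedModule)); intros; apply Cf. }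
destruct (MVT_gen (fun x => F x - G x) a b (fun _ => 0)) as [c [_ hc]].
- rewrite Rmin_left, Rmax_right by lra; intros x hx.
  replace 0 with (f x - f x) by ring; apply (is_derive_minus F G); [apply D, hx | apply DG].
- rewrite Rmin_left, Rmax_right by lra; intros x hx.
  apply continuity_pt_filterlim.
  apply (continuous_minus (V := R_NormedModule) F G); [apply CF, hx|].
  apply (ex_derive_continuous (V := R_NormedModule)); eexists; apply DG.
- assert (G a = 0) by exact (RInt_point (V := R_CompleteNormedModule) a f).
  change (RInt f a b) with (G b); lra.
Qed.

(* After the substitution [v = z ^ (1/b)] the beta integral becomes proper:
   [int_0^1 v ^ (b - 1) (1 - v) ^ s dv = beta_int b s / b]. *)
Definition beta_kernel (b s z : R) : R := powr (1 - powr z (/ b)) s.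
Definition beta_int (b s : R) : R := RInt (beta_kernel b s) 0 1.

Lemma continuous_beta_kernel b s z : 0 < b -> 0 < s -> continuous (beta_kernel b s) z.
Proof.
intros hb hs; unfold beta_kernel.
apply (continuous_comp (fun z => 1 - powr z (/ b)) (fun x => powr x s)); [|apply continuous_powr, hs].
apply (continuous_minus (V := R_NormedModule) (fun _ => 1)); [apply continuous_const|].
apply continuous_powr, Rinv_0_lt_compat, hb.
Qed.

Lemma ex_RInt_beta b s x y : 0 < b -> 0 < s -> ex_RInt (beta_kernel b s) x y.
Proof. intros hb hs; apply (ex_RInt_continuous (V := R_CompleteNormedModule)); intros; apply continuous_beta_kernel; assumption. Qed.

Lemma powr_lt_1 z e : 0 < e -> z < 1 -> powr z e < 1.
Proof.
intros he hz; destruct (Rle_dec z 0) as [h|h]; [rewrite powr_npos; lra|].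
rewrite powr_pos by lra.
apply Rlt_le_trans with (Rpower 1 e); [apply Rlt_Rpower_l; lra|].
unfold Rpower; rewrite ln_1, Rmult_0_r, exp_0; lra.
Qed.

Lemma powr_1 e : powr 1 e = 1.
Proof. rewrite powr_pos by lra; unfold Rpower; rewrite ln_1, Rmult_0_r, exp_0; reflexivity. Qed.

Lemma beta_int_pos b s : 0 < b -> 0 < s -> 0 < beta_int b s.
Proof.
intros hb hs; apply RInt_gt_0; [lra | | intros; apply continuous_beta_kernel; assumption].
intros z hz; unfold beta_kernel; rewrite powr_pos; [apply Rpower_pos|].
pose proof (powr_lt_1 z (/ b) (Rinv_0_lt_compat _ hb) ltac:(lra)); lra.
Qed.

(** Integrate the derivative of [z (1 - z^(1/b))^(s + 1)], which vanishes at 0 and 1, after writing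
    [z^(1/b)] as [1 - (1 - z^(1/b))]. *)
Lemma beta_int_rec b s : 0 < b -> 0 < s ->
  (b + s + 1) * beta_int b (s + 1) = (s + 1) * beta_int b s.
Proof.
intros hb hs.
set (F := fun z => z * beta_kernel b (s + 1) z).
set (f := fun z => (1 + (s + 1) / b) * beta_kernel b (s + 1) z - (s + 1) / b * beta_kernel b s z).
assert (Cf : forall z, continuous f z).
{ intros z; apply (continuous_minus (V := R_NormedModule));
    apply (continuous_scal_r (V := R_NormedModule)), continuous_beta_kernel; lra. }
assert (E : RInt f 0 1 = F 1 - F 0).
{ apply RInt_primitive_open; [lra | exact Cf | |].
  - intros x _; apply (continuous_mult (K := R_AbsRing) (fun z => z)); [apply continuous_id|].
    apply continuous_beta_kernel; lra.
  - intros x hx.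
    assert (hib : 0 < / b) by (apply Rinv_0_lt_compat, hb).
    assert (hq : 0 < 1 - powr x (/ b)) by (pose proof (powr_lt_1 x (/ b) hib ltac:(lra)); lra).
    assert (D1 : is_derive (fun z => 1 - powr z (/ b)) x (0 - / b * Rpower x (/ b - 1))).
    { apply (is_derive_minus (V := R_NormedModule) (fun _ => 1)); [apply (is_derive_const (V := R_NormedModule)) | apply is_derive_powr; lra]. }
    pose proof (is_derive_comp (V := R_NormedModule) (fun y => powr y (s + 1)) _ x _ _
      (is_derive_powr _ (s + 1) hq) D1) as D2.
    pose proof (is_derive_mult (K := R_AbsRing) (fun z => z) _ x _ _ (is_derive_id x) D2 Rmult_comm) as D3.
    replace (f x) with (plus (mult (one : R_AbsRing) (powr (1 - powr x (/ b)) (s + 1)))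
      (mult (x : R_AbsRing) (scal (0 - / b * Rpower x (/ b - 1))
         ((s + 1) * Rpower (1 - powr x (/ b)) (s + 1 - 1))))); [exact D3|].
    unfold f, beta_kernel; unfold plus, mult, scal, one; simpl; unfold mult; simpl.
    replace (s + 1 - 1) with s by ring.
    rewrite !(powr_pos (1 - powr x (/ b))) by exact hq.
    assert (e1 : x * Rpower x (/ b - 1) = powr x (/ b)).
    { rewrite powr_pos by lra; replace x with (Rpower x 1) at 1 by (apply Rpower_1; lra).
      rewrite <- Rpower_plus; f_equal; ring. }
    assert (e2 : Rpower (1 - powr x (/ b)) (s + 1) = Rpower (1 - powr x (/ b)) s * (1 - powr x (/ b)))
      by (rewrite Rpower_plus, Rpower_1 by exact hq; reflexivity).
    replace (x * ((0 - / b * Rpower x (/ b - 1)) * ((s + 1) * Rpower (1 - powr x (/ b)) s)))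
      with (- (x * Rpower x (/ b - 1)) * ((s + 1) / b * Rpower (1 - powr x (/ b)) s)) by (field; lra).
    rewrite e1, e2; field; lra. }
unfold F in E; replace (beta_kernel b (s + 1) 1) with 0 in E.
2:{ unfold beta_kernel; rewrite powr_1, powr_npos; lra. }
unfold f in E.
rewrite (RInt_minus (V := R_CompleteNormedModule) (fun z => (1 + (s + 1) / b) * beta_kernel b (s + 1) z)
  (fun z => (s + 1) / b * beta_kernel b s z)) in E
  by (apply (ex_RInt_scal (V := R_NormedModule)), ex_RInt_beta; lra).
rewrite (RInt_scal (V := R_CompleteNormedModule) (beta_kernel b (s + 1))),
  (RInt_scal (V := R_CompleteNormedModule) (beta_kernel b s)) in E by (apply ex_RInt_beta; lra).
fold (beta_int b (s + 1)) (beta_int b s) in E.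
unfold minus, plus, opp, scal in E; simpl in E; unfold mult in E; simpl in E.
assert (E' : b * ((1 + (s + 1) / b) * beta_int b (s + 1) + - ((s + 1) / b * beta_int b s)) = 0)
  by (rewrite E; ring).
replace (b * ((1 + (s + 1) / b) * beta_int b (s + 1) + - ((s + 1) / b * beta_int b s)))
  with ((b + s + 1) * beta_int b (s + 1) - (s + 1) * beta_int b s) in E' by (field; lra).
lra.
Qed.

(** The recurrence iterated [n] times, its factors collected into binomial coefficients. The limit
    of this identity is Gauss' product. *)
Lemma beta_int_shift b s n : 0 < b -> 0 < s ->
  beta_int b s * binom_coef (s + 1) n = beta_int b (s + INR n) * binom_coef (s + b + 1) n.
Proof.
intros hb hs; induction n as [|n IH]; [simpl; rewrite Rplus_0_r; ring|].
change (binom_coef (s + 1) (S n)) with (binom_coef (s + 1) n * (INR n + (s + 1)) / INR (S n)).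
change (binom_coef (s + b + 1) (S n)) with (binom_coef (s + b + 1) n * (INR n + (s + b + 1)) / INR (S n)).
pose proof (pos_INR n) as hn.
pose proof (beta_int_rec b (s + INR n) hb ltac:(lra)) as R.
assert (hS : INR (S n) = INR n + 1) by apply S_INR.
rewrite hS; replace (s + (INR n + 1)) with (s + INR n + 1) by ring.
replace (beta_int b s * (binom_coef (s + 1) n * (INR n + (s + 1)) / (INR n + 1)))
  with ((beta_int b s * binom_coef (s + 1) n) * (s + INR n + 1) / (INR n + 1)) by (field; lra).
rewrite IH.
replace (beta_int b (s + INR n) * binom_coef (s + b + 1) n * (s + INR n + 1) / (INR n + 1))
  with (binom_coef (s + b + 1) n * ((s + INR n + 1) * beta_int b (s + INR n)) / (INR n + 1)) by (field; lra).
rewrite <- R; field; lra.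
Qed.

(** The substitution [z = s^b] turns [s^(b - 1) e^(-s) ds] into [exp (- z^(1/b)) dz / b], which is
    continuous at 0, so [gamma_int] is a proper integral. *)
Definition gamma_kernel (b z : R) : R := exp (- powr z (/ b)).
Definition gamma_int (b X : R) : R := RInt (gamma_kernel b) 0 X.

Lemma continuous_gamma_kernel b z : 0 < b -> continuous (gamma_kernel b) z.
Proof.
intros hb; apply (continuous_comp (fun z => - powr z (/ b)) exp).
- apply (continuous_opp (V := R_NormedModule)), continuous_powr, Rinv_0_lt_compat, hb.
- apply (ex_derive_continuous (V := R_NormedModule)); auto_derive; trivial.
Qed.

Lemma ex_RInt_gamma b x y : 0 < b -> ex_RInt (gamma_kernel b) x y.
Proof. intros hb; apply (ex_RInt_continuous (V := R_CompleteNormedModule)); intros; apply continuous_gamma_kernel, hb. Qed.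

Lemma is_derive_gamma_int b X : 0 < b -> is_derive (gamma_int b) X (gamma_kernel b X).
Proof.
intros hb; apply (is_derive_RInt (gamma_kernel b) (gamma_int b) 0 X); [|apply continuous_gamma_kernel, hb].
apply filter_forall; intros y; apply (RInt_correct (V := R_CompleteNormedModule)), ex_RInt_gamma, hb.
Qed.

Lemma gamma_int_mono b x y : 0 < b -> x <= y -> gamma_int b x <= gamma_int b y.
Proof.
intros hb h; unfold gamma_int.
rewrite <- (RInt_Chasles (gamma_kernel b) 0 x y) by (apply ex_RInt_gamma, hb).
assert (0 <= RInt (gamma_kernel b) x y).
{ apply RInt_ge_0; [exact h | apply ex_RInt_gamma, hb | intros; left; apply exp_pos]. }
unfold plus; simpl; lra.
Qed.

Lemma is_lim_seq_inj (u : nat -> R) (l1 l2 : R) : is_lim_seq u l1 -> is_lim_seq u l2 -> l1 = l2.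
Proof.
intros H1 H2; apply is_lim_seq_unique in H1; apply is_lim_seq_unique in H2.
apply (f_equal real) in H1; apply (f_equal real) in H2; simpl in H1, H2; congruence.
Qed.

(** With [v = u^(1/b)] one has [u^2 = v^(2 b) <= K e^(v / 2) <= K e^v], so beyond 1 the kernel is
    below [K / u^2]. *)
Lemma gamma_int_bounded b : 0 < b -> exists M, forall X, gamma_int b X <= M.
Proof.
intros hb; destruct (Rpower_le_exp 1 (2 * b) Rlt_0_1) as [K [hK HK]].
assert (hib : 0 < / b) by (apply Rinv_0_lt_compat, hb).
exists (gamma_int b 1 + K).
assert (P : forall X, 1 <= X -> gamma_int b X <= gamma_int b 1 + K).
{ intros X hX; unfold gamma_int at 1.
  rewrite <- (RInt_Chasles (gamma_kernel b) 0 1 X) by (apply ex_RInt_gamma, hb).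
  fold (gamma_int b 1); change (gamma_int b 1 + RInt (gamma_kernel b) 1 X <= gamma_int b 1 + K).
  apply Rplus_le_compat_l.
  assert (I : is_RInt (fun u => K * / u ^ 2) 1 X (K - K / X)).
  { replace (K - K / X) with ((- (K / X)) - (- (K / 1))) by (field; lra).
    apply (is_RInt_derive (V := R_CompleteNormedModule) (fun u => - (K / u)));
      rewrite Rmin_left, Rmax_right by exact hX; intros u hu.
    - auto_derive; [lra | field; lra].
    - apply (ex_derive_continuous (V := R_NormedModule)); auto_derive.
      apply Rgt_not_eq; nra. }
  apply Rle_trans with (K - K / X).
  - rewrite <- (is_RInt_unique _ _ _ _ I).
    apply RInt_le; [exact hX | apply ex_RInt_gamma, hb | eexists; exact I |].
    intros u hu; unfold gamma_kernel; rewrite powr_pos by lra.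
    set (v := Rpower u (/ b)).
    assert (hv : 1 <= v).
    { unfold v; apply Rle_trans with (Rpower u 0); [rewrite Rpower_O; lra | apply Rle_Rpower; lra]. }
    specialize (HK v hv).
    assert (e : Rpower v (2 * b) = u ^ 2).
    { unfold v; rewrite Rpower_mult.
      replace (/ b * (2 * b)) with (INR 2) by (simpl; field; lra); apply Rpower_pow; lra. }
    rewrite e in HK.
    assert (hu2 : 0 < u ^ 2) by (apply pow_lt; lra).
    assert (hev : exp (v / 2) <= exp v) by (apply exp_le_compat; lra).
    rewrite exp_Ropp; assert (he := exp_pos v).
    apply (Rmult_le_reg_r (u ^ 2 * exp v)); [apply Rmult_lt_0_compat; assumption|].
    replace (/ exp v * (u ^ 2 * exp v)) with (u ^ 2) by (field; lra).
    replace (K * / u ^ 2 * (u ^ 2 * exp v)) with (K * exp v) by (field; lra).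
    apply Rle_trans with (K * exp (v / 2)); [exact HK | apply Rmult_le_compat_l; lra].
  - assert (0 < K / X) by (apply Rdiv_lt_0_compat; lra); lra. }
intros X; destruct (Rle_dec 1 X) as [h|h]; [apply P, h|].
pose proof (gamma_int_mono b X 1 hb ltac:(lra)); lra.
Qed.

Lemma gamma_int_limit b : 0 < b -> exists L,
  (forall X, gamma_int b X <= L) /\
  (forall eps, 0 < eps -> exists T, 1 <= T /\ forall X, T <= X -> L - eps < gamma_int b X).
Proof.
intros hb; destruct (gamma_int_bounded b hb) as [M HM].
destruct (completeness (fun y => exists X, y = gamma_int b X)) as [L [HL1 HL2]].
- exists M; intros y [X ->]; apply HM.
- exists (gamma_int b 0), 0; reflexivity.
- exists L; split; [intros X; apply HL1; exists X; reflexivity|].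
  intros eps he; destruct (Classical_Prop.classic (exists T, L - eps < gamma_int b T)) as [[T hT]|h].
  + exists (Rmax 1 T); split; [apply Rmax_l|]; intros X hX.
    eapply Rlt_le_trans; [exact hT|]; apply gamma_int_mono; [exact hb|].
    pose proof (Rmax_r 1 T); lra.
  + exfalso; assert (L <= L - eps); [|lra].
    apply HL2; intros y [X ->]; destruct (Rle_dec (gamma_int b X) (L - eps)) as [a|a]; [exact a|].
    exfalso; apply h; exists X; lra.
Qed.

(** [gamma_int b (s^b) / b] is a primitive of the integrand for [s > 0]; its limits come from the
    continuity of [powr] at 0 and from the supremum [L]. *)
Lemma Gamma_gamma_int b L : 0 < b -> (forall X, gamma_int b X <= L) ->
  (forall eps, 0 < eps -> exists T, 1 <= T /\ forall X, T <= X -> L - eps < gamma_int b X) ->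
  Gamma b = L / b.
Proof.
intros hb H1 H2.
unfold Gamma; apply (is_RInt_gen_unique (V := R_CompleteNormedModule) (Fa := at_right 0) (Fb := Rbar_locally p_infty)).
set (F := fun s => gamma_int b (powr s b) / b).
replace (L / b) with (L / b - F 0).
2:{ unfold F; rewrite powr_npos by lra; unfold gamma_int.
    rewrite (RInt_point (V := R_CompleteNormedModule)); change (L / b - 0 / b = L / b); field; lra. }
apply (is_RInt_gen_primitive (at_right 0) (Rbar_locally p_infty) F).
- exists (fun x => 0 < x) (fun y => 0 < y).
  + exists (mkposreal 1 Rlt_0_1); intros y _ hy; exact hy.
  + exists 0; intros y hy; exact hy.
  + intros x y hx hy s hs; simpl in hs.
    assert (hs0 : 0 < s) by (pose proof (Rmin_glb_lt x y 0 hx hy); lra).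
    split.
    * assert (D := is_derive_comp (V := R_NormedModule) (gamma_int b) (fun s => powr s b) s _ _
        (is_derive_gamma_int b (powr s b) hb) (is_derive_powr s b hs0)).
      apply (is_derive_scal_l (V := R_NormedModule) _ s _ (/ b)) in D.
      unfold F; apply (is_derive_ext (fun s => scal (gamma_int b (powr s b)) (/ b))).
      { intros t; reflexivity. }
      replace (powr s (b - 1) * exp (- s)) with
        (scal (scal (b * Rpower s (b - 1)) (gamma_kernel b (powr s b))) (/ b)); [exact D|].
      unfold scal; simpl; unfold mult; simpl; unfold gamma_kernel.
      rewrite (powr_pos s b), (powr_pos s (b - 1)), (powr_pos (Rpower s b)) by (try apply Rpower_pos; exact hs0).
      rewrite Rpower_mult, Rinv_r, Rpower_1 by lra; field; lra.
    * apply (ex_derive_continuous (V := R_NormedModule)).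
      apply (ex_derive_mult (fun s => powr s (b - 1)) (fun s => exp (- s))).
      -- eexists; apply is_derive_powr, hs0.
      -- auto_derive; trivial.
- apply (filterlim_filter_le_1 (F := locally 0)); [apply filter_le_within|].
  apply (continuous_scal_l (V := R_NormedModule) (fun s => gamma_int b (powr s b)) (/ b) 0).
  apply (continuous_comp (fun s => powr s b) (gamma_int b)); [apply continuous_powr, hb|].
  apply (ex_derive_continuous (V := R_NormedModule)); eexists; apply is_derive_gamma_int, hb.
- apply filterlim_locally; intros [eps he].
  destruct (H2 (eps * b)) as [T [hT HT]]; [apply Rmult_lt_0_compat; assumption|].
  exists (Rpower T (/ b)); intros s hs.
  assert (hs0 : 0 < s) by (pose proof (Rpower_pos T (/ b)); lra).
  assert (hTs : T <= powr s b).
  { rewrite powr_pos by exact hs0; replace T with (Rpower (Rpower T (/ b)) b).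
    - apply Rle_Rpower_l; [lra|]; pose proof (Rpower_pos T (/ b)); lra.
    - rewrite Rpower_mult, Rinv_l, Rpower_1 by lra; reflexivity. }
  specialize (HT _ hTs); specialize (H1 (powr s b)).
  change (Rabs (F s - L / b) < eps); unfold F.
  replace (gamma_int b (powr s b) / b - L / b) with (- ((L - gamma_int b (powr s b)) / b)) by (field; lra).
  rewrite Rabs_Ropp, Rabs_pos_eq by (apply Rdiv_le_0_compat; lra).
  apply (Rmult_lt_reg_r b); [exact hb|]; unfold Rdiv; rewrite Rmult_assoc, Rinv_l; lra.
Qed.

(** The lower bound is [1 / (1 - x) <= exp (x / (1 - x))] inverted, with
    [x / (1 - x) <= x + 2 x^2]. *)
Lemma exp_ineq_neg x : 0 <= x <= 1 / 2 -> exp (- (x + 2 * x ^ 2)) <= 1 - x <= exp (- x).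
Proof.
intros h; split; [|pose proof (exp_ineq1_le (- x)); lra].
pose proof (exp_ineq1_le (x / (1 - x))) as a.
replace (1 + x / (1 - x)) with (/ (1 - x)) in a by (field; lra).
assert (e : x / (1 - x) <= x + 2 * x ^ 2).
{ apply (Rmult_le_reg_r (1 - x)); [lra|]; unfold Rdiv; rewrite Rmult_assoc, Rinv_l by lra; simpl; nra. }
apply exp_le_compat in e; rewrite exp_Ropp.
rewrite <- (Rinv_inv (1 - x)); apply Rinv_le_contravar; [apply Rinv_0_lt_compat; lra | lra].
Qed.

(** The substitution [z = n^(-b) y] changes [z^(1/b)] into [y^(1/b) / n], which brings out the
    approximation of [e^(-t)] by powers of [1 - t / n]. *)
Lemma beta_int_scaled b s n : 0 < b -> 0 < s -> 0 < n ->
  Rpower n b * beta_int b s = RInt (fun y => powr (1 - powr y (/ b) / n) s) 0 (Rpower n b).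
Proof.
intros hb hs hn; set (u := Rpower n (- b)).
assert (hu : 0 < u) by apply Rpower_pos.
assert (hnb : 0 < Rpower n b) by apply Rpower_pos.
assert (e : u * Rpower n b = 1) by (unfold u; rewrite Rpower_Ropp, Rinv_l; lra).
assert (Cf : forall y, continuous (fun y => powr (1 - powr y (/ b) / n) s) y).
{ intros y; apply (continuous_comp (fun y => 1 - powr y (/ b) / n) (fun x => powr x s)); [|apply continuous_powr, hs].
  apply (continuous_minus (V := R_NormedModule) (fun _ => 1)); [apply continuous_const|].
  apply (continuous_scal_l (V := R_NormedModule) (fun y => powr y (/ b)) (/ n)).
  apply continuous_powr, Rinv_0_lt_compat, hb. }
pose proof (RInt_comp_lin (V := R_CompleteNormedModule) (beta_kernel b s) u 0 0 (Rpower n b)) as X.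
rewrite Rmult_0_r, !Rplus_0_r, e in X; specialize (X (ex_RInt_beta b s 0 1 hb hs)).
fold (beta_int b s) in X; rewrite <- X.
rewrite (RInt_ext (V := R_CompleteNormedModule) _ (fun y => scal u (powr (1 - powr y (/ b) / n) s))).
- rewrite (RInt_scal (V := R_CompleteNormedModule)).
  + unfold scal; simpl; unfold mult; simpl; rewrite <- Rmult_assoc, (Rmult_comm _ u), e; ring.
  + apply (ex_RInt_continuous (V := R_CompleteNormedModule)); intros; apply Cf.
- rewrite Rmin_left by lra; intros y hy; rewrite Rplus_0_r; f_equal; unfold beta_kernel; f_equal; f_equal.
  rewrite !powr_pos by (try apply Rmult_lt_0_compat; lra).
  rewrite <- Rpower_mult_distr by lra; unfold u; rewrite Rpower_mult.
  replace (- b * / b) with (- (1)) by (field; lra); rewrite Rpower_Ropp, Rpower_1 by lra.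
  unfold Rdiv; ring.
Qed.

(** Dominated convergence by hand. From above, [1 - t / n <= e^(-t / n)] bounds the integrand by the
    gamma kernel; from below, the integral is cut at [T^b], where [exp_ineq_neg] loses only a factor
    tending to 1. *)
Lemma beta_int_limit b s L : 0 < b -> 0 < s -> (forall X, gamma_int b X <= L) ->
  (forall eps, 0 < eps -> exists T, 1 <= T /\ forall X, T <= X -> L - eps < gamma_int b X) ->
  is_lim_seq (fun n => Rpower (INR n) b * beta_int b (s + INR n)) L.
Proof.
intros hb hs H1 H2.
assert (hib : 0 < / b) by (apply Rinv_0_lt_compat, hb).
set (g := fun (n : nat) y => powr (1 - powr y (/ b) / INR n) (s + INR n)).
assert (Cg : forall n x y, (1 <= n)%nat -> ex_RInt (g n) x y).
{ intros n x y hn; assert (hk : 1 <= INR n) by (apply (le_INR 1); exact hn).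
  apply (ex_RInt_continuous (V := R_CompleteNormedModule)); intros z _.
  apply (continuous_comp (fun y => 1 - powr y (/ b) / INR n) (fun x => powr x (s + INR n)));
    [|apply continuous_powr; lra].
  apply (continuous_minus (V := R_NormedModule) (fun _ => 1)); [apply continuous_const|].
  apply (continuous_scal_l (V := R_NormedModule) (fun y => powr y (/ b)) (/ INR n)).
  apply continuous_powr, hib. }
assert (Upper : forall n, (1 <= n)%nat -> Rpower (INR n) b * beta_int b (s + INR n) <= L).
{ intros n hn; assert (hk : 1 <= INR n) by (apply (le_INR 1); exact hn).
  rewrite beta_int_scaled by lra; eapply Rle_trans; [|apply (H1 (Rpower (INR n) b))].
  apply RInt_le; [left; apply Rpower_pos | apply (Cg n); exact hn | apply ex_RInt_gamma, hb |].
  intros y hy; unfold gamma_kernel; set (t := powr y (/ b)).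
  assert (ht : 0 <= t) by apply powr_ge_0.
  destruct (Rle_dec (1 - t / INR n) 0) as [h|h]; [rewrite powr_npos by exact h; left; apply exp_pos|].
  rewrite powr_pos by lra.
  pose proof (exp_ineq1_le (- (t / INR n))) as a.
  apply Rle_trans with (Rpower (exp (- (t / INR n))) (s + INR n)); [apply Rle_Rpower_l; lra|].
  unfold Rpower; rewrite ln_exp; apply exp_le_compat.
  replace ((s + INR n) * - (t / INR n)) with (- t - s * (t / INR n)) by (field; lra).
  assert (0 <= s * (t / INR n)) by (apply Rmult_le_pos; [lra | apply Rdiv_le_0_compat; lra]); lra. }
(* For [0 <= t <= T] the loss in the exponent is at most [(s T + (s + 1) 2 T^2) / n]; [2 T <= n]
   keeps [t / n] within the range of [exp_ineq_neg]. *)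
assert (Lower : forall T, 1 <= T -> forall n, 2 * T <= INR n ->
  exp (- ((s * T + (s + 1) * (2 * T ^ 2)) / INR n)) * gamma_int b (Rpower T b)
    <= Rpower (INR n) b * beta_int b (s + INR n)).
{ intros T hT n hn.
  assert (hn1 : (1 <= n)%nat) by (apply INR_le; simpl; lra).
  assert (hTn : Rpower T b <= Rpower (INR n) b) by (apply Rle_Rpower_l; lra).
  assert (hTp := Rpower_pos T b).
  rewrite beta_int_scaled by lra.
  pose proof (RInt_Chasles (V := R_CompleteNormedModule) (g n) 0 (Rpower T b) (Rpower (INR n) b)
    (Cg n _ _ hn1) (Cg n _ _ hn1)) as Ch.
  change (RInt (g n) 0 (Rpower T b) + RInt (g n) (Rpower T b) (Rpower (INR n) b)
    = RInt (g n) 0 (Rpower (INR n) b)) in Ch.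
  assert (R2 : 0 <= RInt (g n) (Rpower T b) (Rpower (INR n) b)).
  { apply RInt_ge_0; [exact hTn | apply Cg, hn1 | intros; apply powr_ge_0]. }
  set (q := exp (- ((s * T + (s + 1) * (2 * T ^ 2)) / INR n))).
  assert (R1 : q * gamma_int b (Rpower T b) <= RInt (g n) 0 (Rpower T b)).
  { unfold gamma_int.
    pose proof (RInt_scal (V := R_CompleteNormedModule) (gamma_kernel b) 0 (Rpower T b) q (ex_RInt_gamma b _ _ hb)) as E.
    change (RInt (fun x => q * gamma_kernel b x) 0 (Rpower T b) = q * RInt (gamma_kernel b) 0 (Rpower T b)) in E.
    rewrite <- E; apply RInt_le; [lra | | apply Cg, hn1 |].
    - apply (ex_RInt_scal (V := R_NormedModule)), ex_RInt_gamma, hb.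
    - intros y hy; unfold gamma_kernel, g.
      set (t := powr y (/ b)).
      assert (ht : 0 <= t) by apply powr_ge_0.
      assert (htT : t <= T).
      { unfold t; rewrite powr_pos by lra; replace T with (Rpower (Rpower T b) (/ b)).
        - apply Rle_Rpower_l; lra.
        - rewrite Rpower_mult, Rinv_r, Rpower_1 by lra; reflexivity. }
      assert (hx : 0 <= t / INR n <= 1 / 2).
      { split; [apply Rdiv_le_0_compat; lra|]; apply (Rmult_le_reg_r (INR n)); [lra|].
        unfold Rdiv; rewrite Rmult_assoc, Rinv_l; lra. }
      destruct (exp_ineq_neg (t / INR n) hx) as [a _].
      rewrite powr_pos by lra.
      apply Rle_trans with (Rpower (exp (- (t / INR n + 2 * (t / INR n) ^ 2))) (s + INR n));
        [|apply Rle_Rpower_l; [lra | split; [apply exp_pos | exact a]]].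
      unfold Rpower; rewrite ln_exp; unfold q; rewrite <- exp_plus; apply exp_le_compat.
      replace ((s + INR n) * - (t / INR n + 2 * (t / INR n) ^ 2))
        with (- ((s * t + (s / INR n + 1) * (2 * t ^ 2)) / INR n) + - t) by (field; lra).
      apply Rplus_le_compat_r, Ropp_le_contravar.
      apply Rmult_le_compat_r; [left; apply Rinv_0_lt_compat; lra|].
      assert (hsn : s / INR n <= s).
      { apply (Rmult_le_reg_r (INR n)); [lra|]; unfold Rdiv; rewrite Rmult_assoc, Rinv_l by lra; nra. }
      assert (hsn0 : 0 <= s / INR n) by (apply Rdiv_le_0_compat; lra).
      assert (ht2 : t ^ 2 <= T ^ 2) by (apply pow_incr; lra).
      assert (ht0 : 0 <= t ^ 2) by (apply pow_le, ht).
      apply Rplus_le_compat; [apply Rmult_le_compat_l; lra | apply Rmult_le_compat; lra]. }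
  change (q * gamma_int b (Rpower T b) <= RInt (g n) 0 (Rpower (INR n) b)); lra. }
apply is_lim_seq_spec; intros [eps he]; simpl.
destruct (H2 (eps / 2) ltac:(lra)) as [X0 [hX0 HX0]].
set (T := Rmax 1 (Rpower X0 (/ b))).
assert (hT : 1 <= T) by apply Rmax_l.
assert (hTX : X0 <= Rpower T b).
{ replace X0 with (Rpower (Rpower X0 (/ b)) b) by (rewrite Rpower_mult, Rinv_l, Rpower_1; lra).
  apply Rle_Rpower_l; [lra|]; split; [apply Rpower_pos | apply Rmax_r]. }
specialize (HX0 _ hTX).
set (Q := s * T + (s + 1) * (2 * T ^ 2)).
assert (Lim : is_lim_seq (fun n => exp (- (Q / INR n)) * gamma_int b (Rpower T b)) (gamma_int b (Rpower T b))).
{ replace (Finite (gamma_int b (Rpower T b))) with (Rbar_mult (exp (- 0)) (gamma_int b (Rpower T b)))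
    by (simpl; f_equal; rewrite Ropp_0, exp_0; ring).
  apply (is_lim_seq_mult _ _ (exp (- 0)) (gamma_int b (Rpower T b))); [|apply is_lim_seq_const | reflexivity].
  apply is_lim_seq_continuous; [apply derivable_continuous_pt, derivable_pt_exp|].
  apply (is_lim_seq_opp _ (Finite 0)), is_lim_seq_inv_INR. }
apply is_lim_seq_spec in Lim; destruct (Lim (mkposreal (eps / 2) ltac:(lra))) as [N HN]; simpl in HN.
destruct (INR_archimed 1 (2 * T)) as [N2 hN2]; [lra|].
exists (N + N2 + 1)%nat; intros n hn.
assert (hn2 : 2 * T <= INR n).
{ apply Rle_trans with (INR N2); [lra | apply le_INR; lia]. }
specialize (HN n ltac:(lia)); specialize (Lower T hT n hn2); specialize (Upper n ltac:(lia)).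
fold Q in Lower; apply Rabs_lt_between in HN; apply Rabs_def1; lra.
Qed.

(** Descends from [s >= 2] by unit steps: the coefficients with parameter [s + 2] are those with
    parameter [s + 1] times [(s + 1 + n) / (s + 1)], matching the recurrence of [inv_gamma]. *)
Lemma inv_gamma_limit d s : 0 < d <= 1 / 40 -> 0 < s ->
  is_lim_seq (fun n => binom_coef (s + 1) n / Rpower (INR n) s) (inv_gamma d s).
Proof.
intros hd hs.
destruct (INR_archimed 1 (2 - s)) as [j hj]; [lra|].
assert (h : 2 <= s + INR j) by lra; clear hj.
revert s hs h; induction j as [|j IH]; intros s hs h.
- apply binom_coef_limit; [exact hd | simpl in h; lra].
- rewrite S_INR in h; specialize (IH (s + 1) ltac:(lra) ltac:(lra)).
  replace (inv_gamma d s) with ((s + 1) * inv_gamma d (s + 1))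
    by (rewrite <- inv_gamma_rec by lra; f_equal; ring).
  assert (R : forall n, binom_coef (s + 1 + 1) n = binom_coef (s + 1) n * (s + 1 + INR n) / (s + 1)).
  { induction n as [|n IHn]; [simpl; field; lra|].
    change (binom_coef (s + 1 + 1) (S n)) with (binom_coef (s + 1 + 1) n * (INR n + (s + 1 + 1)) / INR (S n)).
    change (binom_coef (s + 1) (S n)) with (binom_coef (s + 1) n * (INR n + (s + 1)) / INR (S n)).
    rewrite IHn, S_INR; pose proof (pos_INR n); field; lra. }
  assert (L1 : is_lim_seq (fun n => 1 + (s + 1) / INR n) 1).
  { replace (Finite 1) with (Finite (1 + 0)) by (f_equal; ring).
    apply is_lim_seq_plus'; [apply is_lim_seq_const | apply is_lim_seq_inv_INR]. }
  assert (L2 := is_lim_seq_div' _ _ _ _ (is_lim_seq_scal_l _ (s + 1) _ IH) L1 R1_neq_R0).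
  simpl in L2; rewrite Rdiv_1_r in L2.
  revert L2; apply is_lim_seq_ext_loc; exists 1%nat; intros n hn.
  assert (hk : 1 <= INR n) by (apply (le_INR 1); exact hn).
  assert (hp := Rpower_pos (INR n) s).
  rewrite R, Rpower_plus, Rpower_1 by lra; field; repeat split; lra.
Qed.

(** The limit of [beta_int_shift] divided by [n^s]. As [beta_int b s] is [b B(b, s + 1)], it is the
    classical formula for the beta function in terms of Gamma. *)
Lemma beta_int_Gamma d b s : 0 < d <= 1 / 40 -> 0 < b -> 0 < s ->
  beta_int b s * inv_gamma d s = b * Gamma b * inv_gamma d (s + b).
Proof.
intros hd hb hs.
destruct (gamma_int_limit b hb) as [L [H1 H2]].
rewrite (Gamma_gamma_int b L hb H1 H2); replace (b * (L / b)) with L by (field; lra).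
pose proof (beta_int_limit b s L hb hs H1 H2) as B.
pose proof (is_lim_seq_mult' _ _ _ _ B (inv_gamma_limit d (s + b) hd ltac:(lra))) as X.
pose proof (is_lim_seq_mult' _ _ _ _ (is_lim_seq_const (beta_int b s)) (inv_gamma_limit d s hd hs)) as Y.
apply (is_lim_seq_ext_loc _ (fun n => Rpower (INR n) b * beta_int b (s + INR n) *
  (binom_coef (s + b + 1) n / Rpower (INR n) (s + b)))) in Y.
- exact (is_lim_seq_inj _ _ _ Y X).
- exists 1%nat; intros n hn.
  assert (hk : 1 <= INR n) by (apply (le_INR 1); exact hn).
  rewrite Rpower_plus.
  assert (p1 := Rpower_pos (INR n) s); assert (p2 := Rpower_pos (INR n) b).
  replace (beta_int b s * (binom_coef (s + 1) n / Rpower (INR n) s))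
    with (beta_int b s * binom_coef (s + 1) n / Rpower (INR n) s) by (field; lra).
  rewrite (beta_int_shift b s n hb hs); field; lra.
Qed.

(** The normalisation [1 / Gamma (2) = 1], read off from the coefficients [n + 1] of
    [(1 - z)^(-2)]. *)
Lemma inv_gamma_1 d : 0 < d <= 1 / 40 -> inv_gamma d 1 = 1.
Proof.
intros hd; pose proof (inv_gamma_limit d 1 hd Rlt_0_1) as X.
assert (E : forall n, binom_coef (1 + 1) n = INR n + 1).
{ induction n as [|n IH]; [simpl; ring|].
  change (binom_coef (1 + 1) (S n)) with (binom_coef (1 + 1) n * (INR n + (1 + 1)) / INR (S n)).
  rewrite IH, S_INR; pose proof (pos_INR n); field; lra. }
assert (Y : is_lim_seq (fun n => 1 + 1 / INR n) 1).
{ replace (Finite 1) with (Finite (1 + 0)) by (f_equal; ring).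
  apply is_lim_seq_plus'; [apply is_lim_seq_const | apply is_lim_seq_inv_INR]. }
apply (is_lim_seq_ext_loc _ (fun n => binom_coef (1 + 1) n / Rpower (INR n) 1)) in Y.
- exact (is_lim_seq_inj _ _ _ X Y).
- exists 1%nat; intros n hn.
  assert (hk : 1 <= INR n) by (apply (le_INR 1); exact hn).
  rewrite E, Rpower_1 by lra; field; lra.
Qed.

(** At [s = 1] the beta identity has a positive left side and [Gamma b] as a factor on the right. *)
Lemma Gamma_neq_0 b : 0 < b -> Gamma b <> 0.
Proof.
intros hb e.
pose proof (beta_int_Gamma (1 / 40) b 1 ltac:(lra) hb Rlt_0_1) as X.
rewrite inv_gamma_1, e in X by lra; pose proof (beta_int_pos b 1 hb Rlt_0_1); lra.
Qed.

(** The beta identity with parameters [s] and 1 makes [inv_gamma d (1 + s)] nonzero; the recurrence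
    then goes down one step with factor [1 + s]. *)
Lemma inv_gamma_neq_0 d s : 0 < d <= 1 / 40 -> 0 < s -> inv_gamma d s <> 0.
Proof.
intros hd hs e.
pose proof (beta_int_Gamma d s 1 hd hs Rlt_0_1) as X.
rewrite inv_gamma_1 in X by exact hd; pose proof (beta_int_pos s 1 hs Rlt_0_1).
replace s with (1 + s - 1) in e by ring.
rewrite inv_gamma_rec in e by lra; apply Rmult_integral in e; destruct e as [e|e]; [lra|].
rewrite e in X; lra.
Qed.

(** * The Hadamard operator on powers of the logarithm *)

Lemma is_derive_ln_div_l a x : 0 < a -> 0 < x -> is_derive (fun x => ln (x / a)) x (/ x).
Proof.
intros ha hx; auto_derive; [apply Rdiv_lt_0_compat; assumption | field; lra].
Qed.

Lemma is_derive_ln_div_r t x : 0 < t -> 0 < x -> is_derive (fun x => ln (t / x)) x (- / x).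
Proof.
intros ht hx; auto_derive; [|field; lra].
split; [apply Rgt_not_eq, hx | split; [apply Rdiv_lt_0_compat; assumption | trivial]].
Qed.

Lemma ln_div_pos x y : 0 < x -> x < y -> 0 < ln (y / x).
Proof.
intros hx h; rewrite <- ln_1; apply ln_increasing; [lra|].
apply (Rmult_lt_reg_r x); [exact hx|]; unfold Rdiv; rewrite Rmult_assoc, Rinv_l; lra.
Qed.

Lemma continuous_ex_derive (f : R -> R) x l : is_derive f x l -> continuous f x.
Proof. intros H; apply (ex_derive_continuous (V := R_NormedModule)); exists l; exact H. Qed.

(** With [v = log (t / x) / L], the variable [v^b] of [beta_int] yields the primitive [- q P (v^b)];
    the sign reflects that [v] falls from 1 to 0 as [x] runs from [a] to [t]. *)
Lemma hadamard_kernel_int_power a b s t : 0 < a -> a < t -> 0 < b -> 0 < s ->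
  hadamard_kernel_int a b (fun t => powr (ln (t / a)) s) t
  = beta_int b s / b * Rpower (ln (t / a)) (b + s).
Proof.
intros ha hat hb hs.
set (L := ln (t / a)); assert (hL : 0 < L) by (apply ln_div_pos; lra).
set (P := fun X => RInt (beta_kernel b s) 0 X).
assert (DP : forall X, is_derive P X (beta_kernel b s X)).
{ intros X; apply (is_derive_RInt (beta_kernel b s) P 0 X); [|apply continuous_beta_kernel; assumption].
  apply filter_forall; intros y; apply (RInt_correct (V := R_CompleteNormedModule)), ex_RInt_beta; assumption. }
set (q := Rpower L (b + s) / b).
set (F := fun x => - q * P (powr (ln (t / x) / L) b)).
assert (CF : forall x, 0 < x -> continuous F x).
{ intros x hx; unfold F.
  apply (continuous_scal_r (V := R_NormedModule) (- q)).
  apply (continuous_comp (fun x => powr (ln (t / x) / L) b) P);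
    [|apply (continuous_ex_derive _ _ _ (DP _))].
  apply (continuous_comp (fun x => ln (t / x) / L) (fun v => powr v b)); [|apply continuous_powr, hb].
  apply (continuous_scal_l (V := R_NormedModule) (fun x => ln (t / x)) (/ L)).
  apply (continuous_ex_derive _ _ (- / x)), is_derive_ln_div_r; lra. }
unfold hadamard_kernel_int.
apply (is_RInt_gen_unique (V := R_CompleteNormedModule) (Fa := at_right a) (Fb := at_left t)).
replace (beta_int b s / b * Rpower L (b + s)) with (F t - F a).
2:{ unfold F; replace (t / t) with 1 by (field; lra); rewrite ln_1.
    replace (0 / L) with 0 by (field; lra); fold L.
    replace (L / L) with 1 by (field; lra); rewrite powr_1, powr_npos by lra.
    assert (P0 : P 0 = 0) by exact (RInt_point (V := R_CompleteNormedModule) 0 _).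
    rewrite P0; change (P 1) with (beta_int b s); unfold q; field; lra. }
apply (is_RInt_gen_primitive (at_right a) (at_left t) F).
- exists (fun x => a < x < t) (fun y => a < y < t).
  + unfold at_right, within; generalize (locally_lt t a hat); apply filter_imp; intros x h1 h2; split; assumption.
  + unfold at_left, within; generalize (locally_gt a t hat); apply filter_imp; intros x h1 h2; split; assumption.
  + intros x y hx hy z hz; simpl in hz.
    assert (hz' : a < z < t).
    { pose proof (Rmin_glb_lt x y a ltac:(lra) ltac:(lra)).
      pose proof (Rmax_lub_lt x y t ltac:(lra) ltac:(lra)); lra. }
    clear x y hx hy hz.
    assert (hz0 : 0 < z) by lra.
    assert (hl1 : 0 < ln (t / z)) by (apply ln_div_pos; lra).
    assert (hl2 : 0 < ln (z / a)) by (apply ln_div_pos; lra).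
    assert (hsum : ln (t / z) + ln (z / a) = L).
    { rewrite <- ln_mult by (apply Rdiv_lt_0_compat; lra); unfold L; f_equal; field; lra. }
    split.
    * set (v := ln (t / z) / L).
      assert (hv : 0 < v) by (apply Rdiv_lt_0_compat; assumption).
      assert (D0 : is_derive (fun x => ln (t / x) / L) z (- / z * / L)).
      { apply (is_derive_scal_l (V := R_NormedModule) (fun x => ln (t / x)) z (- / z) (/ L)).
        apply is_derive_ln_div_r; lra. }
      assert (D1 := is_derive_comp (V := R_NormedModule) (fun v => powr v b) (fun x => ln (t / x) / L) z _ _
        (is_derive_powr v b hv) D0).
      assert (D2 := is_derive_comp (V := R_NormedModule) P (fun x => powr (ln (t / x) / L) b) z _ _
        (DP (powr v b)) D1).
      apply (is_derive_scal _ z (- q)) in D2.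
      replace (powr (ln (t / z)) (b - 1) * powr (ln (z / a)) s / z)
        with (- q * scal (scal (- / z * / L) (b * Rpower v (b - 1))) (beta_kernel b s (powr v b))); [exact D2|].
      unfold scal; simpl; unfold mult; simpl; unfold beta_kernel.
      assert (e1 : powr (powr v b) (/ b) = v).
      { rewrite (powr_pos v) by exact hv; rewrite powr_pos by apply Rpower_pos.
        rewrite Rpower_mult, Rinv_r, Rpower_1 by lra; reflexivity. }
      assert (e2 : 1 - v = ln (z / a) / L) by (unfold v; rewrite <- hsum; field; lra).
      rewrite e1, e2, !powr_pos by (try apply Rdiv_lt_0_compat; assumption).
      unfold v, q, Rdiv.
      assert (hiL : 0 < / L) by (apply Rinv_0_lt_compat, hL).
      rewrite <- !Rpower_mult_distr by assumption.
      assert (inv : forall e, Rpower (/ L) e = / Rpower L e).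
      { intros e; unfold Rpower; rewrite ln_Rinv, <- exp_Ropp by exact hL; f_equal; ring. }
      unfold Rminus; rewrite !inv, !Rpower_plus, !Rpower_Ropp, !Rpower_1 by assumption.
      assert (p1 := Rpower_pos L b); assert (p2 := Rpower_pos L s).
      field; repeat split; lra.
    * apply (continuous_mult (K := R_AbsRing) (fun x => powr (ln (t / x)) (b - 1) * powr (ln (x / a)) s)).
      -- apply (continuous_mult (K := R_AbsRing) (fun x => powr (ln (t / x)) (b - 1))).
         ++ apply (continuous_comp (fun x => ln (t / x)) (fun v => powr v (b - 1))).
            ** apply (continuous_ex_derive _ _ (- / z)), is_derive_ln_div_r; lra.
            ** apply (continuous_ex_derive _ _ _ (is_derive_powr _ _ hl1)).
         ++ apply (continuous_comp (fun x => ln (x / a)) (fun v => powr v s)).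
            ** apply (continuous_ex_derive _ _ (/ z)), is_derive_ln_div_l; lra.
            ** apply continuous_powr, hs.
      -- apply continuous_Rinv; lra.
- apply (filterlim_filter_le_1 (F := locally a)); [apply filter_le_within | apply CF, ha].
- apply (filterlim_filter_le_1 (F := locally t)); [apply filter_le_within | apply CF; lra].
Qed.

Lemma is_derive_Rpower_ln a t e : 0 < a -> a < t ->
  is_derive (fun t => Rpower (ln (t / a)) e) t (/ t * (e * Rpower (ln (t / a)) (e - 1))).
Proof.
intros ha hat.
apply (is_derive_ext_loc (fun t => powr (ln (t / a)) e)).
- apply (filter_imp (fun y => a < y)); [|apply locally_gt, hat].
  intros y hy; apply powr_pos, ln_div_pos; assumption.
- apply (is_derive_comp (V := R_NormedModule) (fun v => powr v e) (fun t => ln (t / a)) t).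
  + apply is_derive_powr, ln_div_pos; assumption.
  + apply is_derive_ln_div_l; lra.
Qed.

(** Each [delta] multiplies by the current exponent, which is one step of the recurrence of
    [inv_gamma]. Recording the product as a value of [inv_gamma] keeps it correct when an exponent
    reaches 0. *)
Lemma iter_delta_power d a f c e j : 0 < d -> 0 < a -> inv_gamma d e <> 0 ->
  (forall t, a < t -> f t = c * Rpower (ln (t / a)) e) ->
  forall t, a < t -> Nat.iter j delta f t
    = c * inv_gamma d (e - INR j) / inv_gamma d e * Rpower (ln (t / a)) (e - INR j).
Proof.
intros hd ha hr Hf; induction j as [|j IH]; intros t ht.
- simpl; rewrite Rminus_0_r, Hf by exact ht; field; exact hr.
- change (Nat.iter (S j) delta f t) with (t * Derive (Nat.iter j delta f) t).
  rewrite (Derive_ext_loc _ (fun t => c * inv_gamma d (e - INR j) / inv_gamma d e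
     * Rpower (ln (t / a)) (e - INR j))).
  2:{ apply (filter_imp (fun y => a < y)); [exact IH | apply locally_gt, ht]. }
  pose proof (is_derive_unique _ t _ (is_derive_scal _ t
    (c * inv_gamma d (e - INR j) / inv_gamma d e) _ (is_derive_Rpower_ln a t (e - INR j) ha ht))) as D.
  etransitivity; [apply f_equal; exact D|].
  rewrite S_INR; replace (e - (INR j + 1)) with (e - INR j - 1) by ring.
  rewrite inv_gamma_rec by exact hd; unfold mult; simpl; field; split; [exact hr | lra].
Qed.

(** For [alpha < 0] this is the beta identity. For [alpha > 0] the integral of order [m - alpha]
    raises the exponent and the [m] derivatives lower it; if [s - alpha] is a negative integer both
    sides are 0. *)
Lemma hadamard_power d a alpha s t : 0 < d <= 1 / 40 -> 0 < a -> a < t -> 0 < s ->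
  (forall k : nat, alpha <> INR k) ->
  hadamard a alpha (fun t => powr (ln (t / a)) s) t
  = inv_gamma d (s - alpha) / inv_gamma d s * Rpower (ln (t / a)) (s - alpha).
Proof.
intros hd ha hat hs hal.
assert (r0 := inv_gamma_neq_0 d s hd hs).
unfold hadamard; destruct (Rlt_dec alpha 0) as [h|h].
- unfold hadamard_integral.
  rewrite hadamard_kernel_int_power by lra.
  replace (- alpha + s) with (s - alpha) by ring.
  pose proof (beta_int_Gamma d (- alpha) s hd ltac:(lra) hs) as X.
  replace (s + - alpha) with (s - alpha) in X by ring.
  assert (g0 := Gamma_neq_0 (- alpha) ltac:(lra)).
  assert (Y : beta_int (- alpha) s = - alpha * Gamma (- alpha) * inv_gamma d (s - alpha) / inv_gamma d s).
  { rewrite <- X; field; exact r0. }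
  rewrite Y; field; repeat split; try assumption; lra.
- assert (ha0 : 0 < alpha) by (pose proof (hal 0%nat) as e; simpl in e; lra).
  unfold hadamard_derivative; cbv zeta.
  destruct (archimed alpha) as [u1 u2].
  set (m := Z.to_nat (up alpha)).
  assert (hm : INR m = IZR (up alpha)).
  { unfold m; rewrite INR_IZR_INZ, Z2Nat.id; [reflexivity|]; apply le_IZR; lra. }
  set (b := INR m - alpha); assert (hb : 0 < b) by (unfold b; lra).
  assert (rb := inv_gamma_neq_0 d (b + s) hd ltac:(lra)).
  rewrite (iter_delta_power d a _ (beta_int b s / b) (b + s) m ltac:(lra) ha rb); [| |exact hat].
  2:{ intros x hx; apply hadamard_kernel_int_power; assumption. }
  replace (b + s - INR m) with (s - alpha) by (unfold b; ring).
  pose proof (beta_int_Gamma d b s hd hb hs) as X; rewrite (Rplus_comm s b) in X.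
  assert (g0 := Gamma_neq_0 b hb).
  assert (Y : beta_int b s = b * Gamma b * inv_gamma d (b + s) / inv_gamma d s).
  { rewrite <- X; field; exact r0. }
  rewrite Y; field; repeat split; try assumption; lra.
Qed.

(** * The discrete convolution of a power, and the error estimate *)

Lemma Rsum_shift f n : Rsum f (S n) = f 0%nat + Rsum (fun k => f (S k)) n.
Proof.
induction n as [|n IH]; [simpl; ring|].
change (Rsum f (S (S n))) with (Rsum f (S n) + f (S n)); rewrite IH; simpl; ring.
Qed.

Lemma sum_f_R0_rev (f : nat -> R) n : sum_f_R0 f n = Rsum (fun m => f (n - m)%nat) (S n).
Proof.
induction n as [|n IH]; [simpl; ring|].
rewrite Rsum_shift; simpl sum_f_R0; rewrite IH, Rplus_comm, Nat.sub_0_r; f_equal.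
Qed.

Lemma Rsum_ext f g n : (forall m, (m < n)%nat -> f m = g m) -> Rsum f n = Rsum g n.
Proof.
induction n as [|n IH]; intros H; simpl; [reflexivity|].
rewrite IH, H by (intros; try apply H; lia); reflexivity.
Qed.

Lemma ln_node a T N k : 0 < a -> a < T -> ln (node a T N k / a) = INR k * step a T N.
Proof.
intros ha hT; unfold node, step.
replace (a * Rpower (T / a) (INR k / INR N) / a) with (Rpower (T / a) (INR k / INR N)) by (field; lra).
unfold Rpower; rewrite ln_exp; unfold Rdiv; ring.
Qed.

Lemma node_gt a T N n : 0 < a -> a < T -> (1 <= n)%nat -> (1 <= N)%nat -> a < node a T N n.
Proof.
intros ha hT hn hN; unfold node.
assert (hL := ln_div_pos a T ha hT).
assert (1 < Rpower (T / a) (INR n / INR N)); [|nra].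
unfold Rpower; rewrite <- exp_0; apply exp_increasing.
apply Rmult_lt_0_compat; [|exact hL]; apply Rdiv_lt_0_compat; apply lt_0_INR; lia.
Qed.

Lemma discrete_convolution_power a T alpha sigma omega N n : 0 < a -> a < T -> (1 <= N)%nat ->
  discrete_convolution a T alpha omega (fun t => powr (ln (t / a)) sigma) N n
  = Rpower (step a T N) (sigma - alpha)
    * Rsum (fun m => omega m * Rpower (INR n - INR m) sigma) n.
Proof.
intros ha hT hN.
assert (ht : 0 < step a T N).
{ apply Rmult_lt_0_compat; [apply Rinv_0_lt_compat, lt_0_INR; lia | apply ln_div_pos; assumption]. }
unfold discrete_convolution; set (tau := step a T N) in *.
rewrite sum_f_R0_rev; simpl Rsum.
(* The node [a] drops out because [powr 0 sigma] is 0, so the sum runs over [m < n] only. *)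
rewrite Nat.sub_diag, ln_node by assumption; simpl INR; rewrite Rmult_0_l, powr_npos, Rmult_0_r, Rplus_0_r by lra.
replace (sigma - alpha) with (- alpha + sigma) by ring; rewrite Rpower_plus, Rmult_assoc; f_equal.
rewrite <- Rsum_scal; apply Rsum_ext; intros m hm.
rewrite ln_node by assumption; fold tau.
replace (n - (n - m))%nat with m by lia.
assert (hk : 0 < INR (n - m)) by (apply lt_0_INR; lia).
rewrite powr_pos by (apply Rmult_lt_0_compat; assumption).
rewrite <- Rpower_mult_distr, minus_INR by (try assumption; lia); ring.
Qed.

Theorem theorem3p2 :
  forall (a T : R) (p : nat) (alpha sigma : R) (omega : nat -> R) (W : C -> C),
    0 < a -> a < T ->
    (0 < p)%nat ->
    (forall k : nat, alpha <> INR k) ->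
    0 < sigma ->
    generating_function omega W ->
    stable alpha omega ->
    consistent alpha p W ->
    let u := fun t : R => powr (ln (t / a)) sigma in
    exists K1 K2 : R,
      forall N n : nat, (1 <= n)%nat -> (n <= N)%nat ->
        let tau := step a T N in
        let t := node a T N n in
        Rabs (discrete_convolution a T alpha omega u N n - hadamard a alpha u t)
        <= K1 * (Rpower (ln (t / a)) (- alpha - 1) * Rpower tau (sigma + 1))
           + K2 * (Rpower (ln (t / a)) (- alpha + sigma - INR p) * tau ^ p).
Proof.
intros a T p alpha sigma omega W ha hT hp hal hs GF St Co u.
destruct (weighted_power_sum omega W alpha p sigma hs GF St Co) as (d & Cst & hd & hC & H).
assert (r0 := inv_gamma_neq_0 d sigma hd hs).
set (r := inv_gamma d sigma) in *.
assert (hr : 0 < Rabs r) by (apply Rabs_pos_lt, r0).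
(* The estimate [H] concerns [r] times the error in units of the step, so [r] is divided out. *)
exists (Cst / Rabs r), (Cst / Rabs r); intros N n hn hnN tau t.
assert (ht : 0 < tau).
{ apply Rmult_lt_0_compat; [apply Rinv_0_lt_compat, lt_0_INR; lia | apply ln_div_pos; assumption]. }
assert (hk : 0 < INR n) by (apply lt_0_INR; lia).
unfold u; rewrite discrete_convolution_power by (try assumption; lia).
rewrite (hadamard_power d) by (try assumption; apply node_gt; try assumption; lia).
unfold t; rewrite ln_node by assumption; fold tau r.
specialize (H n hn); fold r in H.
set (Sn := Rsum (fun m => omega m * Rpower (INR n - INR m) sigma) n) in *.
set (r' := inv_gamma d (sigma - alpha)) in *.
rewrite <- !Rpower_mult_distr by assumption.
replace (- alpha + sigma - INR p) with (sigma - alpha - INR p) by ring.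
set (k := INR n) in *.
replace (Rpower tau (sigma - alpha) * Sn - r' / r * (Rpower k (sigma - alpha) * Rpower tau (sigma - alpha)))
  with (Rpower tau (sigma - alpha) / r * (r * Sn - r' * Rpower k (sigma - alpha))) by (field; exact r0).
assert (hpt := Rpower_pos tau (sigma - alpha)).
rewrite Rabs_mult, Rabs_div, (Rabs_pos_eq (Rpower tau (sigma - alpha))) by (try exact r0; lra).
apply Rle_trans with (Rpower tau (sigma - alpha) / Rabs r
  * (Cst * (Rpower k (- alpha - 1) + Rpower k (sigma - alpha - INR p)))).
{ apply Rmult_le_compat_l; [apply Rdiv_le_0_compat; lra | exact H]. }
right.
(* Since [log (t_n / a) = n tau], each error term is a power of [n] times the common factor
   [tau^(sigma - alpha)]. *)
assert (e1 : Rpower tau (- alpha - 1) * Rpower tau (sigma + 1) = Rpower tau (sigma - alpha))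
  by (rewrite <- Rpower_plus; f_equal; ring).
assert (e2 : Rpower tau (sigma - alpha - INR p) * tau ^ p = Rpower tau (sigma - alpha))
  by (rewrite <- Rpower_pow, <- Rpower_plus by exact ht; f_equal; ring).
rewrite (Rmult_assoc (Rpower k (- alpha - 1))), e1, (Rmult_assoc (Rpower k (sigma - alpha - INR p))), e2.
field; lra.
Qed.
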